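(* Fix $w\in\mathbb{C}_{1/2}$ and let $\alpha=\operatorname{Re}(w)-1/2$. Then \[\sup_{\substack{\varphi\in\mathscr{G}\\ \varphi(+\infty)=w}}\|\mathscr{C}_\varphi\| = \sqrt{\|B_\alpha\|},\] where $\|\mathscr{C}_\varphi\|$ is the operator norm of $\mathscr{C}_\varphi$ on $\mathscr{H}^2$.
   Context: For real $\theta$, $\mathbb{C}_\theta=\{s\in\mathbb{C}:\operatorname{Re}(s)>\theta\}$. $\mathscr{H}^2$ is the Hilbert space of Dirichlet series $f(s)=\sum_{n\geq1}a_n n^{-s}$ with $\|f\|_{\mathscr{H}^2}:=\left(\sum_{n\geq1}|a_n|^2\right)^{1/2}<\infty$; such series converge absolutely in $\mathbb{C}_{1/2}$. The Gordon--Hedenmalm class $\mathscr{G}$ consists of symbols of the form $\varphi(s)=c_0 s+\sum_{n=1}^\infty c_n n^{-s}=:c_0 s+\varphi_0(s)$, where $c_0$ is a non-negative integer, the Dirichlet series $\varphi_0$ converges uniformly in $\mathbb{C}_\varepsilon$ for every $\varepsilon>0$, and: (a) if $c_0=0$, then $\varphi_0(\mathbb{C}_0)\subset\mathbb{C}_{1/2}$; (b) if $c_0\geq1$, then $\varphi_0\equiv0$ or $\varphi_0(\mathbb{C}_0)\subset\mathbb{C}_0$. Here $\varphi(+\infty)$ is the limit of $\varphi(s)$ as $\operatorname{Re}(s)\to+\infty$; it equals $c_1$ if $c_0=0$ and $+\infty$ if $c_0\geq1$. For $\varphi\in\mathscr{G}$, the composition operator $\mathscr{C}_\varphi f=f\circ\varphi$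 maps $\mathscr{H}^2$ boundedly into $\mathscr{H}^2$ (theorem of Gordon and Hedenmalm). For $0<\alpha<\infty$, $B_\alpha(a,b):=\sum_{m=1}^\infty\sum_{n=1}^\infty a_m b_n\frac{(mn)^{\alpha-1/2}}{[\max(m,n)]^{2\alpha}}$, and $\|B_\alpha\|$ is the smallest positive number $C_\alpha$ such that $|B_\alpha(a,b)|\leq C_\alpha\|a\|_{\ell^2}\|b\|_{\ell^2}$ for all $a,b\in\ell^2$ (complex sequences indexed by the positive integers). *)

(* Defs.v *)
From Stdlib Require Import Reals.
From Coquelicot Require Import Coquelicot.
Open Scope R_scope.

(* Sequences indexed by the positive integers are encoded as nat -> C with a
   shift by one: [a n] stands for a_{n+1}. *)

Definition halfplane (theta : R) (s : C) : Prop := theta < Re s.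

Definition Cexp (z : C) : C := (exp (Re z) * cos (Im z), exp (Re z) * sin (Im z)).

(* [npow_neg n s] is (n+1)^{-s}. *)
Definition npow_neg (n : nat) (s : C) : C := Cexp (- s * RtoC (ln (INR (S n)))).

Definition dirichlet_term (a : nat -> C) (s : C) (n : nat) : C :=
  (a n * npow_neg n s)%C.

Definition ell2 (a : nat -> C) : Prop := ex_series (fun n => Cmod (a n) ^ 2).

Definition ell2_norm (a : nat -> C) : R := sqrt (Series (fun n => Cmod (a n) ^ 2)).

(* f belongs to H^2 with coefficients a; its norm is then [ell2_norm a].  The
   values of f outside C_{1/2} are irrelevant. *)
Definition in_H2 (f : C -> C) (a : nat -> C) : Prop :=
  ell2 a /\
  forall s : C, halfplane (1 / 2) s -> is_series (dirichlet_term a s) (f s).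

Definition dirichlet_cv_unif (c : nat -> C) (D : C -> Prop) (g : C -> C) : Prop :=
  forall eta : R, 0 < eta ->
    exists N : nat, forall n : nat, (N <= n)%nat ->
      forall s : C, D s -> Cmod (sum_n (dirichlet_term c s) n - g s) < eta.

(* Only the values of phi on C_0 matter. *)
Definition gordon_hedenmalm (phi : C -> C) : Prop :=
  exists (c0 : nat) (c : nat -> C) (phi0 : C -> C),
    (forall s : C, halfplane 0 s -> phi s = (RtoC (INR c0) * s + phi0 s)%C) /\
    (forall eps : R, 0 < eps -> dirichlet_cv_unif c (halfplane eps) phi0) /\
    (c0 = 0%nat -> forall s : C, halfplane 0 s -> halfplane (1 / 2) (phi0 s)) /\
    ((1 <= c0)%nat ->
       (forall s : C, halfplane 0 s -> phi0 s = 0%C) \/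
       (forall s : C, halfplane 0 s -> halfplane 0 (phi0 s))).

Definition Re_infty : (C -> Prop) -> Prop :=
  fun P => exists M : R, forall s : C, M < Re s -> P s.

(* phi(+oo) = w for a finite w. *)
Definition value_at_infty (phi : C -> C) (w : C) : Prop :=
  filterlim phi Re_infty (locally w).

(* K >= 0 bounds the composition operator f |-> f o phi on H^2; the existence
   of b expresses that f o phi belongs to H^2. *)
Definition comp_bound (phi : C -> C) (K : R) : Prop :=
  0 <= K /\
  forall (f : C -> C) (a : nat -> C), in_H2 f a ->
    exists b : nat -> C,
      in_H2 (fun s => f (phi s)) b /\ ell2_norm b <= K * ell2_norm a.

(* The operator norm, equal to +oo when the operator does not map H^2
   boundedly into H^2. *)
Definition comp_norm (phi : C -> C) : Rbar := Glb_Rbar (comp_bound phi).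

Definition B_kernel (alpha : R) (m n : nat) : R :=
  Rpower (INR (S m) * INR (S n)) (alpha - 1 / 2)
    / Rpower (INR (Nat.max (S m) (S n))) (2 * alpha).

(* The iterated series defining B_alpha(a, b) converges to v. *)
Definition is_B (alpha : R) (a b : nat -> C) (v : C) : Prop :=
  exists u : nat -> C,
    (forall m : nat,
       is_series (fun n => (a m * b n * RtoC (B_kernel alpha m n))%C) (u m)) /\
    is_series u v.

Definition B_bound (alpha K : R) : Prop :=
  0 < K /\
  forall a b : nat -> C, ell2 a -> ell2 b ->
    exists v : C, is_B alpha a b v /\ Cmod v <= K * ell2_norm a * ell2_norm b.

Definition is_B_norm (alpha N : R) : Prop :=
  B_bound alpha N /\ forall K : R, B_bound alpha K -> N <= K.

(* Main.v *)
Require Import Defs.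
From Stdlib Require Import Reals Lra Lia ZArith ClassicalEpsilon FunctionalExtensionality.
From Coquelicot Require Import Coquelicot.
Open Scope R_scope.

(** A finite value at infinity forces [c0 = 0].  Put [psi = phi - 1/2] and
    [alpha = Re w - 1/2], so that the partial sums of [f o phi] are
    [sum_n c_n e^{- psi ln n}] with [c_n = a_n n^{-1/2}].  Norms in H^2 are mean
    values of |.|^2 along vertical lines, and the mean of a Dirichlet series
    is its value at infinity.  Nesting the sum as
    [h_k = c_k + e^{- (ln (k+1) - ln k) psi} h_{k+1}] gives
    [|h_k|^2 = |c_k|^2 + 2 Re (conj c_k * e^{...} h_{k+1}) + |e^{...} h_{k+1}|^2],
    where the mean of the middle term depends on [w] only, and the last term is at
    most [|h_{k+1}|^2] because [Re psi >= 0].  Telescoping bounds the norm of the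
    partial sum by [B_alpha(a', conj a')], [a'_n] being [a_n n^{- i Im w}].  For
    the conformal map of C_0 in [2^{-s}] onto C_{1/2}, [e^{- d psi}] is
    unimodular almost everywhere on the boundary and every step is an
    equality. *)

(** Integration and boundary values are avoided: averages over an arithmetic progression on a line
    Re s = sigma with sigma > 0 replace integral means. The coefficients of f o phi are never
    computed either. Every function involved is a uniform limit of Dirichlet polynomials on each C_e
    with e > 0, this class is closed under products and exponentials, and coefficients are recovered
    afterwards from mean squares. The nesting matters because e^{- (ln (k+1) - ln k) psi} is a
    bounded function of the class, so that the cross terms stay inside it; expanding the square of
    the whole sum would produce products of n^{- psi} with conjugates of m^{- psi}, whose means are
    not determined by w. On the side of B_alpha it is enough to treat the quadratic form on finite
    real sequences: positivity and symmetry of the kernel give the bilinear form with the same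
    constant. For the extremal symbol equality is only asymptotic: on Re s = sigma unimodularity
    fails, mostly near 2^{-s} = -1, and an auxiliary function with small mean controls the loss
    there. *)

(* [sum_n] has type [AbelianMonoid.sort _], on which [ring] fails. *)
Ltac rring := match goal with |- @eq _ ?x ?y => change (@eq R x y); ring end.
Ltac cring := match goal with |- @eq _ ?x ?y => change (@eq C x y); ring end.

(** * Finite sums and complex limits *)

Lemma sumR_S (u : nat -> R) (n : nat) : sum_n u (S n) = sum_n u n + u (S n).
Proof. exact (sum_Sn u n). Qed.

Lemma sumC_S (u : nat -> C) (n : nat) : sum_n u (S n) = (sum_n u n + u (S n))%C.
Proof. exact (sum_Sn u n). Qed.

Lemma sumR_0 (u : nat -> R) : sum_n u 0 = u 0%nat.
Proof. exact (sum_O u). Qed.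

Lemma sumC_0 (u : nat -> C) : sum_n u 0 = u 0%nat.
Proof. exact (sum_O u). Qed.

Lemma sumR_plus (u v : nat -> R) (n : nat) :
  sum_n (fun k => u k + v k) n = sum_n u n + sum_n v n.
Proof. exact (sum_n_plus u v n). Qed.

Lemma sumC_plus (u v : nat -> C) (n : nat) :
  sum_n (fun k => u k + v k)%C n = (sum_n u n + sum_n v n)%C.
Proof. exact (sum_n_plus u v n). Qed.

Lemma sumR_scal (c : R) (u : nat -> R) (n : nat) :
  sum_n (fun k => c * u k) n = c * sum_n u n.
Proof. exact (sum_n_mult_l (K := R_Ring) c u n). Qed.

Lemma sumC_scal (c : C) (u : nat -> C) (n : nat) :
  sum_n (fun k => c * u k)%C n = (c * sum_n u n)%C.
Proof. exact (sum_n_mult_l (K := C_Ring) c u n). Qed.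

Lemma sumC_scal_r (c : C) (u : nat -> C) (n : nat) :
  sum_n (fun k => u k * c)%C n = (sum_n u n * c)%C.
Proof. exact (sum_n_mult_r (K := C_Ring) c u n). Qed.

Lemma sumR_first (u : nat -> R) (n : nat) :
  sum_n u (S n) = u 0%nat + sum_n (fun i => u (S i)) n.
Proof.
  induction n as [|n IH].
  - rewrite sumR_S, !sumR_0; rring.
  - rewrite sumR_S, IH, sumR_S; rring.
Qed.

Lemma sumC_first (u : nat -> C) (n : nat) :
  sum_n u (S n) = (u 0%nat + sum_n (fun i => u (S i)) n)%C.
Proof.
  induction n as [|n IH].
  - rewrite sumC_S, !sumC_0; cring.
  - rewrite sumC_S, IH, sumC_S; cring.
Qed.

Lemma sumR_le (u v : nat -> R) (n : nat) :
  (forall k, (k <= n)%nat -> u k <= v k) -> sum_n u n <= sum_n v n.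
Proof.
  induction n as [|n IH]; intros H.
  - rewrite !sumR_0; apply H; lia.
  - rewrite !sumR_S. apply Rplus_le_compat; [apply IH; intros; apply H; lia | apply H; lia].
Qed.

Lemma sumR_nonneg (u : nat -> R) (n : nat) :
  (forall k, 0 <= u k) -> 0 <= sum_n u n.
Proof.
  intros H; induction n as [|n IH]; [rewrite sumR_0 | rewrite sumR_S]; auto.
  apply Rplus_le_le_0_compat; auto.
Qed.

Lemma sumR_mono (u : nat -> R) (m n : nat) :
  (forall k, 0 <= u k) -> (m <= n)%nat -> sum_n u m <= sum_n u n.
Proof.
  intros H Hmn; induction Hmn as [|n Hmn IH]; [lra|].
  rewrite sumR_S; specialize (H (S n)); lra.
Qed.

Lemma sumR_term_le (u : nat -> R) (k n : nat) :
  (forall k, 0 <= u k) -> (k <= n)%nat -> u k <= sum_n u n.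
Proof.
  intros H Hkn. apply Rle_trans with (sum_n u k); [|apply sumR_mono; auto].
  destruct k; [rewrite sumR_0; lra|].
  rewrite sumR_S. assert (0 <= sum_n u k) by (apply sumR_nonneg; auto). lra.
Qed.

Lemma sumR_zero (n : nat) : sum_n (fun _ => 0) n = 0.
Proof. rewrite sum_n_const; rring. Qed.

Lemma sumC_zero (n : nat) : sum_n (fun _ => RtoC 0) n = RtoC 0.
Proof.
  induction n as [|n IH]; [apply sumC_0 | rewrite sumC_S, IH; cring].
Qed.

Lemma sumC_Cmod (u : nat -> C) (n : nat) :
  Cmod (sum_n u n) <= sum_n (fun k => Cmod (u k)) n.
Proof.
  induction n as [|n IH]; [rewrite sumC_0, sumR_0; lra|].
  rewrite sumC_S, sumR_S. eapply Rle_trans; [apply Cmod_triangle | lra].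
Qed.

Lemma sumC_RtoC (u : nat -> R) (n : nat) :
  sum_n (fun k => RtoC (u k)) n = RtoC (sum_n u n).
Proof.
  induction n as [|n IH]; [rewrite sumC_0, sumR_0; reflexivity|].
  rewrite sumC_S, sumR_S, IH. symmetry; apply RtoC_plus.
Qed.

Lemma sumR_stable (u : nat -> R) (N n : nat) :
  (forall k, (N < k)%nat -> u k = 0) -> (N <= n)%nat -> sum_n u n = sum_n u N.
Proof.
  intros H Hn; induction Hn as [|n Hn IH]; [reflexivity|].
  rewrite sumR_S, IH, H by lia; rring.
Qed.

Lemma sumC_stable (u : nat -> C) (N n : nat) :
  (forall k, (N < k)%nat -> u k = RtoC 0) -> (N <= n)%nat -> sum_n u n = sum_n u N.
Proof.
  intros H Hn; induction Hn as [|n Hn IH]; [reflexivity|].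
  rewrite sumC_S, IH, H by lia; cring.
Qed.

Lemma sumR_split (u : nat -> R) (K n : nat) :
  sum_n u (S K + n) = sum_n u K + sum_n (fun i => u (S K + i)%nat) n.
Proof.
  induction n as [|n IH].
  - rewrite Nat.add_0_r, sumR_S, sumR_0, Nat.add_0_r; reflexivity.
  - rewrite Nat.add_succ_r, !sumR_S, IH, Nat.add_succ_r; rring.
Qed.

Lemma sumC_split (u : nat -> C) (K n : nat) :
  sum_n u (S K + n) = (sum_n u K + sum_n (fun i => u (S K + i)%nat) n)%C.
Proof.
  induction n as [|n IH].
  - rewrite Nat.add_0_r, sumC_S, sumC_0, Nat.add_0_r; reflexivity.
  - rewrite Nat.add_succ_r, !sumC_S, IH, Nat.add_succ_r; cring.
Qed.

Lemma sumR_switch (u : nat -> nat -> R) (m n : nat) :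
  sum_n (fun i => sum_n (u i) n) m = sum_n (fun j => sum_n (fun i => u i j) m) n.
Proof. exact (sum_n_switch u m n). Qed.

Lemma cauchy_schwarz_sum (u v : nat -> R) (n : nat) :
  (sum_n (fun k => u k * v k) n) ^ 2
  <= sum_n (fun k => u k ^ 2) n * sum_n (fun k => v k ^ 2) n.
Proof.
  induction n as [|n IH]; [rewrite !sumR_0; right; ring|].
  rewrite !sumR_S.
  set (A := sum_n (fun k => u k * v k) n) in *.
  set (X := sum_n (fun k => u k ^ 2) n) in *.
  set (Y := sum_n (fun k => v k ^ 2) n) in *.
  assert (HX : 0 <= X) by (apply sumR_nonneg; intros; apply pow2_ge_0).
  assert (HY : 0 <= Y) by (apply sumR_nonneg; intros; apply pow2_ge_0).
  set (p := u (S n)); set (q := v (S n)).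
  assert (H : 2 * A * (p * q) <= X * q ^ 2 + Y * p ^ 2).
  { apply Rle_trans with (2 * (sqrt X * sqrt Y) * (Rabs p * Rabs q)).
    - apply Rle_trans with (Rabs (2 * A * (p * q))); [apply Rle_abs|].
      rewrite !Rabs_mult, (Rabs_pos_eq 2) by lra.
      assert (Rabs A <= sqrt X * sqrt Y).
      { rewrite <- sqrt_mult by lra. apply Rsqr_incr_0_var; [|apply sqrt_pos].
        rewrite Rsqr_sqrt by nra. rewrite <- Rsqr_abs. unfold Rsqr; nra. }
      pose proof (Rabs_pos p); pose proof (Rabs_pos q).
      apply Rmult_le_compat_r; [apply Rmult_le_pos; lra | lra].
    - pose proof (pow2_ge_0 (sqrt X * Rabs q - sqrt Y * Rabs p)).
      pose proof (pow2_sqrt X HX); pose proof (pow2_sqrt Y HY).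
      pose proof (pow2_abs p); pose proof (pow2_abs q).
      nra. }
  nra.
Qed.

Lemma Cmod_sqr (z : C) : Cmod z ^ 2 = Re z ^ 2 + Im z ^ 2.
Proof. apply Cmod2_alt. Qed.

Lemma Im_le_Cmod (z : C) : Rabs (Im z) <= Cmod z.
Proof.
  apply Rle_trans with (2 := Rmax_Cmod z). apply Rmax_r.
Qed.

Lemma Cmod_le_sum (z : C) : Cmod z <= Rabs (Re z) + Rabs (Im z).
Proof.
  apply Rsqr_incr_0_var; [|pose proof (Rabs_pos (Re z)); pose proof (Rabs_pos (Im z)); lra].
  unfold Rsqr. pose proof (Cmod_sqr z).
  pose proof (pow2_abs (Re z)); pose proof (pow2_abs (Im z)).
  pose proof (Rabs_pos (Re z)); pose proof (Rabs_pos (Im z)). nra.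
Qed.

Lemma Cmod_plus_sqr (x y : C) :
  Cmod (x + y)%C ^ 2 = Cmod x ^ 2 + 2 * Re (Cconj x * y)%C + Cmod y ^ 2.
Proof. rewrite !Cmod_sqr. destruct x, y; simpl; ring. Qed.

(** The weights come from 2|x||y| <= t|x|^2 + |y|^2/t. When |y| <= t the large factor 1 + 1/t costs
    only t^2 + t, so mean squares are stable under small perturbations. *)
Lemma Cmod_plus_sqr_le (t : R) (x y : C) : 0 < t ->
  Cmod (x + y)%C ^ 2 <= (1 + t) * Cmod x ^ 2 + (1 + / t) * Cmod y ^ 2.
Proof.
  intros Ht.
  pose proof (Cmod_triangle x y). pose proof (Cmod_ge_0 (x + y)%C).
  apply Rle_trans with ((Cmod x + Cmod y) ^ 2); [nra|].
  pose proof (pow2_ge_0 (t * Cmod x - Cmod y)).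
  assert (0 <= / t * (t * Cmod x - Cmod y) ^ 2).
  { apply Rmult_le_pos; [left; apply Rinv_0_lt_compat; lra | auto]. }
  replace (/ t * (t * Cmod x - Cmod y) ^ 2)
    with (t * Cmod x ^ 2 - 2 * Cmod x * Cmod y + / t * Cmod y ^ 2) in H2 by (field; lra).
  lra.
Qed.

Lemma Cmod_triangle_minus (x y z : C) : Cmod (x - z)%C <= Cmod (x - y)%C + Cmod (y - z)%C.
Proof.
  replace (x - z)%C with ((x - y) + (y - z))%C by ring. apply Cmod_triangle.
Qed.

Lemma Cmod_minus_sym (x y : C) : Cmod (x - y)%C = Cmod (y - x)%C.
Proof. rewrite <- Cmod_opp. f_equal; ring. Qed.

Lemma Cmod_le_of_close (x y : C) : Cmod x <= Cmod (x - y)%C + Cmod y.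
Proof.
  replace x with ((x - y) + y)%C at 1 by ring. apply Cmod_triangle.
Qed.

Lemma Cmod_le_of_close' (x y : C) : Cmod y <= Cmod (x - y)%C + Cmod x.
Proof. rewrite Cmod_minus_sym. apply Cmod_le_of_close. Qed.

(** * Limits of complex sequences in terms of the modulus *)

Definition Clim (u : nat -> C) (l : C) : Prop :=
  forall eta : R, 0 < eta -> exists N, forall n, (N <= n)%nat -> Cmod (u n - l)%C < eta.

(** Neighbourhoods in C come from the product structure, with squares as balls; the factor sqrt 2
    compares squares with discs. *)
Lemma locally_C_Cmod (l : C) (P : C -> Prop) :
  locally l P <-> exists eta : R, 0 < eta /\ forall z, Cmod (z - l)%C < eta -> P z.
Proof.
  split.
  - intros [e He]. exists e; split; [apply cond_pos|]. intros z Hz. apply He.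
    apply C_NormedModule_mixin_compat1. exact Hz.
  - intros [eta [Heta H]].
    assert (Hs : 0 < sqrt 2) by (apply sqrt_lt_R0; lra).
    assert (Hp : 0 < eta / sqrt 2) by (apply Rdiv_lt_0_compat; lra).
    exists (mkposreal _ Hp). intros z Hz. apply H.
    pose proof (C_NormedModule_mixin_compat2 l z (mkposreal _ Hp) Hz) as Hc. simpl in Hc.
    replace (sqrt 2 * (eta / sqrt 2)) with eta in Hc by (field; lra). exact Hc.
Qed.

Lemma is_series_C_Clim (u : nat -> C) (l : C) :
  is_series (V := C_NormedModule) u l <-> Clim (sum_n u) l.
Proof.
  unfold is_series. split.
  - intros H eta Heta. apply (H (fun z => Cmod (z - l)%C < eta)).
    apply locally_C_Cmod. exists eta; auto.
  - intros H P HP. apply locally_C_Cmod in HP. destruct HP as [eta [Heta HP]].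
    destruct (H eta Heta) as [N HN]. exists N. intros n Hn. apply HP, HN, Hn.
Qed.

Lemma is_series_R_lim (u : nat -> R) (l : R) : is_series u l <-> is_lim_seq (sum_n u) l.
Proof. reflexivity. Qed.

Lemma Clim_of_parts (u : nat -> C) (x y : R) :
  is_lim_seq (fun n => Re (u n)) x -> is_lim_seq (fun n => Im (u n)) y -> Clim u (x, y).
Proof.
  intros Hx Hy eta Heta. apply is_lim_seq_spec in Hx. apply is_lim_seq_spec in Hy.
  assert (H2 : 0 < eta / 2) by lra.
  destruct (Hx (mkposreal _ H2)) as [N1 H1]. destruct (Hy (mkposreal _ H2)) as [N2 H3].
  exists (Nat.max N1 N2). intros n Hn.
  eapply Rle_lt_trans; [apply Cmod_le_sum|].
  specialize (H1 n ltac:(lia)); specialize (H3 n ltac:(lia)); simpl in H1, H3.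
  change (Re (u n - (x, y))%C) with (Re (u n) - x).
  change (Im (u n - (x, y))%C) with (Im (u n) - y). lra.
Qed.

Lemma Clim_unique (u : nat -> C) (l l' : C) : Clim u l -> Clim u l' -> l = l'.
Proof.
  intros H H'. assert (Hle : Cmod (l - l')%C <= 0).
  { apply Rnot_lt_le; intros Hlt.
    destruct (H (Cmod (l - l')%C / 2)) as [N1 H1]; [lra|].
    destruct (H' (Cmod (l - l')%C / 2)) as [N2 H2]; [lra|].
    specialize (H1 (Nat.max N1 N2) ltac:(lia)); specialize (H2 (Nat.max N1 N2) ltac:(lia)).
    pose proof (Cmod_triangle_minus l (u (Nat.max N1 N2)) l') as H3.
    rewrite (Cmod_minus_sym l (u _)) in H3. lra. }
  pose proof (Cmod_ge_0 (l - l')%C).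
  assert (Hz : (l - l')%C = RtoC 0) by (apply Cmod_eq_0; lra).
  replace l with ((l - l') + l')%C by ring. rewrite Hz; ring.
Qed.

Lemma Clim_Cauchy (u : nat -> C) :
  (forall eta, 0 < eta -> exists N, forall m n, (N <= m)%nat -> (N <= n)%nat ->
     Cmod (u m - u n)%C < eta) ->
  exists l, Clim u l.
Proof.
  intros H.
  assert (Hx : ex_finite_lim_seq (fun n => Re (u n))).
  { apply ex_lim_seq_cauchy_corr. intros eta. destruct (H eta (cond_pos eta)) as [N HN].
    exists N. intros m n Hm Hn. apply Rle_lt_trans with (2 := HN m n Hm Hn).
    apply (re_le_Cmod (u m - u n)%C). }
  assert (Hy : ex_finite_lim_seq (fun n => Im (u n))).
  { apply ex_lim_seq_cauchy_corr. intros eta. destruct (H eta (cond_pos eta)) as [N HN].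
    exists N. intros m n Hm Hn. apply Rle_lt_trans with (2 := HN m n Hm Hn).
    apply (Im_le_Cmod (u m - u n)%C). }
  destruct Hx as [x Hx], Hy as [y Hy]. exists (x, y). apply Clim_of_parts; auto.
Qed.

Lemma Clim_dist_le (u : nat -> C) (l z : C) (B : R) :
  Clim u l -> (exists N, forall n, (N <= n)%nat -> Cmod (u n - z)%C <= B) ->
  Cmod (l - z)%C <= B.
Proof.
  intros H [N HN]. apply le_epsilon; intros eta Heta.
  destruct (H eta Heta) as [N' HN'].
  specialize (HN (Nat.max N N') ltac:(lia)); specialize (HN' (Nat.max N N') ltac:(lia)).
  eapply Rle_trans; [apply (Cmod_triangle_minus l (u (Nat.max N N')))|].
  rewrite Cmod_minus_sym. lra.
Qed.

(** * Nonnegative series and square-summable sequences *)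

Lemma pos_bounded_ex_series (u : nat -> R) (B : R) :
  (forall k, 0 <= u k) -> (forall n, sum_n u n <= B) -> ex_series u.
Proof.
  intros H0 HB. apply ex_finite_lim_seq_incr with (M := B); auto.
  intros n. change (sum_n u n <= sum_n u (S n)). rewrite sumR_S. specialize (H0 (S n)). lra.
Qed.

Lemma sum_le_Series (u : nat -> R) (n : nat) :
  (forall k, 0 <= u k) -> ex_series u -> sum_n u n <= Series u.
Proof.
  intros H0 Hu. apply Series_correct in Hu.
  apply (is_lim_seq_incr_compare (sum_n u) (Series u) Hu).
  intros k. change (sum_n u k <= sum_n u (S k)). rewrite sumR_S. specialize (H0 (S k)). lra.
Qed.

Lemma Series_le_bound (u : nat -> R) (B : R) :
  ex_series u -> (forall n, sum_n u n <= B) -> Series u <= B.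
Proof.
  intros Hu HB. apply Series_correct in Hu.
  apply (is_lim_seq_le (sum_n u) (fun _ => B) (Series u) B HB Hu). apply is_lim_seq_const.
Qed.

Lemma ell2_of_bound (a : nat -> C) (B : R) :
  (forall n, sum_n (fun k => Cmod (a k) ^ 2) n <= B) ->
  ell2 a /\ ell2_norm a <= sqrt B.
Proof.
  intros H.
  assert (He : ell2 a).
  { apply pos_bounded_ex_series with (B := B); auto. intros; apply pow2_ge_0. }
  split; auto. apply sqrt_le_1_alt. apply Series_le_bound; auto.
Qed.

Lemma ell2_norm_ge_0 (a : nat -> C) : 0 <= ell2_norm a.
Proof. apply sqrt_pos. Qed.

Lemma ell2_norm_sqr (a : nat -> C) : ell2 a ->
  ell2_norm a ^ 2 = Series (fun k => Cmod (a k) ^ 2).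
Proof.
  intros H. unfold ell2_norm. rewrite pow2_sqrt; auto.
  apply Rle_trans with (sum_n (fun k => Cmod (a k) ^ 2) 0).
  - rewrite sumR_0; apply pow2_ge_0.
  - apply sum_le_Series; auto. intros; apply pow2_ge_0.
Qed.

Lemma ell2_partial (a : nat -> C) (n : nat) : ell2 a ->
  sum_n (fun k => Cmod (a k) ^ 2) n <= ell2_norm a ^ 2.
Proof.
  intros H. rewrite ell2_norm_sqr by auto. apply sum_le_Series; auto.
  intros; apply pow2_ge_0.
Qed.

Lemma ell2_finite (a : nat -> C) (M : nat) :
  (forall k, (M < k)%nat -> a k = RtoC 0) ->
  ell2 a /\ ell2_norm a ^ 2 = sum_n (fun k => Cmod (a k) ^ 2) M.
Proof.
  intros Ha.
  assert (Hs : forall k, (M < k)%nat -> Cmod (a k) ^ 2 = 0).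
  { intros k Hk. rewrite Ha, Cmod_0 by auto; ring. }
  assert (H : is_series (fun k => Cmod (a k) ^ 2) (sum_n (fun k => Cmod (a k) ^ 2) M)).
  { apply is_series_R_lim. apply is_lim_seq_ext_loc with
      (fun _ => sum_n (fun k => Cmod (a k) ^ 2) M); [|apply is_lim_seq_const].
    exists M. intros n Hn. symmetry. apply sumR_stable; auto. }
  assert (He : ell2 a) by (eexists; eauto).
  split; auto. rewrite ell2_norm_sqr by auto. apply is_series_unique; auto.
Qed.

(** * The complex exponential and the functions n^{-s} *)

Lemma Cexp_plus (x y : C) : Cexp (x + y)%C = (Cexp x * Cexp y)%C.
Proof.
  unfold Cexp. destruct x as [a b], y as [c d]. simpl.
  rewrite exp_plus, cos_plus, sin_plus. unfold Cmult; simpl. f_equal; ring.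
Qed.

Lemma Cexp_0 : Cexp (RtoC 0) = RtoC 1.
Proof.
  unfold Cexp; simpl. rewrite exp_0, cos_0, sin_0. unfold RtoC. f_equal; ring.
Qed.

Lemma Cmod_Cexp (z : C) : Cmod (Cexp z) = exp (Re z).
Proof.
  assert (H : Cmod (Cexp z) ^ 2 = exp (Re z) ^ 2).
  { rewrite Cmod_sqr. unfold Cexp; simpl.
    pose proof (sin2_cos2 (Im z)) as H. unfold Rsqr in H.
    transitivity (exp (Re z) * exp (Re z)
      * (sin (Im z) * sin (Im z) + cos (Im z) * cos (Im z))); [ring | rewrite H; ring]. }
  pose proof (Cmod_ge_0 (Cexp z)). pose proof (exp_pos (Re z)). nra.
Qed.

Lemma Cexp_pow (z : C) (n : nat) : (Cexp z ^ n)%C = Cexp (RtoC (INR n) * z)%C.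
Proof.
  induction n as [|n IH].
  - simpl. rewrite Cmult_0_l, Cexp_0; reflexivity.
  - rewrite S_INR, RtoC_plus, Cmult_plus_distr_r, Cmult_1_l, Cexp_plus, <- IH.
    simpl. ring.
Qed.

Lemma exp_le_quadratic (x : R) : x <= 1 / 2 -> exp x <= 1 + x + 2 * x ^ 2.
Proof.
  intros Hx. pose proof (exp_ineq1_le (- x)) as H. rewrite exp_Ropp in H.
  pose proof (exp_pos x) as Hp.
  assert (H1 : (1 - x) * exp x <= 1).
  { apply Rle_trans with (/ exp x * exp x); [apply Rmult_le_compat_r; lra|].
    right; field; lra. }
  (* The product equals 1 + x^2 (1 - 2x), which is where x <= 1/2 enters. *)
  assert (H2 : 1 <= (1 - x) * (1 + x + 2 * x ^ 2)) by nra.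
  apply Rmult_le_reg_l with (1 - x); lra.
Qed.

Lemma Rabs_sin_le (y : R) : Rabs (sin y) <= Rabs y.
Proof.
  destruct (MVT_gen sin 0 y cos) as [c [_ Hc]].
  - intros; auto_derive; auto; ring.
  - intros. apply derivable_continuous_pt, derivable_pt_sin.
  - rewrite sin_0, !Rminus_0_r in Hc. rewrite Hc, Rabs_mult.
    pose proof (COS_bound c). pose proof (Rabs_pos y).
    assert (Rabs (cos c) <= 1) by (apply Rabs_le; lra). nra.
Qed.

Lemma one_minus_cos_bounds (y : R) : 0 <= 1 - cos y <= y ^ 2 / 2.
Proof.
  pose proof (COS_bound y). split; [lra|].
  replace (cos y) with (cos (2 * (y / 2))) by (f_equal; field).
  rewrite cos_2a_sin. pose proof (Rabs_sin_le (y / 2)) as Hs.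
  pose proof (pow2_abs (sin (y / 2))). pose proof (pow2_abs (y / 2)).
  pose proof (Rabs_pos (sin (y / 2))). nra.
Qed.

Lemma sin_minus_id_bound (y : R) : Rabs (sin y - y) <= Rabs y * (y ^ 2 / 2).
Proof.
  destruct (MVT_gen sin 0 y cos) as [c [Hc1 Hc]].
  - intros; auto_derive; auto; ring.
  - intros. apply derivable_continuous_pt, derivable_pt_sin.
  - rewrite sin_0, !Rminus_0_r in Hc.
    replace (sin y - y) with (y * - (1 - cos c)) by (rewrite Hc; ring).
    rewrite Rabs_mult. apply Rmult_le_compat_l; [apply Rabs_pos|].
    destruct (one_minus_cos_bounds c) as [H1 H2].
    rewrite Rabs_Ropp, Rabs_pos_eq by lra.
    apply Rle_trans with (1 := H2).
    assert (c ^ 2 <= y ^ 2); [|lra].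
    unfold Rmin, Rmax in Hc1. destruct (Rle_dec 0 y); nra.
Qed.

Lemma Cexp_linear_approx (u : C) : Cmod u <= 1 / 2 ->
  Cmod (Cexp u - (1 + u))%C <= 3 * Cmod u ^ 2.
Proof.
  intros Hu. rewrite Cmod_sqr.
  pose proof (re_le_Cmod u) as Hx. pose proof (Im_le_Cmod u) as Hy.
  eapply Rle_trans; [apply Cmod_le_sum|].
  destruct u as [x y]. change (Re (x, y)) with x in *. change (Im (x, y)) with y in *.
  set (E := exp x).
  assert (HE1 : 0 <= E - 1 - x <= 2 * x ^ 2).
  { unfold E. pose proof (exp_ineq1_le x).
    pose proof (exp_le_quadratic x). pose proof (Rle_abs x). lra. }
  pose proof (pow2_abs x) as Hx2. pose proof (pow2_abs y) as Hy2.
  pose proof (Rabs_pos x). pose proof (Rabs_pos y). pose proof (Rle_abs x).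
  assert (HE2 : 0 < E <= 2) by (split; [apply exp_pos | nra]).
  assert (HRe : Rabs (Re (Cexp (x, y) - (1 + (x, y)))%C) <= 2 * x ^ 2 + y ^ 2).
  { replace (Re (Cexp (x, y) - (1 + (x, y)))%C) with ((E - 1 - x) - E * (1 - cos y))
      by (unfold Cexp, E; simpl; ring).
    destruct (one_minus_cos_bounds y). apply Rabs_le. nra. }
  assert (HIm : Rabs (Im (Cexp (x, y) - (1 + (x, y)))%C) <= x ^ 2 + 3 / 2 * y ^ 2).
  { replace (Im (Cexp (x, y) - (1 + (x, y)))%C) with ((E - 1) * sin y + (sin y - y))
      by (unfold Cexp, E; simpl; ring).
    eapply Rle_trans; [apply Rabs_triang|]. rewrite Rabs_mult.
    pose proof (Rabs_sin_le y). pose proof (sin_minus_id_bound y).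
    pose proof (Rabs_pos (sin y)).
    assert (Rabs (E - 1) <= 2 * Rabs x).
    { apply Rabs_le. pose proof (Rle_abs (- x)). rewrite Rabs_Ropp in *. nra. }
    assert (Rabs (E - 1) * Rabs (sin y) <= 2 * Rabs x * Rabs y).
    { apply Rmult_le_compat; auto using Rabs_pos. }
    pose proof (pow2_ge_0 (Rabs x - Rabs y)).
    assert (Rabs y * (y ^ 2 / 2) <= 1 * (y ^ 2 / 2))
      by (apply Rmult_le_compat_r; [pose proof (pow2_ge_0 y) |]; lra).
    nra. }
  (* The two parts add up to 3 x^2 + (5/2) y^2. *)
  pose proof (pow2_ge_0 y). lra.
Qed.

Lemma Cpow_diff_bound (a b : C) (B : R) (n : nat) :
  1 <= B -> Cmod a <= B -> Cmod b <= B ->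
  Cmod (a ^ n - b ^ n)%C <= INR n * B ^ n * Cmod (a - b)%C.
Proof.
  intros HB Ha Hb. induction n as [|n IH].
  - simpl. replace (1 - 1)%C with (RtoC 0) by ring. rewrite Cmod_0. lra.
  - replace (a ^ S n - b ^ S n)%C with (a * (a ^ n - b ^ n) + b ^ n * (a - b))%C
      by (simpl; ring).
    eapply Rle_trans; [apply Cmod_triangle|]. rewrite !Cmod_mult, S_INR, Cmod_pow.
    assert (Hbn : Cmod b ^ n <= B ^ n) by (apply pow_incr; split; [apply Cmod_ge_0 | auto]).
    assert (HBn : 1 <= B ^ n) by (apply pow_R1_Rle; auto).
    pose proof (Cmod_ge_0 (a - b)%C). pose proof (Cmod_ge_0 a).
    pose proof (Cmod_ge_0 (a ^ n - b ^ n)%C).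
    assert (Cmod a * Cmod (a ^ n - b ^ n)%C <= B * (INR n * B ^ n * Cmod (a - b)%C)).
    { apply Rmult_le_compat; auto. }
    assert (Cmod b ^ n * Cmod (a - b)%C <= B * B ^ n * Cmod (a - b)%C).
    { apply Rmult_le_compat_r; auto. nra. }
    simpl. nra.
Qed.

(** The error is uniform on bounded sets and (1 + z/n)^n is a polynomial in z; this is how
    exponentials enter the uniform closure of the Dirichlet polynomials. *)
Lemma Cexp_compound_approx (z : C) (n : nat) :
  (0 < n)%nat -> 2 * Cmod z <= INR n ->
  Cmod (Cexp z - (1 + z / RtoC (INR n)) ^ n)%C <= 3 * Cmod z ^ 2 * exp (Cmod z) / INR n.
Proof.
  intros Hn Hz. assert (Hn' : 0 < INR n) by (apply lt_0_INR; auto).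
  assert (Hnz : RtoC (INR n) <> RtoC 0) by (intros H; apply RtoC_inj in H; lra).
  set (u := (z / RtoC (INR n))%C).
  assert (Hu : Cmod u = Cmod z / INR n).
  { unfold u. rewrite Cmod_div, Cmod_R, Rabs_pos_eq by (auto; lra). reflexivity. }
  assert (Hu2 : Cmod u <= 1 / 2).
  { rewrite Hu. apply Rmult_le_reg_r with (INR n); auto.
    unfold Rdiv at 1. rewrite Rmult_assoc, Rinv_l by lra. lra. }
  replace (Cexp z) with (Cexp u ^ n)%C.
  2:{ rewrite Cexp_pow. f_equal. unfold u. field. auto. }
  pose proof (Cmod_ge_0 u) as Hu0.
  eapply Rle_trans.
  - apply Cpow_diff_bound with (B := exp (Cmod u)).
    + pose proof (exp_ineq1_le (Cmod u)). lra.
    + rewrite Cmod_Cexp. pose proof (re_le_Cmod u). pose proof (Rle_abs (Re u)).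
      destruct (Req_dec (Re u) (Cmod u)) as [->|]; [lra|].
      left; apply exp_increasing; lra.
    + eapply Rle_trans; [apply Cmod_triangle|]. rewrite Cmod_1. apply exp_ineq1_le.
  - replace (exp (Cmod u) ^ n) with (exp (Cmod z)).
    2:{ rewrite <- Rpower_pow by apply exp_pos. unfold Rpower. rewrite ln_exp.
        f_equal. rewrite Hu. field. lra. }
    apply Rle_trans with (INR n * exp (Cmod z) * (3 * Cmod u ^ 2)).
    + apply Rmult_le_compat_l; [pose proof (exp_pos (Cmod z)); nra|].
      apply Cexp_linear_approx; auto.
    + right. rewrite Hu. field. lra.
Qed.

Definition lnS (n : nat) : R := ln (INR (S n)).

Lemma INR_S_pos (n : nat) : 0 < INR (S n).
Proof. apply lt_0_INR; lia. Qed.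

Lemma lnS_0 : lnS 0 = 0.
Proof. unfold lnS; simpl; apply ln_1. Qed.

Lemma lnS_lt (m n : nat) : (m < n)%nat -> lnS m < lnS n.
Proof. intros H. apply ln_increasing; [apply INR_S_pos | apply lt_INR; lia]. Qed.

Lemma lnS_le (m n : nat) : (m <= n)%nat -> lnS m <= lnS n.
Proof.
  intros H. destruct (Nat.eq_dec m n) as [->|]; [lra|]. left; apply lnS_lt; lia.
Qed.

Lemma lnS_ge_0 (n : nat) : 0 <= lnS n.
Proof. rewrite <- lnS_0. apply lnS_le; lia. Qed.

Lemma exp_lnS (n : nat) : exp (lnS n) = INR (S n).
Proof. apply exp_ln, INR_S_pos. Qed.

(** In the shifted indexing, m * n + m + n is the index of the product (m+1)(n+1). *)
Lemma lnS_mult (m n : nat) : lnS (m * n + m + n) = lnS m + lnS n.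
Proof.
  unfold lnS. rewrite <- ln_mult by apply INR_S_pos. f_equal.
  rewrite <- mult_INR. f_equal. lia.
Qed.

Lemma npow_neg_eq (n : nat) (s : C) : npow_neg n s = Cexp (- s * RtoC (lnS n))%C.
Proof. reflexivity. Qed.

Lemma npow_neg_0 (s : C) : npow_neg 0 s = RtoC 1.
Proof. rewrite npow_neg_eq, lnS_0, Cmult_0_r. apply Cexp_0. Qed.

Lemma npow_neg_mult (m n : nat) (s : C) :
  (npow_neg m s * npow_neg n s)%C = npow_neg (m * n + m + n) s.
Proof. rewrite !npow_neg_eq, lnS_mult, <- Cexp_plus, RtoC_plus. f_equal; ring. Qed.

Lemma Cmod_npow_neg (n : nat) (s : C) : Cmod (npow_neg n s) = exp (- Re s * lnS n).
Proof. rewrite npow_neg_eq, Cmod_Cexp. destruct s. f_equal. simpl. ring. Qed.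

Lemma exp_le (x y : R) : x <= y -> exp x <= exp y.
Proof.
  intros [H| ->]; [left; apply exp_increasing; auto | lra].
Qed.

Lemma Cmod_npow_neg_le (n : nat) (s : C) (e : R) : e <= Re s ->
  Cmod (npow_neg n s) <= exp (- e * lnS n).
Proof. intros H. rewrite Cmod_npow_neg. apply exp_le. pose proof (lnS_ge_0 n). nra. Qed.

(** * Means along an arithmetic progression on a vertical line *)

(** Infinite descent: p = 2r turns the equation into q^2 = 2 r^2 with r < q. *)
Lemma nat_sqrt2_irrational (q : nat) : forall p : nat, (p * p = 2 * (q * q))%nat -> q = 0%nat.
Proof.
  induction q as [q IH] using (well_founded_induction Wf_nat.lt_wf). intros p Hp.
  destruct (Nat.Even_or_Odd p) as [[r Hr]|[r Hr]]; [|exfalso; subst; lia].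
  destruct (Nat.eq_dec q 0) as [|Hq]; auto.
  assert (Hr' : r = 0%nat) by (apply (IH r) with (p := q); nia). subst. nia.
Qed.

Lemma one_plus_sqrt2_pow (m : nat) : exists A B : nat,
  (1 + sqrt 2) ^ S m = INR A + INR B * sqrt 2 /\ (0 < B)%nat.
Proof.
  assert (H2 : sqrt 2 * sqrt 2 = 2) by (apply sqrt_sqrt; lra).
  induction m as [|m [A [B [H HB]]]].
  - exists 1%nat, 1%nat. simpl. split; [ring | lia].
  - exists (A + 2 * B)%nat, (A + B)%nat. split; [|lia].
    change ((1 + sqrt 2) ^ S (S m)) with ((1 + sqrt 2) * (1 + sqrt 2) ^ S m). rewrite H.
    rewrite !plus_INR, mult_INR. simpl (INR 2).
    transitivity (INR A + INR A * sqrt 2 + INR B * sqrt 2 + INR B * (sqrt 2 * sqrt 2)); [ring|].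
    rewrite H2. ring.
Qed.

(** Otherwise (l+1)/(k+1) = A + B sqrt 2 with B > 0, and clearing the denominator makes (k+1) B sqrt
    2 an integer. *)
Lemma ratio_not_power (k l m : nat) :
  lnS l - lnS k = INR (S m) * ln (1 + sqrt 2) -> False.
Proof.
  intros H. assert (Hs : 0 < sqrt 2) by (apply sqrt_lt_R0; lra).
  assert (H2 : sqrt 2 * sqrt 2 = 2) by (apply sqrt_sqrt; lra).
  destruct (one_plus_sqrt2_pow m) as [A [B [HAB HB]]].
  assert (He : INR (S l) = INR (S k) * (INR A + INR B * sqrt 2)).
  { rewrite <- HAB, <- !exp_lnS, <- Rpower_pow by lra. unfold Rpower.
    rewrite <- H, <- exp_plus. f_equal; ring. }
  assert (Hle : (S k * A <= S l)%nat).
  { apply INR_le. rewrite mult_INR, He.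
    pose proof (INR_S_pos k). pose proof (pos_INR B).
    assert (0 <= INR B * sqrt 2) by nra. nra. }
  assert (Hq : (S k * B)%nat = 0%nat); [|lia].
  (* The subtraction in [nat] is exact by [Hle]. *)
  apply nat_sqrt2_irrational with (p := (S l - S k * A)%nat).
  apply INR_eq. rewrite (mult_INR 2), !mult_INR, minus_INR, mult_INR, He by auto.
  simpl (INR 2).
  transitivity (INR (S k) * INR (S k) * INR B * INR B * (sqrt 2 * sqrt 2)); [ring|].
  rewrite H2; ring.
Qed.

(* With this step, step * ln (k / l) is in 2 PI Z only if k = l, because no
   nonzero integral power of 1 + sqrt 2 is rational. *)
Definition step : R := 2 * PI / ln (1 + sqrt 2).

Lemma step_nonresonant (k l : nat) : k <> l -> sin (step * (lnS k - lnS l) / 2) <> 0.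
Proof.
  intros Hkl H.
  assert (Hs : 0 < sqrt 2) by (apply sqrt_lt_R0; lra).
  assert (Hln : 0 < ln (1 + sqrt 2)) by (rewrite <- ln_1; apply ln_increasing; lra).
  apply sin_eq_0_0 in H. destruct H as [z Hz].
  assert (Hz' : lnS k - lnS l = IZR z * ln (1 + sqrt 2)).
  { unfold step in Hz. pose proof PI_RGT_0.
    apply Rmult_eq_reg_l with (PI / ln (1 + sqrt 2)).
    - transitivity (IZR z * PI); [rewrite <- Hz | ]; field; lra.
    - apply Rgt_not_eq. apply Rdiv_lt_0_compat; lra. }
  destruct (Z.lt_trichotomy z 0) as [Hneg|[->|Hpos]].
  (* The exponent in [ratio_not_power] is [S m], so |z| - 1 is passed; the sign of z decides which
     ratio exceeds 1. *)
  - apply (ratio_not_power k l (Z.to_nat (- z - 1))).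
    rewrite INR_IZR_INZ. replace (Z.of_nat (S (Z.to_nat (- z - 1)))) with (- z)%Z by lia.
    rewrite opp_IZR. lra.
  - rewrite Rmult_0_l in Hz'. apply Hkl.
    destruct (Nat.lt_trichotomy k l) as [Hlt|[|Hlt]]; auto;
      apply lnS_lt in Hlt; lra.
  - apply (ratio_not_power l k (Z.to_nat (z - 1))).
    rewrite INR_IZR_INZ. replace (Z.of_nat (S (Z.to_nat (z - 1)))) with z by lia.
    exact Hz'.
Qed.

(** * Cesaro means of sampled values *)

Definition avg (u : nat -> R) (N : nat) : R := sum_n u N / INR (S N).

Lemma avg_ext (u v : nat -> R) (N : nat) : (forall j, u j = v j) -> avg u N = avg v N.
Proof. intros H. unfold avg. f_equal. apply sum_n_ext; auto. Qed.

Lemma avg_plus (u v : nat -> R) (N : nat) : avg (fun j => u j + v j) N = avg u N + avg v N.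
Proof. unfold avg. rewrite sumR_plus. field. apply Rgt_not_eq, INR_S_pos. Qed.

Lemma avg_scal (c : R) (u : nat -> R) (N : nat) : avg (fun j => c * u j) N = c * avg u N.
Proof. unfold avg. rewrite sumR_scal. field. apply Rgt_not_eq, INR_S_pos. Qed.

Lemma avg_const (c : R) (N : nat) : avg (fun _ => c) N = c.
Proof. unfold avg. rewrite sum_n_const. field. apply Rgt_not_eq, INR_S_pos. Qed.

Lemma avg_le (u v : nat -> R) (N : nat) : (forall j, u j <= v j) -> avg u N <= avg v N.
Proof.
  intros H. unfold avg. apply Rmult_le_compat_r.
  - left; apply Rinv_0_lt_compat, INR_S_pos.
  - apply sumR_le; auto.
Qed.

Definition mean (u : nat -> R) (l : R) : Prop := is_lim_seq (avg u) l.

Lemma mean_ext (u v : nat -> R) (l : R) : (forall j, u j = v j) -> mean u l -> mean v l.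
Proof.
  intros H. unfold mean. apply is_lim_seq_ext. intros; apply avg_ext; auto.
Qed.

Lemma mean_plus (u v : nat -> R) (l m : R) :
  mean u l -> mean v m -> mean (fun j => u j + v j) (l + m).
Proof.
  intros Hu Hv. unfold mean.
  apply is_lim_seq_ext with (fun n => avg u n + avg v n).
  - intros; symmetry; apply avg_plus.
  - apply (is_lim_seq_plus' _ _ l m); auto.
Qed.

Lemma mean_plus_0 (u v : nat -> R) (l : R) :
  mean u 0 -> mean v l -> mean (fun j => u j + v j) l.
Proof. intros Hu Hv. rewrite <- (Rplus_0_l l). apply mean_plus; auto. Qed.

Lemma mean_scal (c : R) (u : nat -> R) (l : R) : mean u l -> mean (fun j => c * u j) (c * l).
Proof.
  intros Hu. unfold mean.
  apply is_lim_seq_ext with (fun n => c * avg u n).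
  - intros; symmetry; apply avg_scal.
  - apply (is_lim_seq_scal_l _ c l); auto.
Qed.

Lemma mean_const (c : R) : mean (fun _ => c) c.
Proof.
  unfold mean. apply is_lim_seq_ext with (fun _ => c).
  - intros; symmetry; apply avg_const.
  - apply is_lim_seq_const.
Qed.

Lemma mean_sum_0 (u : nat -> nat -> R) (K : nat) :
  (forall k, (k <= K)%nat -> mean (u k) 0) ->
  mean (fun j => sum_n (fun k => u k j) K) 0.
Proof.
  induction K as [|K IH]; intros H.
  - apply mean_ext with (u 0%nat); [intros; symmetry; apply sumR_0 | apply H; lia].
  - apply mean_ext with (fun j => sum_n (fun k => u k j) K + u (S K) j).
    + intros; symmetry; apply sumR_S.
    + rewrite <- (Rplus_0_r 0). apply mean_plus; [apply IH; intros | ]; apply H; lia.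
Qed.

Lemma mean_eventually (u : nat -> R) (l eta : R) : mean u l -> 0 < eta ->
  exists N0, forall N, (N0 <= N)%nat -> Rabs (avg u N - l) < eta.
Proof.
  intros H Heta. apply is_lim_seq_spec in H.
  destruct (H (mkposreal _ Heta)) as [N0 HN]. exists N0; exact HN.
Qed.

(** Multiplied by 2 sin (theta/2), the sum telescopes; the sums are therefore bounded and their
    averages tend to 0. *)
Lemma mean_cos (theta gamma : R) : sin (theta / 2) <> 0 ->
  mean (fun j => cos (INR j * theta + gamma)) 0.
Proof.
  intros Hs.
  assert (Hsum : forall N, 2 * sin (theta / 2) * sum_n (fun j => cos (INR j * theta + gamma)) N
            = sin ((INR N + / 2) * theta + gamma) - sin (gamma - theta / 2)).
  { assert (Hstep : forall x, 2 * sin (theta / 2) * cos x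
                              = sin (x + theta / 2) - sin (x - theta / 2)).
    { intros x. rewrite sin_plus, sin_minus. ring. }
    induction N as [|N IH].
    - rewrite sumR_0, Hstep. f_equal; f_equal; simpl; field.
    - rewrite sumR_S, Rmult_plus_distr_l, IH, Hstep, S_INR.
      replace ((INR N + 1) * theta + gamma - theta / 2)
        with ((INR N + / 2) * theta + gamma) by field.
      replace ((INR N + 1) * theta + gamma + theta / 2)
        with ((INR N + 1 + / 2) * theta + gamma) by field.
      ring. }
  set (B := / Rabs (sin (theta / 2))).
  assert (Habs : 0 < Rabs (sin (theta / 2))) by (apply Rabs_pos_lt; auto).
  assert (Hb : forall N, Rabs (sum_n (fun j => cos (INR j * theta + gamma)) N) <= B).
  { intros N. apply Rmult_le_reg_l with (Rabs (sin (theta / 2))); auto.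
    unfold B. rewrite Rinv_r by lra. rewrite <- Rabs_mult.
    apply Rmult_le_reg_l with 2; [lra|].
    rewrite <- (Rabs_pos_eq 2) at 1 by lra. rewrite <- Rabs_mult, <- Rmult_assoc, Hsum.
    pose proof (SIN_bound ((INR N + / 2) * theta + gamma)).
    pose proof (SIN_bound (gamma - theta / 2)).
    apply Rabs_le. lra. }
  unfold mean. apply is_lim_seq_abs_0.
  apply is_lim_seq_le_le with (u := fun _ => 0) (w := fun N => B * / INR (S N)).
  - intros N. split; [apply Rabs_pos|]. unfold avg, Rdiv. rewrite Rabs_mult.
    rewrite (Rabs_pos_eq (/ INR (S N))) by (left; apply Rinv_0_lt_compat, INR_S_pos).
    apply Rmult_le_compat_r; [left; apply Rinv_0_lt_compat, INR_S_pos | apply Hb].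
  - apply is_lim_seq_const.
  - replace (Finite 0) with (Rbar_mult B 0) by (simpl; f_equal; ring).
    apply is_lim_seq_scal_l.
    apply is_lim_seq_incr_1 with (u := fun n => / INR n).
    replace (Finite 0) with (Rbar_inv p_infty) by reflexivity.
    apply is_lim_seq_inv; [apply is_lim_seq_INR | discriminate].
Qed.

Definition vpt (sigma : R) (j : nat) : C := (sigma, step * INR j).

Lemma mean_npow_pair (sigma : R) (k l : nat) (c : C) : k <> l ->
  mean (fun j => Re (c * (npow_neg k (vpt sigma j) * Cconj (npow_neg l (vpt sigma j))))%C) 0.
Proof.
  intros Hkl.
  set (th := step * (lnS k - lnS l)).
  set (E := exp (- sigma * (lnS k + lnS l))).
  (* Writing the sine as a cosine shifted by PI/2 lets [mean_cos] treat both components of [c]. *)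
  apply mean_ext with (fun j => E * Re c * cos (INR j * th + 0)
                                + E * Im c * cos (INR j * th + - (PI / 2))).
  - intros j.
    assert (Hs : cos (INR j * th + - (PI / 2)) = sin (INR j * th)).
    { rewrite <- cos_shift, <- cos_neg. f_equal; ring. }
    rewrite Hs, Rplus_0_r.
    assert (Hp : (npow_neg k (vpt sigma j) * Cconj (npow_neg l (vpt sigma j)))%C
             = (E * cos (INR j * th), - (E * sin (INR j * th)))).
    { transitivity (Cexp (- sigma * (lnS k + lnS l), - (INR j * th))).
      - rewrite !npow_neg_eq.
        replace (Cconj (Cexp (- vpt sigma j * RtoC (lnS l))%C))
          with (Cexp (Cconj (- vpt sigma j * RtoC (lnS l))%C)).
        + rewrite <- Cexp_plus. f_equal. unfold vpt, th, Cconj, Cplus, Cmult, Copp; simpl.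
          f_equal; ring.
        + unfold Cexp, Cconj; simpl. rewrite cos_neg, sin_neg. f_equal; ring.
      - unfold Cexp; simpl. rewrite cos_neg, sin_neg. unfold E. f_equal; ring. }
    rewrite Hp. destruct c; simpl. ring.
  - replace 0 with (E * Re c * 0 + E * Im c * 0) by ring.
    apply mean_plus; apply mean_scal; apply mean_cos; apply step_nonresonant; auto.
Qed.

(** This is (k+1)^{-2 sigma}, the weight of a coefficient in the mean square on Re s = sigma; it
    tends to 1 as sigma tends to 0. *)
Definition wt (sigma : R) (k : nat) : R := exp (- (2 * sigma) * lnS k).

Lemma wt_pos (sigma : R) (k : nat) : 0 < wt sigma k.
Proof. apply exp_pos. Qed.

Lemma Cmod_npow_neg_sqr (sigma : R) (k : nat) (s : C) : Re s = sigma ->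
  Cmod (npow_neg k s) ^ 2 = wt sigma k.
Proof.
  intros H. rewrite Cmod_npow_neg, H. simpl. rewrite Rmult_1_r, <- exp_plus.
  unfold wt. f_equal; ring.
Qed.

Lemma Re_conj_poly_mult (p : nat -> C) (s c z : C) (K : nat) :
  Re (Cconj (sum_n (dirichlet_term p s) K) * (c * z))%C
  = sum_n (fun k => Re ((c * Cconj (p k)) * (z * Cconj (npow_neg k s)))%C) K.
Proof.
  induction K as [|K IH].
  - rewrite sumR_0, sumC_0. f_equal. unfold dirichlet_term. rewrite Cmult_conj. ring.
  - rewrite sumR_S, sumC_S, <- IH, Cplus_conj, Cmult_plus_distr_r, re_plus. f_equal.
    f_equal. unfold dirichlet_term. rewrite Cmult_conj. ring.
Qed.

(** Carlson's identity for polynomials: each new term contributes its own square and cross terms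
    between distinct indices, whose means vanish. *)
Lemma mean_square_poly (sigma : R) (p : nat -> C) (K : nat) :
  mean (fun j => Cmod (sum_n (dirichlet_term p (vpt sigma j)) K) ^ 2)
       (sum_n (fun k => Cmod (p k) ^ 2 * wt sigma k) K).
Proof.
  assert (Hterm : forall k j, Cmod (dirichlet_term p (vpt sigma j) k) ^ 2
                              = Cmod (p k) ^ 2 * wt sigma k).
  { intros k j. unfold dirichlet_term. rewrite Cmod_mult, Rpow_mult_distr.
    rewrite Cmod_npow_neg_sqr with (sigma := sigma); reflexivity. }
  induction K as [|K IH].
  - rewrite sumR_0. apply mean_ext with (fun _ => Cmod (p 0%nat) ^ 2 * wt sigma 0).
    + intros j. rewrite sumC_0, Hterm. reflexivity.
    + apply mean_const.
  - rewrite sumR_S.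
    apply mean_ext with (fun j =>
      Cmod (sum_n (dirichlet_term p (vpt sigma j)) K) ^ 2
      + (2 * sum_n (fun k => Re ((p (S K) * Cconj (p k)) *
           (npow_neg (S K) (vpt sigma j) * Cconj (npow_neg k (vpt sigma j))))%C) K
         + Cmod (p (S K)) ^ 2 * wt sigma (S K))).
    + intros j. rewrite sumC_S, Cmod_plus_sqr, Hterm.
      set (P := sum_n (dirichlet_term p (vpt sigma j)) K).
      replace (Re (Cconj P * dirichlet_term p (vpt sigma j) (S K))%C) with
        (sum_n (fun k => Re ((p (S K) * Cconj (p k)) *
           (npow_neg (S K) (vpt sigma j) * Cconj (npow_neg k (vpt sigma j))))%C) K).
      { ring. }
      symmetry. apply Re_conj_poly_mult.
    + apply mean_plus; auto. apply mean_plus_0; [|apply mean_const].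
      rewrite <- (Rmult_0_r 2). apply mean_scal. apply mean_sum_0.
      intros k Hk. apply mean_npow_pair. lia.
Qed.

(** The constant 1 is the term of index 0, so every later term pairs two distinct indices and
    averages out. *)
Lemma mean_Re_poly (sigma : R) (p : nat -> C) (K : nat) :
  mean (fun j => Re (sum_n (dirichlet_term p (vpt sigma j)) K)) (Re (p 0%nat)).
Proof.
  induction K as [|K IH].
  - apply mean_ext with (fun _ => Re (p 0%nat)); [|apply mean_const].
    intros j. rewrite sumC_0. unfold dirichlet_term. rewrite npow_neg_0. f_equal; ring.
  - apply mean_ext with (fun j => Re (sum_n (dirichlet_term p (vpt sigma j)) K)
      + Re (p (S K) * (npow_neg (S K) (vpt sigma j) * Cconj (npow_neg 0 (vpt sigma j))))%C).
    + intros j. rewrite sumC_S, re_plus. f_equal. f_equal.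
      rewrite npow_neg_0. unfold dirichlet_term.
      replace (Cconj 1) with (RtoC 1); [ring|]. unfold Cconj, RtoC; simpl. f_equal; ring.
    + rewrite <- (Rplus_0_r (Re (p 0%nat))). apply mean_plus; auto.
      apply mean_npow_pair. lia.
Qed.

(** * Uniform limits of Dirichlet polynomials *)

(** Coefficients beyond [K] must vanish so that polynomials of different lengths can be combined and
    compared at every index. *)
Definition dpoly (p : nat -> C) (K : nat) (P : C -> C) : Prop :=
  (forall k, (K < k)%nat -> p k = RtoC 0) /\
  forall s, P s = sum_n (dirichlet_term p s) K.

Definition is_dpoly (P : C -> C) : Prop := exists p K, dpoly p K P.

Lemma dirichlet_term_0 (p : nat -> C) (s : C) (k : nat) :
  p k = RtoC 0 -> dirichlet_term p s k = RtoC 0.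
Proof. intros H. unfold dirichlet_term. rewrite H; ring. Qed.

Lemma dpoly_widen (p : nat -> C) (K L : nat) (P : C -> C) :
  (K <= L)%nat -> dpoly p K P -> dpoly p L P.
Proof.
  intros HKL [H0 H]. split; [intros; apply H0; lia|].
  intros s. rewrite H. symmetry. apply sumC_stable; auto.
  intros; apply dirichlet_term_0; auto.
Qed.

Lemma dpoly_lin (c : C) (p q : nat -> C) (K L : nat) (P Q : C -> C) :
  dpoly p K P -> dpoly q L Q ->
  dpoly (fun k => p k + c * q k)%C (Nat.max K L) (fun s => P s + c * Q s)%C.
Proof.
  intros HP HQ. apply (dpoly_widen _ _ (Nat.max K L)) in HP; [|lia].
  apply (dpoly_widen _ _ (Nat.max K L)) in HQ; [|lia].
  destruct HP as [HP0 HP], HQ as [HQ0 HQ]. split.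
  - intros k Hk. rewrite HP0, HQ0 by auto. cring.
  - intros s. rewrite HP, HQ, <- sumC_scal, <- sumC_plus. apply sum_n_ext.
    intros k. unfold dirichlet_term. cring.
Qed.

Lemma is_dpoly_ext (P Q : C -> C) : (forall s, P s = Q s) -> is_dpoly P -> is_dpoly Q.
Proof.
  intros H [p [K [H0 HP]]]. exists p, K. split; auto. intros s. rewrite <- H; auto.
Qed.

Lemma is_dpoly_term (c : C) (n : nat) : is_dpoly (fun s => c * npow_neg n s)%C.
Proof.
  exists (fun k => if Nat.eqb k n then c else RtoC 0), n. split.
  - intros k Hk. destruct (Nat.eqb_spec k n); [lia | auto].
  - intros s. destruct n as [|n].
    + rewrite sumC_0. reflexivity.
    + rewrite sumC_S, (sum_n_ext_loc _ (fun _ => RtoC 0)), sumC_zero.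
      * unfold dirichlet_term. rewrite Nat.eqb_refl. ring.
      * intros k Hk. apply dirichlet_term_0. destruct (Nat.eqb_spec k (S n)); [lia | auto].
Qed.

Lemma is_dpoly_const (c : C) : is_dpoly (fun _ => c).
Proof.
  apply is_dpoly_ext with (2 := is_dpoly_term c 0). intros s. rewrite npow_neg_0; ring.
Qed.

Lemma is_dpoly_plus (P Q : C -> C) :
  is_dpoly P -> is_dpoly Q -> is_dpoly (fun s => P s + Q s)%C.
Proof.
  intros [p [K HP]] [q [L HQ]].
  apply is_dpoly_ext with (fun s => P s + 1 * Q s)%C; [intros; ring|].
  eexists; eexists. apply dpoly_lin; eauto.
Qed.

Lemma is_dpoly_sum (P : nat -> C -> C) (K : nat) :
  (forall k, is_dpoly (P k)) -> is_dpoly (fun s => sum_n (fun k => P k s) K).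
Proof.
  intros H. induction K as [|K IH].
  - apply is_dpoly_ext with (P 0%nat); auto. intros; symmetry; apply sumC_0.
  - apply is_dpoly_ext with (fun s => sum_n (fun k => P k s) K + P (S K) s)%C.
    + intros; symmetry; apply sumC_S.
    + apply is_dpoly_plus; auto.
Qed.

Lemma is_dpoly_partial (c : nat -> C) (K : nat) :
  is_dpoly (fun s => sum_n (dirichlet_term c s) K).
Proof.
  apply (is_dpoly_sum (fun k s => c k * npow_neg k s)%C). intros; apply is_dpoly_term.
Qed.

Lemma is_dpoly_mult (P Q : C -> C) :
  is_dpoly P -> is_dpoly Q -> is_dpoly (fun s => P s * Q s)%C.
Proof.
  intros [p [K [_ HP]]] [q [L [_ HQ]]].
  apply is_dpoly_ext with
    (fun s => sum_n (fun k => sum_n (fun l => (p k * q l) * npow_neg (k * l + k + l) s)%C L) K).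
  - intros s. rewrite HP, HQ, <- sumC_scal_r. apply sum_n_ext. intros k.
    rewrite <- sumC_scal. apply sum_n_ext. intros l. unfold dirichlet_term.
    rewrite <- npow_neg_mult. cring.
  - apply (is_dpoly_sum (fun k s =>
      sum_n (fun l => (p k * q l) * npow_neg (k * l + k + l) s)%C L)). intros k.
    apply (is_dpoly_sum (fun l s => (p k * q l) * npow_neg (k * l + k + l) s)%C).
    intros l. apply is_dpoly_term.
Qed.

Lemma is_dpoly_bounded (P : C -> C) (e : R) : is_dpoly P ->
  exists B, 0 <= B /\ forall s, halfplane e s -> Cmod (P s) <= B.
Proof.
  intros [p [K [_ HP]]].
  exists (sum_n (fun k => Cmod (p k) * exp (- e * lnS k)) K). split.
  - apply sumR_nonneg. intros k. apply Rmult_le_pos; [apply Cmod_ge_0 | left; apply exp_pos].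
  - intros s Hs. rewrite HP. eapply Rle_trans; [apply sumC_Cmod|].
    apply sumR_le. intros k _. unfold dirichlet_term. rewrite Cmod_mult.
    apply Rmult_le_compat_l; [apply Cmod_ge_0|]. apply Cmod_npow_neg_le.
    unfold halfplane in Hs; lra.
Qed.

(** Approximation by arbitrary Dirichlet polynomials, instead of the partial sums of one series,
    makes closure under products and exponentials direct: nothing has to be said about partial sums
    of product series. *)
Definition unif_dpoly (e : R) (F : C -> C) : Prop :=
  forall eta, 0 < eta ->
    exists P, is_dpoly P /\ forall s, halfplane e s -> Cmod (F s - P s)%C <= eta.

Lemma unif_dpoly_of_dpoly (e : R) (P : C -> C) : is_dpoly P -> unif_dpoly e P.
Proof.
  intros H eta Heta. exists P; split; auto. intros s _.
  replace (P s - P s)%C with (RtoC 0) by ring. rewrite Cmod_0; lra.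
Qed.

Lemma unif_dpoly_lim (e : R) (F : C -> C) :
  (forall eta, 0 < eta ->
     exists G, unif_dpoly e G /\ forall s, halfplane e s -> Cmod (F s - G s)%C <= eta) ->
  unif_dpoly e F.
Proof.
  intros H eta Heta. destruct (H (eta / 2)) as [G [HG Hs]]; [lra|].
  destruct (HG (eta / 2)) as [P [HP Hs']]; [lra|]. exists P; split; auto.
  intros s Hh. specialize (Hs s Hh). specialize (Hs' s Hh).
  eapply Rle_trans; [apply (Cmod_triangle_minus _ (G s)) | lra].
Qed.

Lemma unif_dpoly_ext (e : R) (F G : C -> C) :
  (forall s, halfplane e s -> F s = G s) -> unif_dpoly e F -> unif_dpoly e G.
Proof.
  intros H HF eta Heta. destruct (HF eta Heta) as [P [HP Hs]]. exists P; split; auto.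
  intros s Hh. rewrite <- H; auto.
Qed.

Lemma unif_dpoly_bounded (e : R) (F : C -> C) : unif_dpoly e F ->
  exists B, 0 <= B /\ forall s, halfplane e s -> Cmod (F s) <= B.
Proof.
  intros H. destruct (H 1) as [P [HP Hs]]; [lra|].
  destruct (is_dpoly_bounded P e HP) as [B [HB Hb]]. exists (B + 1). split; [lra|].
  intros s Hh. specialize (Hs s Hh); specialize (Hb s Hh).
  eapply Rle_trans; [apply (Cmod_le_of_close _ (P s)) | lra].
Qed.

Lemma unif_dpoly_const (e : R) (c : C) : unif_dpoly e (fun _ => c).
Proof. apply unif_dpoly_of_dpoly, is_dpoly_const. Qed.

Lemma unif_dpoly_plus (e : R) (F G : C -> C) :
  unif_dpoly e F -> unif_dpoly e G -> unif_dpoly e (fun s => F s + G s)%C.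
Proof.
  intros HF HG eta Heta.
  destruct (HF (eta / 2)) as [P [HP Hs]]; [lra|].
  destruct (HG (eta / 2)) as [Q [HQ Hs']]; [lra|].
  exists (fun s => P s + Q s)%C. split; [apply is_dpoly_plus; auto|].
  intros s Hh. specialize (Hs s Hh); specialize (Hs' s Hh).
  replace (F s + G s - (P s + Q s))%C with ((F s - P s) + (G s - Q s))%C by ring.
  eapply Rle_trans; [apply Cmod_triangle | lra].
Qed.

Lemma unif_dpoly_mult (e : R) (F G : C -> C) :
  unif_dpoly e F -> unif_dpoly e G -> unif_dpoly e (fun s => F s * G s)%C.
Proof.
  intros HF HG eta Heta.
  destruct (unif_dpoly_bounded e F HF) as [B [HB0 HB]].
  destruct (unif_dpoly_bounded e G HG) as [D [HD0 HD]].
  (* Since t <= 1, [Q] is bounded by D + 1, and the product is approximated within B t + (D + 1)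
     t. *)
  set (t := Rmin 1 (eta / (B + D + 1))).
  assert (Ht : 0 < t).
  { apply Rmin_glb_lt; [lra | apply Rdiv_lt_0_compat; lra]. }
  assert (Ht1 : t <= 1) by apply Rmin_l.
  assert (Ht2 : t * (B + D + 1) <= eta).
  { apply Rle_trans with (eta / (B + D + 1) * (B + D + 1)).
    - apply Rmult_le_compat_r; [lra | apply Rmin_r].
    - right; field; lra. }
  destruct (HF t Ht) as [P [HP Hs]]. destruct (HG t Ht) as [Q [HQ Hs']].
  exists (fun s => P s * Q s)%C. split; [apply is_dpoly_mult; auto|].
  intros s Hh. specialize (Hs s Hh); specialize (Hs' s Hh).
  specialize (HB s Hh); specialize (HD s Hh).
  replace (F s * G s - P s * Q s)%C with (F s * (G s - Q s) + Q s * (F s - P s))%C by ring.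
  eapply Rle_trans; [apply Cmod_triangle|]. rewrite !Cmod_mult.
  pose proof (Cmod_le_of_close' (G s) (Q s)).
  pose proof (Cmod_ge_0 (F s)). pose proof (Cmod_ge_0 (Q s)).
  pose proof (Cmod_ge_0 (F s - P s)%C). pose proof (Cmod_ge_0 (G s - Q s)%C).
  assert (Cmod (F s) * Cmod (G s - Q s)%C <= B * t) by (apply Rmult_le_compat; auto).
  assert (Cmod (Q s) * Cmod (F s - P s)%C <= (D + 1) * t)
    by (apply Rmult_le_compat; auto; lra).
  nra.
Qed.

Lemma unif_dpoly_pow (e : R) (F : C -> C) (n : nat) :
  unif_dpoly e F -> unif_dpoly e (fun s => F s ^ n)%C.
Proof.
  intros HF. induction n as [|n IH]; simpl.
  - apply unif_dpoly_const.
  - apply unif_dpoly_mult; auto.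
Qed.

Lemma unif_dpoly_Cexp (e : R) (F : C -> C) :
  unif_dpoly e F -> unif_dpoly e (fun s => Cexp (F s)).
Proof.
  intros HF. apply unif_dpoly_lim. intros eta Heta.
  destruct (unif_dpoly_bounded e F HF) as [B [HB0 HB]].
  set (A := 3 * B ^ 2 * exp B).
  assert (HA : 0 <= A).
  { unfold A. pose proof (exp_pos B). pose proof (pow2_ge_0 B). nra. }
  (* One index serves twice: beyond 2B the estimate of [Cexp_compound_approx] applies, and beyond
     A/eta its error is at most eta. *)
  destruct (nfloor_ex (A / eta + 2 * B)) as [n [_ Hn]].
  { assert (0 <= A / eta) by (apply Rmult_le_pos; [auto | left; apply Rinv_0_lt_compat; auto]).
    lra. }
  rewrite <- S_INR in Hn. pose proof (INR_S_pos n) as Hpos.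
  assert (HAe : 0 <= A / eta).
  { apply Rmult_le_pos; [auto | left; apply Rinv_0_lt_compat; auto]. }
  exists (fun s => (1 + F s / RtoC (INR (S n))) ^ S n)%C. split.
  - apply unif_dpoly_pow. apply unif_dpoly_plus; [apply unif_dpoly_const|].
    apply unif_dpoly_mult; [auto | apply unif_dpoly_const].
  - intros s Hh. specialize (HB s Hh). pose proof (Cmod_ge_0 (F s)).
    eapply Rle_trans; [apply Cexp_compound_approx; [lia | lra]|].
    apply Rle_trans with (A / INR (S n)).
    + apply Rmult_le_compat_r; [left; apply Rinv_0_lt_compat; auto|].
      unfold A. apply Rmult_le_compat.
      * pose proof (pow2_ge_0 (Cmod (F s))); lra.
      * left; apply exp_pos.
      * apply Rmult_le_compat_l; [lra|]. apply pow_incr; lra.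
      * apply exp_le; auto.
    + apply Rmult_le_reg_r with (INR (S n)); auto.
      replace (A / INR (S n) * INR (S n)) with (A / eta * eta) by (field; lra).
      rewrite (Rmult_comm eta). apply Rmult_le_compat_r; lra.
Qed.

(** * Limits as Re s tends to infinity, and means *)

Definition lim_infty (F : C -> C) (v : C) : Prop :=
  forall eta, 0 < eta -> exists M, forall s, M < Re s -> Cmod (F s - v)%C < eta.

Lemma lim_infty_ext (e : R) (F G : C -> C) (v : C) :
  (forall s, halfplane e s -> F s = G s) -> lim_infty F v -> lim_infty G v.
Proof.
  intros H HF eta Heta. destruct (HF eta Heta) as [M HM]. exists (Rmax M e).
  intros s Hs. pose proof (Rmax_l M e). pose proof (Rmax_r M e).
  rewrite <- H; [apply HM; lra | unfold halfplane; lra].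
Qed.

Lemma lim_infty_const (v : C) : lim_infty (fun _ => v) v.
Proof.
  intros eta Heta. exists 0. intros s _.
  replace (v - v)%C with (RtoC 0) by ring. rewrite Cmod_0; lra.
Qed.

Lemma lim_infty_plus (F G : C -> C) (v w : C) :
  lim_infty F v -> lim_infty G w -> lim_infty (fun s => F s + G s)%C (v + w)%C.
Proof.
  intros HF HG eta Heta.
  destruct (HF (eta / 2)) as [M HM]; [lra|]. destruct (HG (eta / 2)) as [M' HM']; [lra|].
  exists (Rmax M M'). intros s Hs. pose proof (Rmax_l M M'). pose proof (Rmax_r M M').
  specialize (HM s ltac:(lra)). specialize (HM' s ltac:(lra)).
  replace (F s + G s - (v + w))%C with ((F s - v) + (G s - w))%C by ring.
  eapply Rle_lt_trans; [apply Cmod_triangle | lra].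
Qed.

Lemma lim_infty_mult (F G : C -> C) (v w : C) :
  lim_infty F v -> lim_infty G w -> lim_infty (fun s => F s * G s)%C (v * w)%C.
Proof.
  intros HF HG eta Heta.
  set (B := Cmod v + Cmod w + 1).
  assert (HB : 1 <= B) by (unfold B; pose proof (Cmod_ge_0 v); pose proof (Cmod_ge_0 w); lra).
  set (t := Rmin 1 (eta / (2 * B))).
  assert (Ht : 0 < t).
  { apply Rmin_glb_lt; [lra | apply Rdiv_lt_0_compat; lra]. }
  assert (Ht1 : t <= 1) by apply Rmin_l.
  assert (Ht2 : t * (2 * B) <= eta).
  { apply Rle_trans with (eta / (2 * B) * (2 * B)).
    - apply Rmult_le_compat_r; [lra | apply Rmin_r].
    - right; field; lra. }
  destruct (HF t Ht) as [M HM]. destruct (HG t Ht) as [M' HM'].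
  exists (Rmax M M'). intros s Hs. pose proof (Rmax_l M M'). pose proof (Rmax_r M M').
  specialize (HM s ltac:(lra)). specialize (HM' s ltac:(lra)).
  replace (F s * G s - v * w)%C with ((F s - v) * G s + v * (G s - w))%C by ring.
  eapply Rle_lt_trans; [apply Cmod_triangle|]. rewrite !Cmod_mult.
  pose proof (Cmod_le_of_close (G s) w).
  pose proof (Cmod_ge_0 (G s)). pose proof (Cmod_ge_0 v). pose proof (Cmod_ge_0 w).
  pose proof (Cmod_ge_0 (F s - v)%C). pose proof (Cmod_ge_0 (G s - w)%C).
  assert (Cmod (F s - v)%C * Cmod (G s) <= t * (Cmod w + 1))
    by (apply Rmult_le_compat; lra).
  assert (Cmod v * Cmod (G s - w)%C <= Cmod v * t)
    by (apply Rmult_le_compat_l; lra).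
  unfold B in *. nra.
Qed.

Lemma lim_infty_Cexp (F : C -> C) (v : C) :
  lim_infty F v -> lim_infty (fun s => Cexp (F s)) (Cexp v).
Proof.
  intros HF eta Heta. set (E := Cmod (Cexp v)).
  assert (HE : 0 < E) by (unfold E; rewrite Cmod_Cexp; apply exp_pos).
  set (t := Rmin (1 / 2) (eta / (4 * E))).
  assert (Ht : 0 < t).
  { apply Rmin_glb_lt; [lra | apply Rdiv_lt_0_compat; lra]. }
  assert (Ht1 : t <= 1 / 2) by apply Rmin_l.
  assert (Ht2 : t * (4 * E) <= eta).
  { apply Rle_trans with (eta / (4 * E) * (4 * E)).
    - apply Rmult_le_compat_r; [lra | apply Rmin_r].
    - right; field; lra. }
  destruct (HF t Ht) as [M HM]. exists M. intros s Hs. specialize (HM s Hs).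
  set (u := (F s - v)%C) in *.
  replace (Cexp (F s) - Cexp v)%C with (Cexp v * ((Cexp u - (1 + u)) + u))%C.
  2:{ replace (F s) with (v + u)%C by (unfold u; ring). rewrite Cexp_plus. ring. }
  rewrite Cmod_mult. fold E.
  pose proof (Cmod_triangle (Cexp u - (1 + u))%C u).
  pose proof (Cexp_linear_approx u ltac:(lra)). pose proof (Cmod_ge_0 u).
  assert (Cmod (Cexp u - (1 + u) + u)%C < 4 * t) by nra.
  apply Rlt_le_trans with (E * (4 * t)); [apply Rmult_lt_compat_l; auto | lra].
Qed.

Lemma lim_infty_npow_neg (c : C) (k : nat) :
  lim_infty (fun s => c * npow_neg (S k) s)%C (RtoC 0).
Proof.
  intros eta Heta. assert (Hl : 0 < lnS (S k)) by (rewrite <- lnS_0; apply lnS_lt; lia).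
  exists (Cmod c / (lnS (S k) * eta)). intros s Hs.
  replace (c * npow_neg (S k) s - 0)%C with (c * npow_neg (S k) s)%C by ring.
  rewrite Cmod_mult, Cmod_npow_neg. pose proof (Cmod_ge_0 c) as Hc.
  assert (H0 : 0 <= Cmod c / (lnS (S k) * eta)).
  { apply Rmult_le_pos; auto. left; apply Rinv_0_lt_compat; nra. }
  replace (- Re s * lnS (S k)) with (- (Re s * lnS (S k))) by ring.
  rewrite exp_Ropp. pose proof (exp_ineq1_le (Re s * lnS (S k))) as He.
  assert (Hp : 0 < Re s * lnS (S k)) by (apply Rmult_lt_0_compat; lra).
  apply Rmult_lt_reg_r with (exp (Re s * lnS (S k))); [apply exp_pos|].
  rewrite Rmult_assoc, Rinv_l, Rmult_1_r by (apply Rgt_not_eq, exp_pos).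
  apply Rle_lt_trans with (Cmod c / (lnS (S k) * eta) * (lnS (S k) * eta)).
  - right; field; lra.
  - apply Rlt_le_trans with (Re s * (lnS (S k) * eta)); [apply Rmult_lt_compat_r; nra | nra].
Qed.

Lemma lim_infty_dpoly (p : nat -> C) (K : nat) :
  lim_infty (fun s => sum_n (dirichlet_term p s) K) (p 0%nat).
Proof.
  induction K as [|K IH].
  - apply (lim_infty_ext 0 (fun _ => p 0%nat)); [|apply lim_infty_const].
    intros s _. rewrite sumC_0. unfold dirichlet_term. rewrite npow_neg_0. ring.
  - apply (lim_infty_ext 0 (fun s => sum_n (dirichlet_term p s) K
                                      + p (S K) * npow_neg (S K) s)%C).
    + intros s _. rewrite sumC_S. reflexivity.
    + rewrite <- (Cplus_0_r (p 0%nat)). apply lim_infty_plus; auto.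
      apply lim_infty_npow_neg.
Qed.

Lemma avg_dist (u v : nat -> R) (eta : R) (N : nat) :
  (forall j, Rabs (u j - v j) <= eta) -> Rabs (avg u N - avg v N) <= eta.
Proof.
  intros H. apply Rabs_le.
  assert (H1 : avg u N <= avg (fun j => v j + eta) N).
  { apply avg_le. intros j. specialize (H j). apply Rabs_le_between in H. lra. }
  assert (H2 : avg v N <= avg (fun j => u j + eta) N).
  { apply avg_le. intros j. specialize (H j). apply Rabs_le_between in H. lra. }
  rewrite avg_plus, avg_const in H1, H2. lra.
Qed.

Lemma halfplane_vpt (e sigma : R) (j : nat) : e < sigma -> halfplane e (vpt sigma j).
Proof. intros H; exact H. Qed.

(** Both functions are compared at a real point far to the right, where [P] is close to its constant
    coefficient and [F] to [v]. *)
Lemma coeff0_close (e : R) (F : C -> C) (v : C) (p : nat -> C) (K : nat) (P : C -> C) (eta : R) :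
  lim_infty F v -> dpoly p K P -> (forall s, halfplane e s -> Cmod (F s - P s)%C <= eta) ->
  Cmod (p 0%nat - v)%C <= eta.
Proof.
  intros HF [_ HP] Hs. apply le_epsilon. intros t Ht.
  destruct (HF (t / 2)) as [M HM]; [lra|].
  destruct (lim_infty_dpoly p K (t / 2)) as [M' HM']; [lra|].
  set (x := RtoC (Rmax e (Rmax M M') + 1)).
  assert (Hx : Re x = Rmax e (Rmax M M') + 1) by reflexivity.
  pose proof (Rmax_l e (Rmax M M')). pose proof (Rmax_r e (Rmax M M')).
  pose proof (Rmax_l M M'). pose proof (Rmax_r M M').
  specialize (HM x ltac:(lra)). specialize (HM' x ltac:(lra)).
  specialize (Hs x ltac:(unfold halfplane; lra)). rewrite <- HP in HM'.
  pose proof (Cmod_triangle_minus (p 0%nat) (P x) v).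
  pose proof (Cmod_triangle_minus (P x) (F x) v).
  rewrite (Cmod_minus_sym (p 0%nat) (P x)), (Cmod_minus_sym (P x) (F x)) in *. lra.
Qed.

(** A uniform error carries over unchanged to averages and to values at infinity, so the polynomial
    case passes to the limit. *)
Lemma mean_Re_unif (e sigma : R) (F : C -> C) (v : C) :
  unif_dpoly e F -> lim_infty F v -> e < sigma ->
  mean (fun j => Re (F (vpt sigma j))) (Re v).
Proof.
  intros HF Hv He. apply is_lim_seq_spec. intros eta.
  pose proof (cond_pos eta) as Heta. set (t := eta / 4).
  assert (Ht : 0 < t) by (unfold t; lra).
  destruct (HF t Ht) as [P [[p [K HP]] Hs]].
  pose proof (coeff0_close e F v p K P t Hv HP Hs) as Hp0.
  destruct (mean_eventually _ _ t (mean_Re_poly sigma p K) Ht) as [N0 HN0].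
  exists N0. intros N HN. specialize (HN0 N HN).
  assert (Hd : Rabs (avg (fun j => Re (F (vpt sigma j))) N
              - avg (fun j => Re (sum_n (dirichlet_term p (vpt sigma j)) K)) N) <= t).
  { apply avg_dist. intros j. destruct HP as [_ HP]. rewrite <- HP.
    eapply Rle_trans; [|apply (Hs (vpt sigma j)); exact He].
    apply (re_le_Cmod (F (vpt sigma j) - P (vpt sigma j))%C). }
  assert (Hr : Rabs (Re (p 0%nat) - Re v) <= t).
  { eapply Rle_trans; [|exact Hp0]. apply (re_le_Cmod (p 0%nat - v)%C). }
  apply Rabs_le_between in Hd. apply Rabs_le_between in Hr. apply Rabs_lt_between in HN0.
  apply Rabs_lt_between. unfold t in *. lra.
Qed.

(** * Dirichlet coefficients, Bessel and Parseval *)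

Lemma inv_S_eventually (eta : R) : 0 < eta ->
  exists N, forall n, (N <= n)%nat -> / INR (S n) < eta.
Proof.
  intros H. destruct (nfloor_ex (/ eta)) as [N [_ HN]].
  { left; apply Rinv_0_lt_compat; auto. }
  exists N. intros n Hn. rewrite <- (Rinv_inv eta). rewrite <- S_INR in HN.
  apply Rinv_lt_contravar.
  - apply Rmult_lt_0_compat; [apply Rinv_0_lt_compat; auto | apply INR_S_pos].
  - apply Rlt_le_trans with (1 := HN). apply le_INR; lia.
Qed.

Lemma inv_S_pos (n : nat) : 0 < / INR (S n).
Proof. apply Rinv_0_lt_compat, INR_S_pos. Qed.

Lemma is_lim_seq_inv_S : is_lim_seq (fun n => / INR (S n)) 0.
Proof.
  apply is_lim_seq_spec. intros eta. destruct (inv_S_eventually eta (cond_pos eta)) as [N HN].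
  exists N. intros n Hn. rewrite Rminus_0_r, Rabs_pos_eq by (left; apply inv_S_pos).
  apply HN; auto.
Qed.

Lemma is_lim_seq_sum (u : nat -> nat -> R) (l : nat -> R) (L : nat) :
  (forall k, is_lim_seq (fun n => u n k) (l k)) ->
  is_lim_seq (fun n => sum_n (u n) L) (sum_n l L).
Proof.
  intros H. induction L as [|L IH].
  - apply is_lim_seq_ext with (fun n => u n 0%nat).
    + intros; symmetry; apply sumR_0.
    + rewrite sumR_0. apply H.
  - apply is_lim_seq_ext with (fun n => sum_n (u n) L + u n (S L)).
    + intros; symmetry; apply sumR_S.
    + rewrite sumR_S. apply (is_lim_seq_plus' _ _ (sum_n l L) (l (S L))); auto.
Qed.

Lemma Clim_Cmod_sqr (u : nat -> C) (l z : C) :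
  Clim u l -> is_lim_seq (fun n => Cmod (z - u n)%C ^ 2) (Cmod (z - l)%C ^ 2).
Proof.
  intros H.
  assert (H1 : is_lim_seq (fun n => Cmod (z - u n)%C) (Cmod (z - l)%C)).
  { apply is_lim_seq_spec. intros eta. destruct (H eta (cond_pos eta)) as [N HN].
    exists N. intros n Hn. specialize (HN n Hn).
    pose proof (Cmod_triangle_minus z (u n) l). pose proof (Cmod_triangle_minus z l (u n)).
    rewrite (Cmod_minus_sym l) in *. apply Rabs_lt_between. lra. }
  apply is_lim_seq_ext with (fun n => Cmod (z - u n)%C * Cmod (z - u n)%C).
  - intros; ring.
  - replace (Cmod (z - l)%C ^ 2) with (Cmod (z - l)%C * Cmod (z - l)%C) by ring.
    apply (is_lim_seq_mult' _ _ (Cmod (z - l)%C) (Cmod (z - l)%C)); auto.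
Qed.

Lemma lnS_gap (n : nat) : / INR (S (S n)) <= lnS (S n) - lnS n.
Proof.
  pose proof (INR_S_pos n) as H1. pose proof (INR_S_pos (S n)) as H2.
  set (x := lnS n - lnS (S n)).
  assert (Hx : exp x = 1 - / INR (S (S n))).
  { unfold x, Rminus at 1. rewrite exp_plus, exp_Ropp, !exp_lnS.
    rewrite (S_INR (S n)). field. rewrite <- S_INR; lra. }
  pose proof (exp_ineq1_le x). unfold x in *. lra.
Qed.

Lemma exp_tail_step (alpha : R) (n : nat) : 0 < alpha ->
  exp (- (alpha + 1) * lnS (S n))
  <= / alpha * (exp (- alpha * lnS n) - exp (- alpha * lnS (S n))).
Proof.
  intros Ha. pose proof (lnS_gap n) as Hg.
  set (y := / INR (S (S n))) in *.
  assert (Hy : 0 < y) by apply inv_S_pos.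
  set (E := exp (- alpha * lnS (S n))).
  assert (HE : 0 < E) by apply exp_pos.
  replace (exp (- (alpha + 1) * lnS (S n))) with (E * y).
  2:{ unfold E, y. rewrite <- (exp_lnS (S n)), <- exp_Ropp, <- exp_plus. f_equal; ring. }
  apply Rmult_le_reg_l with alpha; auto.
  replace (alpha * (/ alpha * (exp (- alpha * lnS n) - E)))
    with (exp (- alpha * lnS n) - E) by (field; lra).
  assert (H : E * (1 + alpha * y) <= exp (- alpha * lnS n)).
  { apply Rle_trans with (E * exp (alpha * y)).
    - apply Rmult_le_compat_l; [lra | apply exp_ineq1_le].
    - unfold E. rewrite <- exp_plus. apply exp_le. nra. }
  lra.
Qed.

Lemma exp_tail_sum (alpha : R) (K n : nat) : 0 < alpha ->
  sum_n (fun i => exp (- (alpha + 1) * lnS (S K + i))) n <= exp (- alpha * lnS K) / alpha.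
Proof.
  intros Ha.
  assert (H : sum_n (fun i => exp (- (alpha + 1) * lnS (S K + i))) n
              <= / alpha * (exp (- alpha * lnS K) - exp (- alpha * lnS (S K + n)))).
  { induction n as [|n IH].
    - rewrite sumR_0, Nat.add_0_r. apply exp_tail_step; auto.
    - rewrite sumR_S. pose proof (exp_tail_step alpha (S K + n) Ha) as Hs.
      rewrite <- Nat.add_succ_r in Hs. lra. }
  apply Rle_trans with (1 := H). unfold Rdiv. rewrite (Rmult_comm _ (/ alpha)).
  apply Rmult_le_compat_l; [left; apply Rinv_0_lt_compat; auto|].
  pose proof (exp_pos (- alpha * lnS (S K + n))). lra.
Qed.

Lemma exp_sum_bounded (theta : R) : 1 < theta ->
  exists Z, 0 <= Z /\ forall n, sum_n (fun k => exp (- theta * lnS k)) n <= Z.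
Proof.
  intros H. exists (1 + 1 / (theta - 1)).
  assert (Hi : 0 < / (theta - 1)) by (apply Rinv_0_lt_compat; lra).
  split; [unfold Rdiv; lra|].
  assert (H0 : exp (- theta * lnS 0) = 1) by (rewrite lnS_0, Rmult_0_r; apply exp_0).
  intros [|n].
  - rewrite sumR_0, H0. unfold Rdiv; lra.
  - rewrite sumR_first, H0. apply Rplus_le_compat_l.
    pose proof (exp_tail_sum (theta - 1) 0 n ltac:(lra)) as Ht.
    rewrite lnS_0, Rmult_0_r, exp_0 in Ht.
    eapply Rle_trans; [|exact Ht]. right. apply sum_n_ext. intros i.
    simpl (1 + i)%nat. f_equal. f_equal. ring.
Qed.

Lemma sum_prod_le_sqrt (u v : nat -> R) (n : nat) :
  sum_n (fun k => u k * v k) n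
  <= sqrt (sum_n (fun k => u k ^ 2) n * sum_n (fun k => v k ^ 2) n).
Proof.
  apply Rle_trans with (1 := Rle_abs _). rewrite <- sqrt_Rsqr_abs.
  apply sqrt_le_1_alt. pose proof (cauchy_schwarz_sum u v n) as H.
  unfold Rsqr. simpl in *. lra.
Qed.

Lemma exp_sqr (x : R) : exp x ^ 2 = exp (2 * x).
Proof. simpl. rewrite Rmult_1_r, <- exp_plus. f_equal; ring. Qed.

Lemma Cplus_minus_l (x y : C) : (x + y - x)%C = y.
Proof. ring. Qed.

Lemma Cminus_plus_plus (x u v w : C) : ((x + u) - (v + w))%C = ((x - v) + (u - w))%C.
Proof. ring. Qed.

Lemma Cminus_minus_minus (x u v w : C) : ((x - u) - (v - w))%C = ((x - v) + - (u - w))%C.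
Proof. ring. Qed.

Lemma Cminus_lin (x y : C) : (x - y)%C = (x + (- (1)) * y)%C.
Proof. ring. Qed.

Lemma Cminus_0_r (x : C) : (x - 0)%C = x.
Proof. ring. Qed.

(** Cauchy-Schwarz against k^{-rho}, whose squares have a tail of exponent 2 rho > 1. The bound sees
    [b] only through [B] and [s] only through [rho], hence it is uniform both in s and along bounded
    families of series. *)
Lemma dirichlet_tail (b : nat -> C) (B rho : R) (s z : C) :
  (forall n, sum_n (fun k => Cmod (b k) ^ 2) n <= B) -> 1 / 2 < rho -> rho <= Re s ->
  Clim (sum_n (dirichlet_term b s)) z ->
  forall K, Cmod (z - sum_n (dirichlet_term b s) K)%C
            <= sqrt (B * (exp (- (2 * rho - 1) * lnS K) / (2 * rho - 1))).
Proof.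
  intros HB Hrho Hs Hz K. apply Clim_dist_le with (1 := Hz). exists (S K). intros n Hn.
  replace n with (S K + (n - S K))%nat by lia. set (m := (n - S K)%nat).
  rewrite sumC_split.
  rewrite Cplus_minus_l.
  eapply Rle_trans; [apply sumC_Cmod|].
  apply Rle_trans with
    (sum_n (fun i => Cmod (b (S K + i)%nat) * exp (- rho * lnS (S K + i))) m).
  { apply sumR_le. intros i _. unfold dirichlet_term. rewrite Cmod_mult.
    apply Rmult_le_compat_l; [apply Cmod_ge_0 | apply Cmod_npow_neg_le; auto]. }
  eapply Rle_trans; [apply sum_prod_le_sqrt|]. apply sqrt_le_1_alt.
  apply Rmult_le_compat.
  - apply sumR_nonneg; intros; apply pow2_ge_0.
  - apply sumR_nonneg; intros; apply pow2_ge_0.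
  - apply Rle_trans with (2 := HB (S K + m)%nat). rewrite (sumR_split (fun k => Cmod (b k) ^ 2)).
    assert (0 <= sum_n (fun k => Cmod (b k) ^ 2) K)
      by (apply sumR_nonneg; intros; apply pow2_ge_0). lra.
  - eapply Rle_trans; [|apply (exp_tail_sum (2 * rho - 1) K m); lra].
    right. apply sum_n_ext. intros i. rewrite exp_sqr. f_equal. ring.
Qed.

Lemma dirichlet_tail_small (B alpha eta : R) : 0 <= B -> 0 < alpha -> 0 < eta ->
  exists K, forall k, (K <= k)%nat -> sqrt (B * (exp (- alpha * lnS k) / alpha)) < eta.
Proof.
  intros HB Ha He.
  (* Since e^x > x, having alpha * lnS k > D already forces the quantity under the root below
     eta^2. *)
  set (D := B / alpha / eta ^ 2).
  assert (He2 : 0 < eta ^ 2) by nra.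
  assert (HD : 0 <= D).
  { unfold D, Rdiv. repeat apply Rmult_le_pos; auto; left; apply Rinv_0_lt_compat; auto. }
  destruct (nfloor_ex (exp (D / alpha))) as [K [_ HK]]; [left; apply exp_pos|].
  exists K. intros k Hk. rewrite <- S_INR in HK.
  assert (Hl : D < alpha * lnS k).
  { apply Rmult_lt_reg_l with (/ alpha); [apply Rinv_0_lt_compat; auto|].
    rewrite <- Rmult_assoc, Rinv_l, Rmult_1_l, Rmult_comm by lra.
    apply exp_lt_inv. rewrite exp_lnS. apply Rlt_le_trans with (1 := HK). apply le_INR; lia. }
  rewrite <- (sqrt_pow2 eta) by lra. apply sqrt_lt_1_alt. split.
  { apply Rmult_le_pos; auto. apply Rmult_le_pos; [left; apply exp_pos|].
    left; apply Rinv_0_lt_compat; auto. }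
  replace (- alpha * lnS k) with (- (alpha * lnS k)) by ring. rewrite exp_Ropp.
  pose proof (exp_ineq1_le (alpha * lnS k)). pose proof (exp_pos (alpha * lnS k)).
  apply Rmult_lt_reg_r with (exp (alpha * lnS k)); auto.
  replace (B * (/ exp (alpha * lnS k) / alpha) * exp (alpha * lnS k)) with (D * eta ^ 2).
  - rewrite (Rmult_comm D). apply Rmult_lt_compat_l; lra.
  - unfold D. field. repeat split; lra.
Qed.

Lemma weighted_le (x y sigma : R) (n : nat) : 0 <= x -> 0 <= y ->
  x ^ 2 * wt sigma n <= y ^ 2 -> x <= y * exp (sigma * lnS n).
Proof.
  intros Hx Hy H. pose proof (exp_pos (sigma * lnS n)) as He.
  assert (Hw : wt sigma n * exp (sigma * lnS n) ^ 2 = 1).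
  { unfold wt. rewrite exp_sqr, <- exp_plus.
    replace (- (2 * sigma) * lnS n + 2 * (sigma * lnS n)) with 0 by ring. apply exp_0. }
  apply Rsqr_incr_0_var; [|nra]. unfold Rsqr.
  apply Rle_trans with (x ^ 2 * wt sigma n * exp (sigma * lnS n) ^ 2).
  - rewrite Rmult_assoc, Hw. right; ring.
  - apply Rle_trans with (y ^ 2 * exp (sigma * lnS n) ^ 2); [|right; ring].
    apply Rmult_le_compat_r; [apply pow2_ge_0 | auto].
Qed.

Lemma poly_square_le (sigma A : R) (p : nat -> C) (K : nat) (P : C -> C) :
  dpoly p K P ->
  (exists N0, forall N, (N0 <= N)%nat -> avg (fun j => Cmod (P (vpt sigma j)) ^ 2) N <= A) ->
  forall L, sum_n (fun k => Cmod (p k) ^ 2 * wt sigma k) L <= A.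
Proof.
  intros [H0 HP] [N0 HN] L.
  apply Rle_trans with (sum_n (fun k => Cmod (p k) ^ 2 * wt sigma k) (Nat.max K L)).
  { apply sumR_mono; [|lia]. intros k. apply Rmult_le_pos; [apply pow2_ge_0|].
    left; apply wt_pos. }
  rewrite sumR_stable with (N := K); [|intros k Hk; rewrite H0, Cmod_0 by auto; ring|lia].
  apply le_epsilon. intros t Ht.
  destruct (mean_eventually _ _ t (mean_square_poly sigma p K) Ht) as [N1 HN1].
  specialize (HN (Nat.max N0 N1) ltac:(lia)). specialize (HN1 (Nat.max N0 N1) ltac:(lia)).
  rewrite (avg_ext _ (fun j => Cmod (sum_n (dirichlet_term p (vpt sigma j)) K) ^ 2)) in HN
    by (intros; rewrite HP; reflexivity).
  apply Rabs_lt_between in HN1. lra.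
Qed.

(** A mean square never exceeds the square of the supremum. This is what makes coefficients stable
    under uniform approximation. *)
Lemma dpoly_dist (e sigma eta : R) (p q : nat -> C) (K L : nat) (P Q : C -> C) :
  dpoly p K P -> dpoly q L Q -> e < sigma ->
  (forall s, halfplane e s -> Cmod (P s - Q s)%C <= eta) ->
  forall n, sum_n (fun k => Cmod (p k - q k)%C ^ 2 * wt sigma k) n <= eta ^ 2.
Proof.
  intros HP HQ He H n.
  eapply Rle_trans.
  2:{ apply (poly_square_le sigma (eta ^ 2) _ _ _ (dpoly_lin (- (1)) p q K L P Q HP HQ)) with (L := n).
      exists 0%nat. intros N _. apply Rle_trans with (avg (fun _ => eta ^ 2) N);
        [|rewrite avg_const; lra]. apply avg_le. intros j.
      specialize (H (vpt sigma j) He). apply pow_incr. split; [apply Cmod_ge_0|].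
      eapply Rle_trans; [|exact H]. right. f_equal. ring. }
  right. apply sum_n_ext. intros k. do 3 f_equal. ring.
Qed.

(** One term of the weighted sum on Re s = 2, a line inside C_1. The factor (k+1)^2 is harmless,
    since k stays fixed when limits are taken. *)
Lemma dpoly_coeff_dist (eta : R) (p q : nat -> C) (K L : nat) (P Q : C -> C) :
  0 <= eta -> dpoly p K P -> dpoly q L Q ->
  (forall s, halfplane 1 s -> Cmod (P s - Q s)%C <= eta) ->
  forall k, Cmod (p k - q k)%C <= eta * exp (2 * lnS k).
Proof.
  intros He HP HQ H k. apply weighted_le; auto; [apply Cmod_ge_0|].
  eapply Rle_trans; [|apply (dpoly_dist 1 2 eta p q K L P Q HP HQ ltac:(lra) H k)].
  apply (sumR_term_le (fun k => Cmod (p k - q k)%C ^ 2 * wt 2 k)); auto.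
  intros i. apply Rmult_le_pos; [apply pow2_ge_0 | left; apply wt_pos].
Qed.

Lemma choose_seq (A : Type) (R : nat -> A -> Prop) :
  (forall n, exists x, R n x) -> exists f : nat -> A, forall n, R n (f n).
Proof.
  intros H. exists (fun n => proj1_sig (constructive_indefinite_description _ (H n))).
  intros n. apply proj2_sig.
Qed.

Lemma unif_dpoly_seq (e : R) (F : C -> C) : unif_dpoly e F ->
  exists (p : nat -> nat -> C) (K : nat -> nat) (P : nat -> C -> C),
    forall n, dpoly (p n) (K n) (P n) /\
      forall s, halfplane e s -> Cmod (F s - P n s)%C <= / INR (S n).
Proof.
  intros H.
  destruct (choose_seq ((nat -> C) * nat * (C -> C))
    (fun n x => dpoly (fst (fst x)) (snd (fst x)) (snd x) /\
      forall s, halfplane e s -> Cmod (F s - snd x s)%C <= / INR (S n))) as [f Hf].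
  - intros n. destruct (H (/ INR (S n)) (inv_S_pos n)) as [P [[p [K HP]] Hs]].
    exists (p, K, P); auto.
  - exists (fun n => fst (fst (f n))), (fun n => snd (fst (f n))), (fun n => snd (f n)). exact Hf.
Qed.

(* [b] is the sequence of Dirichlet coefficients of [F], read off from any
   approximation of [F] by Dirichlet polynomials on [C_1]. *)
Definition is_coeffs (F : C -> C) (b : nat -> C) : Prop :=
  forall p K P eta, dpoly p K P -> 0 <= eta ->
    (forall s, halfplane 1 s -> Cmod (F s - P s)%C <= eta) ->
    forall k, Cmod (p k - b k)%C <= eta * exp (2 * lnS k).

(** A single approximating sequence with convergent coefficients suffices: any polynomial within eta
    of [F] is within eta + t n of [Q n], and n tends to infinity. *)
Lemma is_coeffs_of_approx (F : C -> C) (b : nat -> C) (q : nat -> nat -> C)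
  (L : nat -> nat) (Q : nat -> C -> C) (t : nat -> R) :
  (forall n, dpoly (q n) (L n) (Q n)) ->
  (forall n, forall s, halfplane 1 s -> Cmod (F s - Q n s)%C <= t n) ->
  (forall n, 0 <= t n) -> is_lim_seq t 0 ->
  (forall k, Clim (fun n => q n k) (b k)) -> is_coeffs F b.
Proof.
  intros HQ Hs Ht0 Ht Hq p K P eta HP Heta HF k.
  set (E := exp (2 * lnS k)). assert (HE : 0 < E) by apply exp_pos.
  rewrite Cmod_minus_sym. apply le_epsilon. intros d Hd.
  apply is_lim_seq_spec in Ht.
  assert (Hd' : 0 < d / E) by (apply Rdiv_lt_0_compat; auto).
  destruct (Ht (mkposreal _ Hd')) as [N HN].
  apply Clim_dist_le with (1 := Hq k). exists N. intros n Hn.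
  specialize (HN n Hn). simpl in HN. rewrite Rminus_0_r, Rabs_pos_eq in HN by auto.
  specialize (Ht0 n).
  rewrite Cmod_minus_sym.
  eapply Rle_trans.
  - apply (dpoly_coeff_dist (eta + t n) p (q n) K (L n) P (Q n)); auto; [lra|].
    intros s H1. specialize (HF s H1). specialize (Hs n s H1).
    pose proof (Cmod_triangle_minus (P s) (F s) (Q n s)).
    rewrite (Cmod_minus_sym (P s)) in *. rewrite (Cmod_minus_sym (P s) (F s)) in *. lra.
  - fold E. rewrite Rmult_plus_distr_r. apply Rplus_le_compat_l.
    apply Rle_trans with (d / E * E); [apply Rmult_le_compat_r; lra|]. right; field; lra.
Qed.

Lemma is_coeffs_exists (F : C -> C) : unif_dpoly 1 F -> exists b, is_coeffs F b.
Proof.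
  intros H. destruct (unif_dpoly_seq 1 F H) as [p [K [P HP]]].
  destruct (choose_seq C (fun k l => Clim (fun n => p n k) l)) as [b Hb].
  - intros k. apply Clim_Cauchy. intros eta Heta.
    set (E := exp (2 * lnS k)). assert (HE : 0 < E) by apply exp_pos.
    destruct (inv_S_eventually (eta / (2 * E))) as [N HN].
    { apply Rdiv_lt_0_compat; lra. }
    exists N. intros m n Hm Hn. specialize (HN m Hm) as Hm'. specialize (HN n Hn) as Hn'.
    pose proof (inv_S_pos m). pose proof (inv_S_pos n).
    eapply Rle_lt_trans.
    + apply (dpoly_coeff_dist (/ INR (S m) + / INR (S n)) _ _ _ _ _ _ ltac:(lra)
               (proj1 (HP m)) (proj1 (HP n))).
      intros s Hs. pose proof (proj2 (HP m) s Hs). pose proof (proj2 (HP n) s Hs).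
      pose proof (Cmod_triangle_minus (P m s) (F s) (P n s)).
      rewrite (Cmod_minus_sym (P m s) (F s)) in *. lra.
    + fold E. apply Rlt_le_trans with (2 * (eta / (2 * E)) * E).
      * apply Rmult_lt_compat_r; lra.
      * right; field; lra.
  - exists b. apply (is_coeffs_of_approx F b p K P (fun n => / INR (S n))); auto.
    + intros n; apply (HP n).
    + intros n; apply (HP n).
    + intros n; left; apply inv_S_pos.
    + apply is_lim_seq_inv_S.
Qed.

Lemma is_coeffs_Clim (F : C -> C) (b : nat -> C) (p : nat -> nat -> C) (K : nat -> nat)
  (P : nat -> C -> C) :
  is_coeffs F b ->
  (forall n, dpoly (p n) (K n) (P n) /\
     forall s, halfplane 1 s -> Cmod (F s - P n s)%C <= / INR (S n)) ->
  forall k, Clim (fun n => p n k) (b k).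
Proof.
  intros Hb HP k eta Heta.
  set (E := exp (2 * lnS k)). assert (HE : 0 < E) by apply exp_pos.
  destruct (inv_S_eventually (eta / E)) as [N HN]; [apply Rdiv_lt_0_compat; auto|].
  exists N. intros n Hn. specialize (HN n Hn).
  eapply Rle_lt_trans; [apply (Hb (p n) (K n) (P n) (/ INR (S n))); try apply HP|].
  - left; apply inv_S_pos.
  - fold E. apply Rlt_le_trans with (eta / E * E); [apply Rmult_lt_compat_r; auto|].
    right; field; lra.
Qed.

Lemma is_coeffs_minus (F G : C -> C) (b c : nat -> C) :
  unif_dpoly 1 F -> unif_dpoly 1 G -> is_coeffs F b -> is_coeffs G c ->
  is_coeffs (fun s => F s + (- (1)) * G s)%C (fun k => b k + (- (1)) * c k)%C.
Proof.
  intros HF HG Hb Hc.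
  destruct (unif_dpoly_seq 1 F HF) as [p [K [P HP]]].
  destruct (unif_dpoly_seq 1 G HG) as [q [L [Q HQ]]].
  pose proof (is_coeffs_Clim F b p K P Hb HP) as Hp.
  pose proof (is_coeffs_Clim G c q L Q Hc HQ) as Hq.
  apply (is_coeffs_of_approx _ _ (fun n k => p n k + (- (1)) * q n k)%C
           (fun n => Nat.max (K n) (L n)) (fun n s => P n s + (- (1)) * Q n s)%C
           (fun n => / INR (S n) + / INR (S n))).
  - intros n. apply dpoly_lin; [apply HP | apply HQ].
  - intros n s Hs. destruct (HP n) as [_ H1], (HQ n) as [_ H2].
    specialize (H1 s Hs); specialize (H2 s Hs).
    replace (F s + - (1) * G s - (P n s + - (1) * Q n s))%C
      with ((F s - P n s) + - (G s - Q n s))%C by ring.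
    eapply Rle_trans; [apply Cmod_triangle|]. rewrite Cmod_opp. lra.
  - intros n. pose proof (inv_S_pos n). lra.
  - rewrite <- (Rplus_0_r 0). apply is_lim_seq_plus'; apply is_lim_seq_inv_S.
  - intros k eta Heta. destruct (Hp k (eta / 2)) as [N HN]; [lra|].
    destruct (Hq k (eta / 2)) as [N' HN']; [lra|].
    exists (Nat.max N N'). intros n Hn.
    specialize (HN n ltac:(lia)); specialize (HN' n ltac:(lia)).
    replace (p n k + - (1) * q n k - (b k + - (1) * c k))%C
      with ((p n k - b k) + - (q n k - c k))%C by ring.
    eapply Rle_lt_trans; [apply Cmod_triangle|]. rewrite Cmod_opp. lra.
Qed.

(** Limit of [dpoly_dist] along polynomials tending to [F]; only finitely many terms are involved.
    The condition e <= 1 lets approximations on C_e serve on C_1, where [is_coeffs] is tested. *)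
Lemma coeffs_dist (e sigma eta : R) (F : C -> C) (b : nat -> C)
  (p : nat -> C) (K : nat) (P : C -> C) :
  e <= 1 -> e < sigma -> 0 <= eta -> unif_dpoly e F -> is_coeffs F b -> dpoly p K P ->
  (forall s, halfplane e s -> Cmod (F s - P s)%C <= eta) ->
  forall n, sum_n (fun k => Cmod (p k - b k)%C ^ 2 * wt sigma k) n <= eta ^ 2.
Proof.
  intros He1 He Heta HF Hb HP Hs n.
  destruct (unif_dpoly_seq e F HF) as [q [L [Q HQ]]].
  assert (Hq : forall k, Clim (fun n => q n k) (b k)).
  { apply (is_coeffs_Clim F b q L Q Hb). intros m. split; [apply HQ|].
    intros s H1. apply HQ. unfold halfplane in *; lra. }
  apply (is_lim_seq_le
    (fun m => sum_n (fun k => Cmod (p k - q m k)%C ^ 2 * wt sigma k) n)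
    (fun m => (eta + / INR (S m)) ^ 2)
    (sum_n (fun k => Cmod (p k - b k)%C ^ 2 * wt sigma k) n) (eta ^ 2)).
  - intros m. apply (dpoly_dist e sigma _ p (q m) K (L m) P (Q m)); auto; [apply HQ|].
    intros s Hh. destruct (HQ m) as [_ H1]. specialize (H1 s Hh). specialize (Hs s Hh).
    pose proof (Cmod_triangle_minus (P s) (F s) (Q m s)).
    rewrite (Cmod_minus_sym (P s) (F s)) in *. lra.
  - apply is_lim_seq_sum. intros k.
    apply (is_lim_seq_scal_r _ (wt sigma k) (Cmod (p k - b k)%C ^ 2)).
    apply Clim_Cmod_sqr; auto.
  - apply is_lim_seq_ext with (fun m => (eta + / INR (S m)) * (eta + / INR (S m))).
    { intros; ring. }
    replace (eta ^ 2) with ((eta + 0) * (eta + 0)) by ring.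
    apply is_lim_seq_mult'; apply is_lim_seq_plus';
      (apply is_lim_seq_const || apply is_lim_seq_inv_S).
Qed.

Lemma weighted_sum_perturb (t sigma A : R) (p b : nat -> C) (n : nat) :
  0 < t ->
  sum_n (fun k => Cmod (p k) ^ 2 * wt sigma k) n <= A ->
  sum_n (fun k => Cmod (b k - p k)%C ^ 2 * wt sigma k) n <= t ^ 2 ->
  sum_n (fun k => Cmod (b k) ^ 2 * wt sigma k) n <= (1 + t) * A + (t ^ 2 + t).
Proof.
  intros Ht HA Hd.
  apply Rle_trans with (sum_n (fun k => (1 + t) * (Cmod (p k) ^ 2 * wt sigma k)
     + (1 + / t) * (Cmod (b k - p k)%C ^ 2 * wt sigma k)) n).
  - apply sumR_le. intros k _.
    pose proof (Cmod_plus_sqr_le t (p k) (b k - p k)%C Ht) as H.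
    replace (p k + (b k - p k))%C with (b k) in H by ring.
    pose proof (wt_pos sigma k). nra.
  - rewrite sumR_plus, !sumR_scal.
    assert (Hi : 0 < / t) by (apply Rinv_0_lt_compat; auto).
    replace (t ^ 2 + t) with ((1 + / t) * t ^ 2) by (field; lra).
    apply Rplus_le_compat; apply Rmult_le_compat_l; auto; lra.
Qed.

Lemma avg_perturb (t sigma : R) (F P : C -> C) (N : nat) :
  0 < t -> (forall j, Cmod (F (vpt sigma j) - P (vpt sigma j))%C <= t) ->
  avg (fun j => Cmod (F (vpt sigma j)) ^ 2) N
  <= (1 + t) * avg (fun j => Cmod (P (vpt sigma j)) ^ 2) N + (t ^ 2 + t).
Proof.
  intros Ht H. rewrite <- avg_scal.
  rewrite <- (avg_const (t ^ 2 + t) N), <- avg_plus. apply avg_le. intros j.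
  specialize (H j).
  pose proof (Cmod_plus_sqr_le t (P (vpt sigma j)) (F (vpt sigma j) - P (vpt sigma j))%C Ht) as H1.
  replace (P (vpt sigma j) + (F (vpt sigma j) - P (vpt sigma j)))%C with (F (vpt sigma j)) in H1 by ring.
  assert (Hi : 0 < / t) by (apply Rinv_0_lt_compat; auto).
  assert (Hs : Cmod (F (vpt sigma j) - P (vpt sigma j))%C ^ 2 <= t ^ 2)
    by (apply pow_incr; split; [apply Cmod_ge_0 | auto]).
  replace (t ^ 2 + t) with ((1 + / t) * t ^ 2) by (field; lra).
  apply Rle_trans with (1 := H1). apply Rplus_le_compat_l. apply Rmult_le_compat_l; lra.
Qed.

(** In the two proofs that use it, a value A is perturbed twice by a factor 1 + t. For t <= 1, (1 +
    t)^2 <= 1 + 3t accounts for 3A t, and the additive errors total less than 12 t. *)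
Lemma small_parameter (C eta : R) : 0 <= C -> 0 < eta ->
  exists t, 0 < t <= 1 /\ (3 * C + 12) * t <= eta.
Proof.
  intros HC He. exists (Rmin 1 (eta / (3 * C + 12))).
  split; [split; [apply Rmin_glb_lt; [lra | apply Rdiv_lt_0_compat; lra] | apply Rmin_l]|].
  apply Rle_trans with ((3 * C + 12) * (eta / (3 * C + 12))).
  - apply Rmult_le_compat_l; [lra | apply Rmin_r].
  - right; field; lra.
Qed.

(** Passing to a polynomial within t and back to [b] costs O(t) each way, and for the polynomial the
    mean square is exact. This direction gives the upper bound for composition operators. *)
Lemma coeffs_bessel (e sigma A : R) (F : C -> C) (b : nat -> C) :
  e <= 1 -> e < sigma -> 0 <= A -> unif_dpoly e F -> is_coeffs F b ->
  (forall eta, 0 < eta -> exists N0, forall N, (N0 <= N)%nat ->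
     avg (fun j => Cmod (F (vpt sigma j)) ^ 2) N <= A + eta) ->
  forall n, sum_n (fun k => Cmod (b k) ^ 2 * wt sigma k) n <= A.
Proof.
  intros He1 He HC HF Hb HA n. apply le_epsilon. intros eta Heta.
  destruct (small_parameter A eta HC Heta) as [t [Ht Hte]].
  destruct (HF t ltac:(lra)) as [P [[p [K HP]] Hs]].
  destruct (HA t ltac:(lra)) as [N0 HN0].
  assert (Hp : sum_n (fun k => Cmod (p k) ^ 2 * wt sigma k) n
               <= (1 + t) * (A + t) + (t ^ 2 + t)).
  { apply (poly_square_le sigma _ p K P HP). exists N0. intros N HN.
    specialize (HN0 N HN). eapply Rle_trans.
    - apply (avg_perturb t sigma P F N ltac:(lra)). intros j. rewrite Cmod_minus_sym.
      apply Hs. exact He.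
    - apply Rplus_le_compat_r, Rmult_le_compat_l; lra. }
  pose proof (coeffs_dist e sigma t F b p K P He1 He ltac:(lra) HF Hb HP Hs n) as Hd.
  rewrite (sum_n_ext _ (fun k => Cmod (b k - p k)%C ^ 2 * wt sigma k)) in Hd
    by (intros; rewrite Cmod_minus_sym; reflexivity).
  pose proof (weighted_sum_perturb t sigma _ p b n ltac:(lra) Hp Hd) as H.
  apply Rle_trans with (1 := H). nra.
Qed.

(** The same perturbation in the opposite direction; it serves the lower bound, where the norm of
    the image must dominate the averages. *)
Lemma coeffs_parseval_le (e sigma A : R) (F : C -> C) (b : nat -> C) :
  e <= 1 -> e < sigma -> 0 <= A -> unif_dpoly e F -> is_coeffs F b ->
  (forall n, sum_n (fun k => Cmod (b k) ^ 2 * wt sigma k) n <= A) ->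
  forall eta, 0 < eta -> exists N0, forall N, (N0 <= N)%nat ->
     avg (fun j => Cmod (F (vpt sigma j)) ^ 2) N <= A + eta.
Proof.
  intros He1 He HC HF Hb HA eta Heta.
  destruct (small_parameter A eta HC Heta) as [t [Ht Hte]].
  destruct (HF t ltac:(lra)) as [P [[p [K HP]] Hs]].
  pose proof (coeffs_dist e sigma t F b p K P He1 He ltac:(lra) HF Hb HP Hs K) as Hd.
  pose proof (weighted_sum_perturb t sigma A b p K ltac:(lra) (HA K) Hd) as H.
  destruct (mean_eventually _ _ t (mean_square_poly sigma p K) ltac:(lra)) as [N0 HN0].
  exists N0. intros N HN. specialize (HN0 N HN). apply Rabs_lt_between in HN0.
  rewrite (avg_ext _ (fun j => Cmod (P (vpt sigma j)) ^ 2)) in HN0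
    by (intros; destruct HP as [_ HP]; rewrite HP; reflexivity).
  pose proof (avg_perturb t sigma F P N ltac:(lra) (fun j => Hs (vpt sigma j) He)) as HF'.
  apply Rle_trans with (1 := HF').
  apply Rle_trans with ((1 + t) * ((1 + t) * A + (t ^ 2 + t) + t) + (t ^ 2 + t)); [|nra].
  apply Rplus_le_compat_r, Rmult_le_compat_l; lra.
Qed.

(** An approximating polynomial is close to the partial sums of [b] by Cauchy-Schwarz: the
    coefficients are close in the norm weighted by n^{-2 sigma}, and n^{-2 (Re s - sigma)} is
    summable. The estimate holds for all n beyond the degree, so convergence comes out as well. *)
Lemma coeffs_series (F : C -> C) (b : nat -> C) (s : C) :
  (forall e, 0 < e -> unif_dpoly e F) -> is_coeffs F b -> halfplane (1 / 2) s ->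
  Clim (sum_n (dirichlet_term b s)) (F s).
Proof.
  intros HF Hb Hs. unfold halfplane in Hs.
  (* This choice gives 2 (Re s - sigma) >= Re s + 1/2 > 1. *)
  set (sigma := Rmin 1 ((Re s - 1 / 2) / 2)).
  assert (Hs1 : 0 < sigma) by (apply Rmin_glb_lt; lra).
  assert (Hs2 : sigma <= 1) by apply Rmin_l.
  assert (Hs3 : sigma <= (Re s - 1 / 2) / 2) by apply Rmin_r.
  set (e := sigma / 2).
  destruct (exp_sum_bounded (2 * (Re s - sigma)) ltac:(lra)) as [Z [HZ0 HZ]].
  intros eta Heta.
  set (t := eta / (2 * (sqrt Z + 1))).
  pose proof (sqrt_pos Z) as HsZ.
  assert (Ht : 0 < t) by (apply Rdiv_lt_0_compat; lra).
  destruct (HF e ltac:(unfold e; lra) t Ht) as [P [[p [K HP]] HPs]].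
  exists K. intros n Hn.
  pose proof (coeffs_dist e sigma t F b p K P ltac:(unfold e; lra) ltac:(unfold e; lra)
                ltac:(lra) (HF e ltac:(unfold e; lra)) Hb HP HPs n) as Hd.
  assert (HPn : P s = sum_n (dirichlet_term p s) n).
  { apply (dpoly_widen p K n P Hn) in HP. apply HP. }
  assert (H1 : Cmod (P s - sum_n (dirichlet_term b s) n)%C <= t * sqrt Z).
  { replace (P s - sum_n (dirichlet_term b s) n)%C
      with (sum_n (fun k => (p k - b k) * npow_neg k s)%C n).
    2:{ rewrite HPn, Cminus_lin, <- sumC_scal, <- sumC_plus. apply sum_n_ext. intros k.
        unfold dirichlet_term. cring. }
    eapply Rle_trans; [apply sumC_Cmod|].
    apply Rle_trans with (sum_n (fun k => (Cmod (p k - b k)%C * exp (- sigma * lnS k))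
                                  * exp (- (Re s - sigma) * lnS k)) n).
    { apply sumR_le. intros k _. rewrite Cmod_mult, Cmod_npow_neg, Rmult_assoc, <- exp_plus.
      right. f_equal. f_equal. ring. }
    eapply Rle_trans; [apply sum_prod_le_sqrt|].
    rewrite <- (sqrt_pow2 t) by lra. rewrite <- sqrt_mult; [|nra|auto].
    apply sqrt_le_1_alt. apply Rmult_le_compat.
    - apply sumR_nonneg; intros; apply pow2_ge_0.
    - apply sumR_nonneg; intros; apply pow2_ge_0.
    - eapply Rle_trans; [|exact Hd]. right. apply sum_n_ext. intros k.
      rewrite Rpow_mult_distr, exp_sqr. unfold wt. f_equal. f_equal. ring.
    - eapply Rle_trans; [|exact (HZ n)]. right. apply sum_n_ext. intros k.
      rewrite exp_sqr. f_equal. ring. }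
  specialize (HPs s ltac:(unfold halfplane, e; lra)).
  pose proof (Cmod_triangle_minus (F s) (P s) (sum_n (dirichlet_term b s) n)) as H2.
  rewrite Cmod_minus_sym. apply Rle_lt_trans with (1 := H2).
  assert (t * (sqrt Z + 1) < eta).
  { unfold t. replace (eta / (2 * (sqrt Z + 1)) * (sqrt Z + 1)) with (eta / 2) by (field; lra).
    lra. }
  lra.
Qed.

(** A uniqueness statement: on C_1 truncations of a square-summable series converge uniformly, so
    they qualify as approximations. It identifies a sequence known to represent [F] only on C_{1/2}
    with the coefficients read off from means further left. *)
Lemma is_coeffs_of_series (F : C -> C) (b : nat -> C) (B : R) :
  (forall n, sum_n (fun k => Cmod (b k) ^ 2) n <= B) ->
  (forall s, halfplane (1 / 2) s -> Clim (sum_n (dirichlet_term b s)) (F s)) ->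
  is_coeffs F b.
Proof.
  intros HB HF.
  assert (HB0 : 0 <= B).
  { apply Rle_trans with (2 := HB 0%nat). rewrite sumR_0. apply pow2_ge_0. }
  apply (is_coeffs_of_approx F b (fun n k => if Nat.leb k n then b k else RtoC 0)
           (fun n => n) (fun n s => sum_n (dirichlet_term b s) n)
           (fun n => sqrt (B * (exp (- 1 * lnS n) / 1)))).
  - intros n. split.
    + intros k Hk. destruct (Nat.leb_spec k n); [lia | auto].
    + intros s. apply sum_n_ext_loc. intros k Hk. unfold dirichlet_term.
      destruct (Nat.leb_spec k n); [auto | lia].
  - intros n s Hs. eapply Rle_trans.
    + apply (dirichlet_tail b B 1 s (F s) HB ltac:(lra)).
      * unfold halfplane in Hs; lra.
      * apply HF. unfold halfplane in *; lra.
    + right. f_equal. f_equal. replace (2 * 1 - 1) with 1 by ring. reflexivity.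
  - intros; apply sqrt_pos.
  - apply is_lim_seq_spec. intros eta.
    destruct (dirichlet_tail_small B 1 eta HB0 ltac:(lra) (cond_pos eta)) as [N HN].
    exists N. intros n Hn. rewrite Rminus_0_r, Rabs_pos_eq by apply sqrt_pos. apply HN; auto.
  - intros k eta Heta. exists k. intros n Hn.
    destruct (Nat.leb_spec k n); [|lia].
    replace (b k - b k)%C with (RtoC 0) by ring. rewrite Cmod_0; auto.
Qed.

(** Finite sums of squares pass to the limit, which gives the norm bound. The tails at [s] are
    controlled by [B] alone, uniformly in j, so the values pass to the limit too. *)
Lemma dirichlet_weak_limit (b : nat -> nat -> C) (beta : nat -> C) (B : R) :
  (forall j n, sum_n (fun k => Cmod (b j k) ^ 2) n <= B) ->
  (forall k, Clim (fun j => b j k) (beta k)) ->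
  (forall n, sum_n (fun k => Cmod (beta k) ^ 2) n <= B) /\
  forall (s : C) (z : nat -> C) (y : C), halfplane (1 / 2) s ->
    (forall j, Clim (sum_n (dirichlet_term (b j) s)) (z j)) -> Clim z y ->
    Clim (sum_n (dirichlet_term beta s)) y.
Proof.
  intros HB Hb.
  assert (HB0 : 0 <= B).
  { apply Rle_trans with (2 := HB 0%nat 0%nat). rewrite sumR_0. apply pow2_ge_0. }
  split.
  - intros n. apply (is_lim_seq_le (fun j => sum_n (fun k => Cmod (RtoC 0 - b j k)%C ^ 2) n)
      (fun _ => B) (sum_n (fun k => Cmod (beta k) ^ 2) n) B).
    + intros j. eapply Rle_trans; [|exact (HB j n)]. right. apply sum_n_ext. intros k.
      f_equal. rewrite <- Cmod_opp. f_equal. ring.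
    + apply is_lim_seq_sum. intros k.
      replace (Cmod (beta k)) with (Cmod (RtoC 0 - beta k)%C).
      * apply Clim_Cmod_sqr; auto.
      * rewrite <- Cmod_opp. f_equal. ring.
    + apply is_lim_seq_const.
  - intros s z y Hs Hz Hy eta Heta. unfold halfplane in Hs.
    destruct (dirichlet_tail_small B (2 * Re s - 1) eta HB0 ltac:(lra) Heta) as [K HK].
    exists K. intros n Hn. apply Rle_lt_trans with (2 := HK n Hn).
    assert (Hlim : Clim (fun j => z j - sum_n (dirichlet_term (b j) s) n)%C
                        (y - sum_n (dirichlet_term beta s) n)%C).
    { clear HK Hn.
      assert (Hsum : Clim (fun j => sum_n (dirichlet_term (b j) s) n)
                          (sum_n (dirichlet_term beta s) n)).
      { assert (Hterm : forall k, Clim (fun j => dirichlet_term (b j) s k)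
                                       (dirichlet_term beta s k)).
        { intros k t Ht. set (E := Cmod (npow_neg k s)).
          assert (HE : 0 < E) by (unfold E; rewrite Cmod_npow_neg; apply exp_pos).
          destruct (Hb k (t / E)) as [N HN]; [apply Rdiv_lt_0_compat; auto|].
          exists N. intros j Hj. specialize (HN j Hj). unfold dirichlet_term.
          replace (b j k * npow_neg k s - beta k * npow_neg k s)%C
            with ((b j k - beta k) * npow_neg k s)%C by ring.
          rewrite Cmod_mult. fold E.
          apply Rlt_le_trans with (t / E * E); [apply Rmult_lt_compat_r; auto|].
          right; field; lra. }
        induction n as [|n IH]; intros t Ht.
        - destruct (Hterm 0%nat t Ht) as [N HN]. exists N. intros j Hj.
          rewrite !sumC_0. apply HN; auto.
        - destruct (IH (t / 2)) as [N HN]; [lra|].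
          destruct (Hterm (S n) (t / 2)) as [N' HN']; [lra|].
          exists (Nat.max N N'). intros j Hj.
          specialize (HN j ltac:(lia)); specialize (HN' j ltac:(lia)).
          rewrite !sumC_S.
          rewrite Cminus_plus_plus.
          eapply Rle_lt_trans; [apply Cmod_triangle | lra]. }
      intros t Ht. destruct (Hsum (t / 2)) as [N HN]; [lra|].
      destruct (Hy (t / 2)) as [N' HN']; [lra|].
      exists (Nat.max N N'). intros j Hj.
      specialize (HN j ltac:(lia)); specialize (HN' j ltac:(lia)).
      rewrite Cminus_minus_minus.
      eapply Rle_lt_trans; [apply Cmod_triangle|]. rewrite Cmod_opp. lra. }
    rewrite Cmod_minus_sym.
    replace (y - sum_n (dirichlet_term beta s) n)%C
      with (y - sum_n (dirichlet_term beta s) n - 0)%C by ring.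
    apply Clim_dist_le with (1 := Hlim). exists 0%nat. intros j _.
    rewrite Cminus_0_r.
    apply (dirichlet_tail (b j) B (Re s) s (z j)); auto; lra.
Qed.

(** * The bilinear form B_alpha *)

Lemma B_kernel_max (alpha : R) (m n : nat) :
  B_kernel alpha m n
  = exp ((alpha - 1 / 2) * (lnS m + lnS n) - 2 * alpha * lnS (Nat.max m n)).
Proof.
  unfold B_kernel, Rpower, Rdiv. rewrite ln_mult by apply INR_S_pos.
  change (Nat.max (S m) (S n)) with (S (Nat.max m n)).
  rewrite <- exp_Ropp, <- exp_plus. reflexivity.
Qed.

(** For indices standing for m <= n the kernel is (mn)^{-1/2} (m/n)^alpha, the shape in which the
    product of the factors e^{-gap psi} from m to n appears. *)
Lemma B_kernel_le (alpha : R) (m n : nat) : (m <= n)%nat ->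
  B_kernel alpha m n = exp (- (lnS m + lnS n) / 2 - alpha * (lnS n - lnS m)).
Proof. intros H. rewrite B_kernel_max, Nat.max_r by auto. f_equal. field. Qed.

Lemma B_kernel_sym (alpha : R) (m n : nat) : B_kernel alpha m n = B_kernel alpha n m.
Proof. rewrite !B_kernel_max, Nat.max_comm. f_equal. ring. Qed.

Lemma B_kernel_pos (alpha : R) (m n : nat) : 0 < B_kernel alpha m n.
Proof. rewrite B_kernel_max. apply exp_pos. Qed.

Definition Bsum (alpha : R) (x y : nat -> R) (M L : nat) : R :=
  sum_n (fun m => sum_n (fun n => x m * y n * B_kernel alpha m n) L) M.

(** Finite real sequences of arbitrary sign, on the diagonal only: this is what the nested sums
    produce. Its least constant is shown below to be the norm of B_alpha. *)
Definition quad_bound (alpha K : R) : Prop :=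
  forall (x : nat -> R) (M : nat), Bsum alpha x x M M <= K * sum_n (fun m => x m ^ 2) M.

(** With y = 1/(n+2), the increment of the power is at least (n+2)^alpha * alpha y / (1 + alpha y);
    y <= 1 then gives the factor 1 + alpha. *)
Lemma exp_head_step (alpha : R) (n : nat) : 0 < alpha ->
  exp ((alpha - 1) * lnS (S n))
  <= (1 + alpha) / alpha * (exp (alpha * lnS (S n)) - exp (alpha * lnS n)).
Proof.
  intros Ha. pose proof (lnS_gap n) as Hg.
  set (y := / INR (S (S n))) in *.
  assert (Hy : 0 < y) by apply inv_S_pos.
  assert (Hy1 : y <= 1).
  { unfold y. rewrite <- Rinv_1. apply Rinv_le_contravar; [lra|].
    rewrite S_INR. pose proof (INR_S_pos n). lra. }
  set (E := exp (alpha * lnS (S n))).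
  assert (HE : 0 < E) by apply exp_pos.
  replace (exp ((alpha - 1) * lnS (S n))) with (E * y).
  2:{ unfold E, y. rewrite <- (exp_lnS (S n)), <- exp_Ropp, <- exp_plus. f_equal; ring. }
  assert (H : exp (alpha * lnS n) * (1 + alpha * y) <= E).
  { apply Rle_trans with (exp (alpha * lnS n) * exp (alpha * y)).
    - apply Rmult_le_compat_l; [left; apply exp_pos | apply exp_ineq1_le].
    - unfold E. rewrite <- exp_plus. apply exp_le. nra. }
  pose proof (exp_pos (alpha * lnS n)) as Hp.
  assert (Hay : 0 < alpha * y) by (apply Rmult_lt_0_compat; auto).
  assert (Hpay : 0 < exp (alpha * lnS n) * (alpha * y)) by (apply Rmult_lt_0_compat; auto).
  set (D := E - exp (alpha * lnS n)) in *.
  assert (HD0 : 0 <= D) by (unfold D; lra).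
  assert (HD : E * (alpha * y) <= D * (1 + alpha * y)) by (unfold D; lra).
  assert (HD2 : D * (1 + alpha * y) <= D * (1 + alpha)) by (apply Rmult_le_compat_l; nra).
  apply Rmult_le_reg_l with alpha; auto.
  replace (alpha * ((1 + alpha) / alpha * D)) with (D * (1 + alpha)) by (field; lra).
  replace (alpha * (E * y)) with (E * (alpha * y)) by ring. lra.
Qed.

Lemma exp_head_sum (alpha : R) (m : nat) : 0 < alpha ->
  sum_n (fun n => exp ((alpha - 1) * lnS n)) m <= (1 + alpha) / alpha * exp (alpha * lnS m).
Proof.
  intros Ha. induction m as [|m IH].
  - rewrite sumR_0, lnS_0, !Rmult_0_r, exp_0. apply Rmult_le_reg_l with alpha; auto.
    replace (alpha * ((1 + alpha) / alpha * 1)) with (1 + alpha) by (field; lra). lra.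
  - rewrite sumR_S. pose proof (exp_head_step alpha m Ha). lra.
Qed.

(** Schur's test with the test sequence n^{-1/2}: the entries become m^{-alpha} n^{alpha-1} for n <=
    m and m^alpha n^{-alpha-1} for n > m, so each row splits into a head and a tail of bounded
    size. *)
Definition schur_weight (alpha : R) (m n : nat) : R :=
  B_kernel alpha m n * exp ((lnS m - lnS n) / 2).

Lemma schur_row (alpha : R) (m M : nat) : 0 < alpha ->
  sum_n (schur_weight alpha m) M <= (1 + alpha) / alpha + 1 / alpha.
Proof.
  intros Ha.
  apply Rle_trans with (sum_n (schur_weight alpha m) (S m + M)).
  { apply sumR_mono; [|lia]. intros n. left. apply Rmult_lt_0_compat; [apply B_kernel_pos|].
    apply exp_pos. }
  rewrite sumR_split. apply Rplus_le_compat.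
  - apply Rle_trans with (exp (- alpha * lnS m) * sum_n (fun n => exp ((alpha - 1) * lnS n)) m).
    + rewrite <- sumR_scal. right. apply sum_n_ext_loc. intros n Hn. unfold schur_weight.
      rewrite B_kernel_sym, B_kernel_le by auto. rewrite <- !exp_plus. f_equal. field.
    + pose proof (exp_head_sum alpha m Ha) as H. pose proof (exp_pos (- alpha * lnS m)).
      apply Rle_trans with (exp (- alpha * lnS m) * ((1 + alpha) / alpha * exp (alpha * lnS m))).
      * apply Rmult_le_compat_l; lra.
      * replace (- alpha * lnS m) with (- (alpha * lnS m)) by ring. rewrite exp_Ropp.
        right. field. split; apply Rgt_not_eq; [auto | apply exp_pos].
  - apply Rle_trans with
      (exp (alpha * lnS m) * sum_n (fun i => exp (- (alpha + 1) * lnS (S m + i))) M).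
    + rewrite <- sumR_scal. right. apply sum_n_ext. intros i. unfold schur_weight.
      rewrite B_kernel_le by lia. rewrite <- !exp_plus. f_equal. field.
    + pose proof (exp_tail_sum alpha m M Ha) as H. pose proof (exp_pos (alpha * lnS m)).
      apply Rle_trans with (exp (alpha * lnS m) * (exp (- alpha * lnS m) / alpha)).
      * apply Rmult_le_compat_l; lra.
      * replace (- alpha * lnS m) with (- (alpha * lnS m)) by ring. rewrite exp_Ropp.
        right. field. split; apply Rgt_not_eq; [auto | apply exp_pos].
Qed.

(** Termwise 2 x_m x_n <= e x_m^2 + x_n^2 / e with e = (m/n)^{1/2}, then symmetry. The constant is
    not sharp; it only shows that some bound exists. *)
Lemma schur_test (alpha : R) : 0 < alpha ->
  quad_bound alpha ((1 + alpha) / alpha + 1 / alpha).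
Proof.
  intros Ha x M. set (K := (1 + alpha) / alpha + 1 / alpha).
  unfold Bsum.
  apply Rle_trans with (sum_n (fun m => sum_n (fun n =>
      / 2 * (x m ^ 2 * schur_weight alpha m n) + / 2 * (x n ^ 2 * schur_weight alpha n m)) M) M).
  - apply sumR_le. intros m _. apply sumR_le. intros n _. unfold schur_weight.
    rewrite (B_kernel_sym alpha n m). pose proof (B_kernel_pos alpha m n) as HB.
    set (e := exp ((lnS m - lnS n) / 2)).
    assert (He : 0 < e) by apply exp_pos.
    replace (exp ((lnS n - lnS m) / 2)) with (/ e).
    2:{ unfold e. rewrite <- exp_Ropp. f_equal. field. }
    assert (H : 0 <= / e * (e * x m - x n) ^ 2).
    { apply Rmult_le_pos; [left; apply Rinv_0_lt_compat; auto | apply pow2_ge_0]. }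
    replace (/ e * (e * x m - x n) ^ 2)
      with (x m ^ 2 * e - 2 * x m * x n + x n ^ 2 * / e) in H by (field; lra).
    set (f := / e) in *. nra.
  - rewrite (sum_n_ext _ (fun m =>
        sum_n (fun n => / 2 * (x m ^ 2 * schur_weight alpha m n)) M +
        sum_n (fun n => / 2 * (x n ^ 2 * schur_weight alpha n m)) M))
      by (intros; apply sumR_plus).
    rewrite sumR_plus, (sumR_switch (fun m n => / 2 * (x n ^ 2 * schur_weight alpha n m))).
    assert (H : sum_n (fun m => sum_n (fun n => / 2 * (x m ^ 2 * schur_weight alpha m n)) M) M
                <= / 2 * (K * sum_n (fun m => x m ^ 2) M)).
    { rewrite <- !sumR_scal. apply sumR_le. intros m _.
      rewrite !sumR_scal. pose proof (schur_row alpha m M Ha) as Hr. fold K in Hr.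
      rewrite (Rmult_comm K). apply Rmult_le_compat_l; [lra|].
      apply Rmult_le_compat_l; [apply pow2_ge_0 | exact Hr]. }
    lra.
Qed.

Lemma discriminant_le (a b c : R) : 0 <= a -> 0 <= c ->
  (forall r, 0 <= a * r ^ 2 - 2 * b * r + c) -> b ^ 2 <= a * c.
Proof.
  intros Ha Hc H. destruct (Req_dec a 0) as [->|Ha'].
  - destruct (Req_dec b 0) as [->|Hb]; [right; ring|].
    specialize (H ((c + 1) / (2 * b))).
    replace (0 * ((c + 1) / (2 * b)) ^ 2 - 2 * b * ((c + 1) / (2 * b)) + c) with (-1) in H
      by (field; auto). lra.
  - specialize (H (b / a)).
    replace (a * (b / a) ^ 2 - 2 * b * (b / a) + c) with ((a * c - b ^ 2) / a) in H
      by (field; auto).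
    assert (0 < a) by lra. apply Rmult_le_compat_r with (r := a) in H; auto.
    replace ((a * c - b ^ 2) / a * a) with (a * c - b ^ 2) in H by (field; auto). lra.
Qed.

(** [quad_bound] bounds the form from above only; positivity of the kernel turns this into a bound
    from below, which polarization requires. *)
Lemma Bsum_abs_lower (alpha : R) (x : nat -> R) (M : nat) :
  - Bsum alpha (fun k => Rabs (x k)) (fun k => Rabs (x k)) M M <= Bsum alpha x x M M.
Proof.
  unfold Bsum. rewrite <- (Rmult_1_l (sum_n _ _)), Ropp_mult_distr_l, <- sumR_scal.
  apply sumR_le. intros m _. rewrite <- sumR_scal. apply sumR_le. intros n _.
  pose proof (B_kernel_pos alpha m n).
  assert (- (Rabs (x m) * Rabs (x n)) <= x m * x n).
  { rewrite <- Rabs_mult. pose proof (Rle_abs (- (x m * x n))). rewrite Rabs_Ropp in *. lra. }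
  nra.
Qed.

(* Polarization: the kernel is positive and symmetric, so a bound for the
   quadratic form on x + r y and |x - r y| bounds the bilinear form. *)
Lemma Bsum_bilinear (alpha K : R) (x y : nat -> R) (M : nat) : 0 <= K -> quad_bound alpha K ->
  (forall k, 0 <= x k) -> (forall k, 0 <= y k) ->
  Bsum alpha x y M M ^ 2 <= (K * sum_n (fun m => x m ^ 2) M) * (K * sum_n (fun m => y m ^ 2) M).
Proof.
  intros HK HQ Hx Hy.
  assert (HX : 0 <= sum_n (fun m => x m ^ 2) M) by (apply sumR_nonneg; intros; apply pow2_ge_0).
  assert (HY : 0 <= sum_n (fun m => y m ^ 2) M) by (apply sumR_nonneg; intros; apply pow2_ge_0).
  apply discriminant_le; [apply Rmult_le_pos; auto | apply Rmult_le_pos; auto |].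
  intros r.
  set (u := fun k => r * x k + y k). set (v := fun k => r * x k + - (1) * y k).
  pose proof (HQ u M) as Hu. pose proof (HQ (fun k => Rabs (v k)) M) as Hv.
  pose proof (Bsum_abs_lower alpha v M) as Hv'.
  assert (HQv : sum_n (fun m => Rabs (v m) ^ 2) M = sum_n (fun m => v m ^ 2) M).
  { apply sum_n_ext. intros; apply pow2_abs. }
  (* The two squares cancel and symmetry merges the mixed terms; the sum of squares in [Hsq] is the
     parallelogram law. *)
  assert (Hpol : Bsum alpha u u M M + -1 * Bsum alpha v v M M = 4 * r * Bsum alpha x y M M).
  { assert (Hsym : Bsum alpha x y M M = Bsum alpha y x M M).
    { unfold Bsum. rewrite sumR_switch. apply sum_n_ext. intros m. apply sum_n_ext. intros n.
      rewrite B_kernel_sym. rring. }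
    replace (4 * r * Bsum alpha x y M M)
      with (2 * r * Bsum alpha x y M M + 2 * r * Bsum alpha y x M M) by (rewrite Hsym; ring).
    unfold Bsum. rewrite <- !sumR_scal, <- !sumR_plus. apply sum_n_ext. intros m.
    rewrite <- !sumR_scal, <- !sumR_plus. apply sum_n_ext. intros n. unfold u, v. rring. }
  assert (Hsq : sum_n (fun m => u m ^ 2) M + sum_n (fun m => v m ^ 2) M
          = 2 * r ^ 2 * sum_n (fun m => x m ^ 2) M + 2 * sum_n (fun m => y m ^ 2) M).
  { rewrite <- !sumR_scal, <- !sumR_plus. apply sum_n_ext. intros m. unfold u, v. rring. }
  cbv beta in Hv. rewrite HQv in Hv.
  assert (H4 : 4 * r * Bsum alpha x y M M
     <= K * (2 * r ^ 2 * sum_n (fun m => x m ^ 2) M + 2 * sum_n (fun m => y m ^ 2) M)).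
  { rewrite <- Hsq, <- Hpol. lra. }
  lra.
Qed.

(** * From the quadratic form to the norm of B_alpha *)

Lemma Clim_finite (u : nat -> C) (M : nat) :
  (forall k, (M < k)%nat -> u k = RtoC 0) -> Clim (sum_n u) (sum_n u M).
Proof.
  intros H eta Heta. exists M. intros n Hn. rewrite (sumC_stable u M n) by auto.
  rewrite Cminus_lin. replace (sum_n u M + - (1) * sum_n u M)%C with (RtoC 0) by ring.
  rewrite Cmod_0; auto.
Qed.

Lemma Clim_abs_summable (u : nat -> C) (B : R) :
  (forall n, sum_n (fun k => Cmod (u k)) n <= B) -> exists l, Clim (sum_n u) l.
Proof.
  intros H. apply Clim_Cauchy. intros eta Heta.
  destruct (pos_bounded_ex_series (fun k => Cmod (u k)) B) as [l Hl]; auto using Cmod_ge_0.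
  apply is_series_R_lim, is_lim_seq_spec in Hl.
  assert (He : 0 < eta / 2) by lra. destruct (Hl (mkposreal _ He)) as [N HN].
  assert (Hle : forall m n, (N <= m)%nat -> (m <= n)%nat ->
                  Cmod (sum_n u n - sum_n u m)%C < eta).
  { intros m n Hm Hmn. destruct (Nat.eq_dec m n) as [->|Hne].
    - replace (sum_n u n - sum_n u n)%C with (RtoC 0) by ring. rewrite Cmod_0; auto.
    - pose proof (HN m ltac:(lia)) as H1. pose proof (HN n ltac:(lia)) as H2. simpl in H1, H2.
      apply Rabs_lt_between in H1. apply Rabs_lt_between in H2.
      replace n with (S m + (n - S m))%nat in * by lia. set (d := (n - S m)%nat) in *.
      rewrite sumC_split, Cplus_minus_l. eapply Rle_lt_trans; [apply sumC_Cmod|].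
      change (S (m + d)) with (S m + d)%nat in H2.
      rewrite (sumR_split (fun k => Cmod (u k))) in H2. lra. }
  exists N. intros m n Hm Hn. destruct (Nat.le_ge_cases m n).
  - rewrite Cmod_minus_sym. auto.
  - auto.
Qed.

Lemma Clim_Cmod (u : nat -> C) (l : C) : Clim u l -> is_lim_seq (fun n => Cmod (u n)) (Cmod l).
Proof.
  intros H. apply is_lim_seq_spec. intros eta. destruct (H eta (cond_pos eta)) as [N HN].
  exists N. intros n Hn. specialize (HN n Hn).
  pose proof (Cmod_le_of_close (u n) l). pose proof (Cmod_le_of_close' (u n) l).
  apply Rabs_lt_between. lra.
Qed.

(** All estimates are made on moduli, where terms are nonnegative: uniformly bounded rectangles give
    absolute convergence of each row, and then of the sum of the row values. *)
Lemma B_bound_of_quad (alpha K : R) : 0 < K -> quad_bound alpha K -> B_bound alpha K.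
Proof.
  intros HK HQ. split; auto. intros a b Ha Hb.
  set (T := K * ell2_norm a * ell2_norm b).
  pose proof (ell2_norm_ge_0 a) as Ha0. pose proof (ell2_norm_ge_0 b) as Hb0.
  set (x := fun k => Cmod (a k)). set (y := fun k => Cmod (b k)).
  assert (HT0 : 0 <= T) by (unfold T; apply Rmult_le_pos; [nra | auto]).
  assert (Hnn : forall m n, 0 <= x m * y n * B_kernel alpha m n).
  { intros m n. apply Rmult_le_pos; [apply Rmult_le_pos; apply Cmod_ge_0|].
    left; apply B_kernel_pos. }
  assert (Hsq : forall M, Bsum alpha x y M M <= T).
  { intros M. apply Rsqr_incr_0_var; auto.
    pose proof (Bsum_bilinear alpha K x y M ltac:(lra) HQ
       (fun k => Cmod_ge_0 _) (fun k => Cmod_ge_0 _)) as H.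
    pose proof (ell2_partial a M Ha) as H1. pose proof (ell2_partial b M Hb) as H2.
    fold x in H1. fold y in H2.
    replace (Rsqr (Bsum alpha x y M M)) with (Bsum alpha x y M M ^ 2) by (unfold Rsqr; ring).
    apply Rle_trans with (1 := H).
    replace (Rsqr T) with ((K * ell2_norm a ^ 2) * (K * ell2_norm b ^ 2))
      by (unfold Rsqr, T; ring).
    apply Rmult_le_compat.
    - apply Rmult_le_pos; [lra|]. apply sumR_nonneg; intros; apply pow2_ge_0.
    - apply Rmult_le_pos; [lra|]. apply sumR_nonneg; intros; apply pow2_ge_0.
    - apply Rmult_le_compat_l; [lra | exact H1].
    - apply Rmult_le_compat_l; [lra | exact H2]. }
  (* A rectangle is enlarged to a square, the case covered by polarization. *)
  assert (HML : forall M L, Bsum alpha x y M L <= T).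
  { intros M L. apply Rle_trans with (2 := Hsq (Nat.max M L)). unfold Bsum.
    apply Rle_trans with
      (sum_n (fun m => sum_n (fun n => x m * y n * B_kernel alpha m n) (Nat.max M L)) M).
    - apply sumR_le. intros m _. apply sumR_mono; [auto | lia].
    - apply (sumR_mono (fun m => sum_n (fun n => x m * y n * B_kernel alpha m n) (Nat.max M L)));
        [|lia]. intros m. apply sumR_nonneg; auto. }
  set (t := fun m n => (a m * b n * RtoC (B_kernel alpha m n))%C).
  assert (Ht : forall m n, Cmod (t m n) = x m * y n * B_kernel alpha m n).
  { intros m n. unfold t. rewrite !Cmod_mult, Cmod_R, Rabs_pos_eq; auto.
    left; apply B_kernel_pos. }
  assert (Hrow : forall m, exists l, Clim (sum_n (t m)) l).
  { intros m. apply Clim_abs_summable with (B := T). intros L.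
    apply Rle_trans with (2 := HML m L). unfold Bsum.
    rewrite (sum_n_ext _ (fun n => x m * y n * B_kernel alpha m n)) by (intros; apply Ht).
    apply (sumR_term_le (fun m => sum_n (fun n => x m * y n * B_kernel alpha m n) L)); auto.
    intros k. apply sumR_nonneg; auto. }
  destruct (choose_seq C _ Hrow) as [u Hu].
  assert (HuT : forall M, sum_n (fun m => Cmod (u m)) M <= T).
  { intros M.
    apply (is_lim_seq_le (fun L => sum_n (fun m => Cmod (sum_n (t m) L)) M) (fun _ => T)
             (sum_n (fun m => Cmod (u m)) M) T).
    - intros L. apply Rle_trans with (2 := HML M L). apply sumR_le. intros m _.
      eapply Rle_trans; [apply sumC_Cmod|]. right. apply sum_n_ext. intros; apply Ht.
    - apply is_lim_seq_sum. intros m. apply Clim_Cmod. apply Hu.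
    - apply is_lim_seq_const. }
  destruct (Clim_abs_summable u T HuT) as [v Hv].
  exists v. split.
  - exists u. split; [intros m; apply is_series_C_Clim; apply Hu | apply is_series_C_Clim; auto].
  - fold T. rewrite <- (Cminus_0_r v). apply Clim_dist_le with (1 := Hv).
    exists 0%nat. intros n _. rewrite Cminus_0_r.
    apply Rle_trans with (2 := HuT n). apply sumC_Cmod.
Qed.

Lemma quad_of_B_bound (alpha K : R) : B_bound alpha K -> quad_bound alpha K.
Proof.
  intros [HK HB] x M.
  set (a := fun k => if Nat.leb k M then RtoC (x k) else RtoC 0).
  assert (Ha0 : forall k, (M < k)%nat -> a k = RtoC 0).
  { intros k Hk. unfold a. destruct (Nat.leb_spec k M); [lia | auto]. }
  assert (Ha1 : forall k, (k <= M)%nat -> a k = RtoC (x k)).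
  { intros k Hk. unfold a. destruct (Nat.leb_spec k M); [auto | lia]. }
  destruct (ell2_finite a M Ha0) as [Hl Hn].
  destruct (HB a a Hl Hl) as [v [[u [Hu Hv]] Hle]].
  assert (Hum : forall m, u m = sum_n (fun n => (a m * a n * RtoC (B_kernel alpha m n))%C) M).
  { intros m. specialize (Hu m). apply is_series_C_Clim in Hu.
    apply (Clim_unique _ _ _ Hu). apply Clim_finite. intros k Hk. rewrite (Ha0 k) by auto. ring. }
  assert (Hu0 : forall m, (M < m)%nat -> u m = RtoC 0).
  { intros m Hm. rewrite Hum, (sum_n_ext _ (fun _ => RtoC 0)), sumC_zero; auto.
    intros n. rewrite (Ha0 m) by auto. cring. }
  assert (Hval : v = RtoC (Bsum alpha x x M M)).
  { apply is_series_C_Clim in Hv. rewrite (Clim_unique _ _ _ Hv (Clim_finite u M Hu0)).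
    unfold Bsum. rewrite <- sumC_RtoC. apply sum_n_ext_loc. intros m Hm.
    rewrite Hum, <- sumC_RtoC. apply sum_n_ext_loc. intros n Hn'.
    rewrite !Ha1 by auto. rewrite <- !RtoC_mult. reflexivity. }
  rewrite Hval, Cmod_R in Hle. apply Rle_trans with (1 := Rle_abs _).
  apply Rle_trans with (1 := Hle).
  replace (K * ell2_norm a * ell2_norm a) with (K * ell2_norm a ^ 2) by ring.
  rewrite Hn. right. f_equal. apply sum_n_ext_loc. intros k Hk.
  rewrite Ha1, Cmod_R, pow2_abs by auto. reflexivity.
Qed.

(** Tested on a single first entry, where the kernel is 1. It supplies the positivity that [B_bound]
    demands. *)
Lemma quad_bound_ge_1 (alpha K : R) : quad_bound alpha K -> 1 <= K.
Proof.
  intros H. specialize (H (fun _ => 1) 0%nat). unfold Bsum in H.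
  rewrite !sumR_0, B_kernel_le in H by auto.
  rewrite lnS_0 in H. replace (- (0 + 0) / 2 - alpha * (0 - 0)) with 0 in H by field.
  rewrite exp_0 in H. lra.
Qed.

(** The infimum is attained because each instance of the inequality is closed in K: division by the
    sum of squares S turns it into a lower bound for K, and for S = 0 the constant does not
    matter. *)
Lemma quad_bound_least (alpha : R) : 0 < alpha ->
  exists N, quad_bound alpha N /\ forall K, quad_bound alpha K -> N <= K.
Proof.
  intros Ha. pose proof (schur_test alpha Ha) as HS.
  set (K0 := (1 + alpha) / alpha + 1 / alpha) in *.
  (* [completeness] gives suprema, so the infimum is taken as minus the supremum of the
     opposites. *)
  destruct (completeness (fun r => exists K, quad_bound alpha K /\ r = - K)) as [L [HL1 HL2]].
  - exists (-1). intros r [K [HK ->]]. pose proof (quad_bound_ge_1 alpha K HK). lra.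
  - exists (- K0), K0. auto.
  - exists (- L). split.
    + intros x M. set (S := sum_n (fun m => x m ^ 2) M).
      assert (HS0 : 0 <= S) by (apply sumR_nonneg; intros; apply pow2_ge_0).
      destruct (Req_dec S 0) as [Hz|Hz].
      * pose proof (HS x M) as H. fold S in H. rewrite Hz, Rmult_0_r in H.
        rewrite Hz, Rmult_0_r. exact H.
      * assert (HSp : 0 < S) by lra.
        assert (H : L <= - (Bsum alpha x x M M / S)).
        { apply HL2. intros r [K [HK ->]]. apply Ropp_le_contravar.
          apply Rmult_le_reg_r with S; auto.
          replace (Bsum alpha x x M M / S * S) with (Bsum alpha x x M M) by (field; auto).
          apply HK. }
        replace (Bsum alpha x x M M) with (Bsum alpha x x M M / S * S) by (field; auto).
        apply Rmult_le_compat_r; lra.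
    + intros K HK. assert (- K <= L) by (apply HL1; exists K; auto). lra.
Qed.

Lemma is_B_norm_least (alpha N : R) :
  quad_bound alpha N -> (forall K, quad_bound alpha K -> N <= K) -> is_B_norm alpha N.
Proof.
  intros HN Hmin. pose proof (quad_bound_ge_1 alpha N HN). split.
  - apply B_bound_of_quad; auto. lra.
  - intros K HK. apply Hmin, quad_of_B_bound, HK.
Qed.

(** * Subordination: the upper bound *)

Definition gap (k : nat) : R := lnS (S k) - lnS k.

Lemma gap_pos (k : nat) : 0 < gap k.
Proof. unfold gap. pose proof (lnS_lt k (S k) ltac:(lia)). lra. Qed.

(* [horner c y j k] is sum_{k <= n <= k+j} c_n e^{-(ln n - ln k) y}, nested so
   that each step multiplies by one more factor e^{-gap y}. *)
Fixpoint horner (c : nat -> C) (y : C) (j k : nat) : C :=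
  match j with
  | O => c k
  | S j' => (c k + Cexp (- RtoC (gap k) * y) * horner c y j' (S k))%C
  end.

(* The value that |horner|^2 would have on average if every e^{-gap psi} were
   unimodular, omega being the mean of psi. *)
Fixpoint qform (c : nat -> C) (omega : C) (j k : nat) : R :=
  match j with
  | O => Cmod (c k) ^ 2
  | S j' => Cmod (c k) ^ 2
      + 2 * Re (Cconj (c k) * (Cexp (- RtoC (gap k) * omega) * horner c omega j' (S k)))%C
      + qform c omega j' (S k)
  end.

(** Real counterpart with moduli for coefficients and Re omega for omega: it majorizes [horner], and
    [rqform] majorizes [qform]. *)
Fixpoint rhorner (y : nat -> R) (alpha : R) (j k : nat) : R :=
  match j with
  | O => y k
  | S j' => y k + exp (- gap k * alpha) * rhorner y alpha j' (S k)
  end.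

Fixpoint rqform (y : nat -> R) (alpha : R) (j k : nat) : R :=
  match j with
  | O => y k ^ 2
  | S j' => y k ^ 2 + 2 * (y k * (exp (- gap k * alpha) * rhorner y alpha j' (S k)))
      + rqform y alpha j' (S k)
  end.

Lemma horner_sum (c : nat -> C) (y : C) (j : nat) : forall k,
  horner c y j k
  = sum_n (fun i => c (k + i)%nat * Cexp (- RtoC (lnS (k + i) - lnS k) * y))%C j.
Proof.
  induction j as [|j IH]; intros k.
  - simpl. rewrite sumC_0, Nat.add_0_r.
    replace (- RtoC (lnS k - lnS k) * y)%C with (RtoC 0).
    + rewrite Cexp_0. ring.
    + rewrite RtoC_minus. ring.
  - rewrite sumC_first. cbn [horner]. rewrite IH, <- sumC_scal, Nat.add_0_r. f_equal.
    + replace (- RtoC (lnS k - lnS k) * y)%C with (RtoC 0) by (rewrite RtoC_minus; ring).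
      rewrite Cexp_0. ring.
    + apply sum_n_ext. intros i. replace (k + S i)%nat with (S k + i)%nat by lia.
      replace (- RtoC (lnS (S k + i) - lnS k) * y)%C
        with (- RtoC (gap k) * y + - RtoC (lnS (S k + i) - lnS (S k)) * y)%C.
      * rewrite Cexp_plus. cring.
      * unfold gap. rewrite !RtoC_minus. ring.
Qed.

Lemma rhorner_sum (y : nat -> R) (alpha : R) (j : nat) : forall k,
  rhorner y alpha j k
  = sum_n (fun i => y (k + i)%nat * exp (- alpha * (lnS (k + i) - lnS k))) j.
Proof.
  induction j as [|j IH]; intros k.
  - simpl. rewrite sumR_0, Nat.add_0_r, Rminus_diag, Rmult_0_r, exp_0. ring.
  - rewrite sumR_first. cbn [rhorner]. rewrite IH, <- sumR_scal, Nat.add_0_r. f_equal.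
    + rewrite Rminus_diag, Rmult_0_r, exp_0. ring.
    + apply sum_n_ext. intros i. replace (k + S i)%nat with (S k + i)%nat by lia.
      replace (- alpha * (lnS (S k + i) - lnS k))
        with (- gap k * alpha + - alpha * (lnS (S k + i) - lnS (S k))) by (unfold gap; ring).
      rewrite exp_plus. rring.
Qed.

(** Here the kernel of B_alpha emerges. The square array is peeled into its corner, first row, first
    column and the rest; row and column agree by symmetry, which is the factor 2 in [rqform], and
    the row is the nested sum since the gaps add up to ln l - ln k. *)
Lemma rqform_sum (x : nat -> R) (alpha : R) (j : nat) : forall k,
  rqform (fun n => x n * exp (- lnS n / 2)) alpha j k
  = sum_n (fun i => sum_n (fun l => x (k + i)%nat * x (k + l)%nat
                                    * B_kernel alpha (k + i) (k + l)) j) j.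
Proof.
  induction j as [|j IH]; intros k.
  - cbn [rqform]. rewrite !sumR_0, Nat.add_0_r, B_kernel_le by auto.
    replace (- (lnS k + lnS k) / 2 - alpha * (lnS k - lnS k))
      with (2 * (- lnS k / 2)) by field.
    rewrite <- exp_sqr. ring.
  - set (T := fun i l => x (k + i)%nat * x (k + l)%nat * B_kernel alpha (k + i) (k + l)).
    assert (Hdiag : T 0%nat 0%nat = (x k * exp (- lnS k / 2)) ^ 2).
    { unfold T. rewrite Nat.add_0_r, B_kernel_le by auto.
      replace (- (lnS k + lnS k) / 2 - alpha * (lnS k - lnS k))
        with (2 * (- lnS k / 2)) by field.
      rewrite <- exp_sqr. ring. }
    assert (Hrow : sum_n (fun l => T 0%nat (S l)) j
      = x k * exp (- lnS k / 2) * (exp (- gap k * alpha)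
          * rhorner (fun n => x n * exp (- lnS n / 2)) alpha j (S k))).
    { rewrite rhorner_sum, <- !sumR_scal. apply sum_n_ext. intros l. unfold T.
      rewrite Nat.add_0_r, B_kernel_le by lia.
      replace (k + S l)%nat with (S k + l)%nat by lia.
      replace (- (lnS k + lnS (S k + l)) / 2 - alpha * (lnS (S k + l) - lnS k))
        with (- lnS k / 2 + (- gap k * alpha + (- lnS (S k + l) / 2
                + - alpha * (lnS (S k + l) - lnS (S k))))) by (unfold gap; field).
      rewrite !exp_plus. rring. }
    assert (Hcol : sum_n (fun i => T (S i) 0%nat) j = sum_n (fun l => T 0%nat (S l)) j).
    { apply sum_n_ext. intros i. unfold T. rewrite B_kernel_sym. rring. }
    assert (Hrest : sum_n (fun i => sum_n (fun l => T (S i) (S l)) j) j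
                    = rqform (fun n => x n * exp (- lnS n / 2)) alpha j (S k)).
    { rewrite IH. apply sum_n_ext. intros i. apply sum_n_ext. intros l. unfold T.
      replace (k + S i)%nat with (S k + i)%nat by lia.
      replace (k + S l)%nat with (S k + l)%nat by lia. reflexivity. }
    change (rqform (fun n => x n * exp (- lnS n / 2)) alpha (S j) k
            = sum_n (fun i => sum_n (T i) (S j)) (S j)).
    rewrite sumR_first, (sumR_first (T 0%nat)).
    rewrite (sum_n_ext (fun i => sum_n (T (S i)) (S j))
               (fun i => T (S i) 0%nat + sum_n (fun l => T (S i) (S l)) j))
      by (intros; apply sumR_first).
    rewrite sumR_plus, Hcol, Hrest, Hdiag, Hrow. cbn [rqform]. rring.
Qed.

Lemma Cmod_Cexp_scal (d : R) (y : C) : Cmod (Cexp (- RtoC d * y)%C) = exp (- d * Re y).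
Proof. rewrite Cmod_Cexp. destruct y. f_equal. simpl. ring. Qed.

Lemma horner_le (c : nat -> C) (y : nat -> R) (omega : C) (j : nat) :
  (forall k, Cmod (c k) <= y k) ->
  forall k, Cmod (horner c omega j k) <= rhorner y (Re omega) j k.
Proof.
  intros H. induction j as [|j IH]; intros k; simpl; auto.
  eapply Rle_trans; [apply Cmod_triangle|]. rewrite Cmod_mult, Cmod_Cexp_scal.
  apply Rplus_le_compat; auto. apply Rmult_le_compat_l; [left; apply exp_pos | auto].
Qed.

(** Uniformity in y yields one constant for all sample points and all sigma; it multiplies the
    defect from unimodularity in the lower bound. *)
Lemma horner_bounded (c : nat -> C) (j : nat) : forall k,
  exists B, 0 <= B /\ forall y, 0 <= Re y -> Cmod (horner c y j k) <= B.
Proof.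
  induction j as [|j IH]; intros k.
  - exists (Cmod (c k)). split; [apply Cmod_ge_0 | intros; simpl; lra].
  - destruct (IH (S k)) as [B [HB0 HB]]. exists (Cmod (c k) + B).
    split; [pose proof (Cmod_ge_0 (c k)); lra|]. intros y Hy. cbn [horner].
    eapply Rle_trans; [apply Cmod_triangle|]. apply Rplus_le_compat_l.
    rewrite Cmod_mult, Cmod_Cexp_scal. specialize (HB y Hy). pose proof (gap_pos k).
    assert (exp (- gap k * Re y) <= 1) by (rewrite <- exp_0; apply exp_le; nra).
    pose proof (exp_pos (- gap k * Re y)). pose proof (Cmod_ge_0 (horner c y j (S k))). nra.
Qed.

Lemma qform_le (c : nat -> C) (y : nat -> R) (omega : C) (j : nat) :
  (forall k, Cmod (c k) <= y k) ->
  forall k, qform c omega j k <= rqform y (Re omega) j k.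
Proof.
  intros H.
  assert (Hsq : forall k, Cmod (c k) ^ 2 <= y k ^ 2).
  { intros k. apply pow_incr. split; [apply Cmod_ge_0 | auto]. }
  induction j as [|j IH]; intros k; [apply Hsq|]. cbn [qform rqform].
  apply Rplus_le_compat; auto. apply Rplus_le_compat; auto.
  apply Rmult_le_compat_l; [lra|].
  eapply Rle_trans; [apply Rle_abs|]. eapply Rle_trans; [apply re_le_Cmod|].
  rewrite !Cmod_mult, Cmod_conj, Cmod_Cexp_scal.
  apply Rmult_le_compat; auto using Cmod_ge_0.
  - apply Rmult_le_pos; [left; apply exp_pos | apply Cmod_ge_0].
  - apply Rmult_le_compat_l; [left; apply exp_pos | apply horner_le; auto].
Qed.

Lemma unif_dpoly_factor (e d : R) (psi : C -> C) :
  unif_dpoly e psi -> unif_dpoly e (fun s => Cexp (- RtoC d * psi s)%C).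
Proof.
  intros H. apply unif_dpoly_Cexp.
  apply unif_dpoly_mult; [apply unif_dpoly_const | auto].
Qed.

Lemma unif_dpoly_horner (e : R) (c : nat -> C) (psi : C -> C) (j : nat) :
  unif_dpoly e psi -> forall k, unif_dpoly e (fun s => horner c (psi s) j k).
Proof.
  intros H. induction j as [|j IH]; intros k; simpl.
  - apply unif_dpoly_const.
  - apply unif_dpoly_plus; [apply unif_dpoly_const|].
    apply unif_dpoly_mult; [apply unif_dpoly_factor; auto | auto].
Qed.

Lemma lim_infty_horner (c : nat -> C) (psi : C -> C) (omega : C) (j : nat) :
  lim_infty psi omega -> forall k, lim_infty (fun s => horner c (psi s) j k) (horner c omega j k).
Proof.
  intros H. induction j as [|j IH]; intros k; simpl.
  - apply lim_infty_const.
  - apply lim_infty_plus; [apply lim_infty_const|].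
    apply lim_infty_mult; [|auto]. apply lim_infty_Cexp.
    apply lim_infty_mult; [apply lim_infty_const | auto].
Qed.

Lemma mean_cross_term (e sigma : R) (c : nat -> C) (psi : C -> C) (omega : C) (j k : nat) :
  unif_dpoly e psi -> lim_infty psi omega -> e < sigma ->
  mean (fun i => Re (Cconj (c k) * (Cexp (- RtoC (gap k) * psi (vpt sigma i))
                                    * horner c (psi (vpt sigma i)) j (S k)))%C)
       (Re (Cconj (c k) * (Cexp (- RtoC (gap k) * omega) * horner c omega j (S k)))%C).
Proof.
  intros Hu Hl He.
  apply (mean_Re_unif e sigma (fun s => Cconj (c k) * (Cexp (- RtoC (gap k) * psi s)
                                         * horner c (psi s) j (S k)))%C); auto.
  - apply unif_dpoly_mult; [apply unif_dpoly_const|].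
    apply unif_dpoly_mult; [apply unif_dpoly_factor; auto | apply unif_dpoly_horner; auto].
  - apply lim_infty_mult; [apply lim_infty_const|].
    apply lim_infty_mult; [|apply lim_infty_horner; auto]. apply lim_infty_Cexp.
    apply lim_infty_mult; [apply lim_infty_const | auto].
Qed.

Lemma avg_horner_step (c : nat -> C) (f : nat -> C) (j k N : nat) :
  avg (fun i => Cmod (horner c (f i) (S j) k) ^ 2) N
  = Cmod (c k) ^ 2
    + 2 * avg (fun i => Re (Cconj (c k) * (Cexp (- RtoC (gap k) * f i)
                                           * horner c (f i) j (S k)))%C) N
    + avg (fun i => Cmod (Cexp (- RtoC (gap k) * f i) * horner c (f i) j (S k))%C ^ 2) N.
Proof.
  rewrite <- (avg_const (Cmod (c k) ^ 2) N) at 1.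
  rewrite <- avg_scal, <- !avg_plus. apply avg_ext. intros i. cbn [horner].
  apply Cmod_plus_sqr.
Qed.

(* Multiplication by e^{-gap psi} is a contraction on every vertical line. *)
Lemma mean_square_horner_le (c : nat -> C) (psi : C -> C) (omega : C) (sigma : R) (j : nat) :
  (forall e, 0 < e -> unif_dpoly e psi) -> lim_infty psi omega ->
  (forall s, halfplane 0 s -> 0 <= Re (psi s)) -> 0 < sigma ->
  forall k eta, 0 < eta -> exists N0, forall N, (N0 <= N)%nat ->
    avg (fun i => Cmod (horner c (psi (vpt sigma i)) j k) ^ 2) N <= qform c omega j k + eta.
Proof.
  intros Hu Hl Hre Hs. induction j as [|j IH]; intros k eta Heta.
  - exists 0%nat. intros N _. simpl. rewrite avg_const. lra.
  - destruct (IH (S k) (eta / 2)) as [N1 HN1]; [lra|].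
    (* The half-plane of approximation must contain the line Re s = sigma, hence sigma / 2. The
       cross term carries a factor 2, hence eta / 4. *)
    destruct (mean_eventually _ _ (eta / 4)
                (mean_cross_term (sigma / 2) sigma c psi omega j k
                   (Hu (sigma / 2) ltac:(lra)) Hl ltac:(lra)) ltac:(lra)) as [N2 HN2].
    exists (Nat.max N1 N2). intros N HN.
    specialize (HN1 N ltac:(lia)). specialize (HN2 N ltac:(lia)).
    apply Rabs_lt_between in HN2.
    rewrite (avg_horner_step c (fun i => psi (vpt sigma i))). cbn [qform].
    assert (Hc : avg (fun i => Cmod (Cexp (- RtoC (gap k) * psi (vpt sigma i))
                                     * horner c (psi (vpt sigma i)) j (S k))%C ^ 2) N
                 <= avg (fun i => Cmod (horner c (psi (vpt sigma i)) j (S k)) ^ 2) N).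
    { apply avg_le. intros i. rewrite Cmod_mult, Cmod_Cexp_scal, Rpow_mult_distr, exp_sqr.
      specialize (Hre (vpt sigma i) Hs). pose proof (gap_pos k).
      rewrite <- (Rmult_1_l (Cmod (horner _ _ _ _) ^ 2)) at 2.
      apply Rmult_le_compat_r; [apply pow2_ge_0|]. rewrite <- exp_0. apply exp_le. nra. }
    lra.
Qed.

Definition comp_partial (a : nat -> C) (phi : C -> C) (M : nat) (s : C) : C :=
  sum_n (dirichlet_term a (phi s)) M.

Lemma comp_partial_horner (a : nat -> C) (phi : C -> C) (M : nat) (s : C) :
  comp_partial a phi M s
  = horner (fun n => a n * RtoC (exp (- lnS n / 2)))%C (phi s - RtoC (1 / 2))%C M 0.
Proof.
  unfold comp_partial. rewrite horner_sum. apply sum_n_ext. intros n. simpl (0 + n)%nat.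
  unfold dirichlet_term. rewrite npow_neg_eq, lnS_0, Rminus_0_r.
  replace (- phi s * RtoC (lnS n))%C
    with (RtoC (- lnS n / 2) + - RtoC (lnS n) * (phi s - RtoC (1 / 2)))%C.
  - rewrite Cexp_plus.
    replace (Cexp (RtoC (- lnS n / 2))) with (RtoC (exp (- lnS n / 2))); [cring|].
    unfold Cexp, RtoC; simpl. rewrite cos_0, sin_0. f_equal; ring.
  - replace (- lnS n / 2) with (- lnS n * (1 / 2)) by field.
    rewrite RtoC_mult, RtoC_opp. ring.
Qed.

(** With [n] fixed, sigma tends to 0 along 1/(m+1) in a finite sum; this replaces boundary values on
    Re s = 0. *)
Lemma sum_wt_limit (u : nat -> R) (A : R) (n : nat) :
  (forall sigma, 0 < sigma -> sum_n (fun k => u k * wt sigma k) n <= A) -> sum_n u n <= A.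
Proof.
  intros H.
  apply (is_lim_seq_le (fun m => sum_n (fun k => u k * wt (/ INR (S m)) k) n) (fun _ => A)
           (sum_n u n) A).
  - intros m. apply H. apply inv_S_pos.
  - apply is_lim_seq_sum. intros k. rewrite <- (Rmult_1_r (u k)) at 1.
    apply (is_lim_seq_scal_l _ (u k) 1).
    replace 1 with (wt 0 k).
    + apply is_lim_seq_continuous with (f := fun x => wt x k); [|apply is_lim_seq_inv_S].
      unfold wt. apply continuity_pt_filterlim.
      apply (ex_derive_continuous (fun x => exp (- (2 * x) * lnS k))). auto_derive; auto.
    + unfold wt. replace (- (2 * 0) * lnS k) with 0 by ring. apply exp_0.
  - apply is_lim_seq_const.
Qed.

Lemma sum_truncated (a : nat -> C) (L M : nat) : (L <= M)%nat ->
  sum_n (fun k => Cmod (if Nat.leb k L then RtoC 0 else a k) ^ 2) M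
  = sum_n (fun k => Cmod (a k) ^ 2) M - sum_n (fun k => Cmod (a k) ^ 2) L.
Proof.
  intros HLM. induction HLM as [|M HLM IH].
  - rewrite (sum_n_ext_loc _ (fun _ => 0)), sumR_zero; [rring|].
    intros k Hk. destruct (Nat.leb_spec k L); [|lia]. rewrite Cmod_0. rring.
  - rewrite !sumR_S, IH. destruct (Nat.leb_spec (S M) L); [lia | rring].
Qed.

Section Subordination.

Variables (phi : C -> C) (w : C) (N : R).
Hypothesis phi_unif : forall e, 0 < e -> unif_dpoly e phi.
Hypothesis phi_range : forall s, halfplane 0 s -> halfplane (1 / 2) (phi s).
Hypothesis phi_infty : lim_infty phi w.
Hypothesis N_quad : quad_bound (Re w - 1 / 2) N.

Let psi (s : C) : C := (phi s - RtoC (1 / 2))%C.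

Lemma psi_unif (e : R) : 0 < e -> unif_dpoly e psi.
Proof.
  intros He. apply unif_dpoly_plus; [auto | apply unif_dpoly_const].
Qed.

Lemma psi_infty : lim_infty psi (w - RtoC (1 / 2))%C.
Proof. apply lim_infty_plus; [auto | apply lim_infty_const]. Qed.

Lemma comp_partial_unif (a : nat -> C) (M : nat) (e : R) : 0 < e ->
  unif_dpoly e (comp_partial a phi M).
Proof.
  intros He. eapply unif_dpoly_ext.
  - intros s _. symmetry. apply comp_partial_horner.
  - apply unif_dpoly_horner. apply psi_unif; auto.
Qed.

Lemma comp_partial_mean (a : nat -> C) (M : nat) (sigma eta : R) : 0 < sigma -> 0 < eta ->
  exists N0, forall n, (N0 <= n)%nat ->
    avg (fun i => Cmod (comp_partial a phi M (vpt sigma i)) ^ 2) n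
    <= N * sum_n (fun k => Cmod (a k) ^ 2) M + eta.
Proof.
  intros Hs Heta. set (c := fun n => (a n * RtoC (exp (- lnS n / 2)))%C).
  destruct (mean_square_horner_le c psi (w - RtoC (1 / 2))%C sigma M psi_unif psi_infty) 
    with (k := 0%nat) (eta := eta) as [N0 HN0]; auto.
  { intros s Hh. specialize (phi_range s Hh). unfold halfplane in phi_range.
    unfold psi. change (Re (phi s - RtoC (1 / 2))%C) with (Re (phi s) - 1 / 2). lra. }
  exists N0. intros n Hn.
  rewrite (avg_ext _ (fun i => Cmod (horner c (psi (vpt sigma i)) M 0) ^ 2))
    by (intros; rewrite comp_partial_horner; reflexivity).
  apply Rle_trans with (1 := HN0 n Hn). apply Rplus_le_compat_r.
  apply Rle_trans with (2 := N_quad (fun k => Cmod (a k)) M).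
  eapply Rle_trans.
  - apply (qform_le c (fun n => Cmod (a n) * exp (- lnS n / 2))).
    intros k. unfold c. rewrite Cmod_mult, Cmod_R, Rabs_pos_eq by (left; apply exp_pos). lra.
  - rewrite (rqform_sum (fun n => Cmod (a n))). right. reflexivity.
Qed.

Lemma comp_partial_coeffs (a : nat -> C) (M : nat) (b : nat -> C) :
  is_coeffs (comp_partial a phi M) b ->
  forall n, sum_n (fun k => Cmod (b k) ^ 2) n <= N * sum_n (fun k => Cmod (a k) ^ 2) M.
Proof.
  intros Hb n.
  assert (HN : 1 <= N) by (eapply quad_bound_ge_1; eauto).
  assert (HC : 0 <= N * sum_n (fun k => Cmod (a k) ^ 2) M).
  { apply Rmult_le_pos; [lra|]. apply sumR_nonneg; intros; apply pow2_ge_0. }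
  apply sum_wt_limit. intros sigma Hs.
  (* Two constraints on e: at most 1 for [is_coeffs], and below sigma for the averages. *)
  set (e := Rmin 1 (sigma / 2)).
  assert (He : 0 < e) by (apply Rmin_glb_lt; lra).
  assert (He1 : e <= 1) by apply Rmin_l.
  assert (He2 : e <= sigma / 2) by apply Rmin_r.
  apply (coeffs_bessel e sigma _ (comp_partial a phi M) b); auto; [lra | |].
  - apply comp_partial_unif; auto.
  - intros eta Heta. apply comp_partial_mean; auto.
Qed.

(** The difference is again a composed partial sum, of a sequence with its head set to zero, so the
    norm bound applies to differences as well. *)
Lemma comp_partial_minus (a : nat -> C) (M L : nat) (s : C) : (L <= M)%nat ->
  (comp_partial a phi M s + (- (1)) * comp_partial a phi L s)%C
  = comp_partial (fun k => if Nat.leb k L then RtoC 0 else a k) phi M s.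
Proof.
  intros HLM. unfold comp_partial.
  set (aL := fun k => if Nat.leb k L then a k else RtoC 0).
  replace (sum_n (dirichlet_term a (phi s)) L) with (sum_n (dirichlet_term aL (phi s)) M).
  - rewrite <- sumC_scal, <- sumC_plus. apply sum_n_ext. intros k. unfold dirichlet_term, aL.
    destruct (Nat.leb k L); cring.
  - rewrite (sumC_stable _ L M).
    + apply sum_n_ext_loc. intros k Hk. unfold dirichlet_term, aL.
      destruct (Nat.leb_spec k L); [auto | lia].
    + intros k Hk. unfold dirichlet_term, aL. destruct (Nat.leb_spec k L); [lia | ring].
    + auto.
Qed.

(** The bound for partial sums makes each coefficient converge; the limit sequence inherits the norm
    bound and represents f o phi on C_{1/2}, where the partial sums of [f] converge at phi(s). *)
Lemma composition_bounded (f : C -> C) (a : nat -> C) : in_H2 f a ->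
  exists b, in_H2 (fun s => f (phi s)) b /\ ell2_norm b <= sqrt N * ell2_norm a.
Proof.
  intros [Ha Hf].
  assert (HN : 1 <= N) by (eapply quad_bound_ge_1; eauto).
  destruct (choose_seq (nat -> C) (fun M b => is_coeffs (comp_partial a phi M) b)) as [b Hb].
  { intros M. apply is_coeffs_exists. apply comp_partial_unif. lra. }
  set (S2 := sum_n (fun k => Cmod (a k) ^ 2)).
  (* The right side is a block of the convergent series of |a_k|^2, so every coefficient is Cauchy
     in the length of the partial sum. *)
  assert (Hdiff : forall k L M, (L <= M)%nat -> Cmod (b M k - b L k)%C ^ 2 <= N * (S2 M - S2 L)).
  { intros k L M HLM.
    pose proof (is_coeffs_minus _ _ _ _ (comp_partial_unif a M 1 ltac:(lra))
                  (comp_partial_unif a L 1 ltac:(lra)) (Hb M) (Hb L)) as Hc.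
    assert (Hc' : is_coeffs (comp_partial (fun k => if Nat.leb k L then RtoC 0 else a k) phi M)
                            (fun k => b M k + (- (1)) * b L k)%C).
    { intros p K P eta HP He HF. apply (Hc p K P eta HP He). intros s Hs.
      rewrite comp_partial_minus by auto. auto. }
    pose proof (comp_partial_coeffs _ _ _ Hc' k) as Hk.
    cbv beta in Hk. rewrite sum_truncated in Hk by auto.
    apply Rle_trans with (2 := Hk). rewrite Cminus_lin.
    apply (sumR_term_le (fun k => Cmod (b M k + (- (1)) * b L k)%C ^ 2)); auto.
    intros; apply pow2_ge_0. }
  assert (HS2 : ex_finite_lim_seq S2) by exact Ha.
  destruct (choose_seq C (fun k l => Clim (fun M => b M k) l)) as [beta Hbeta].
  { intros k. apply Clim_Cauchy. intros eta Heta.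
    apply ex_lim_seq_cauchy_corr in HS2.
    assert (He : 0 < eta ^ 2 / N) by (apply Rdiv_lt_0_compat; [nra | lra]).
    destruct (HS2 (mkposreal _ He)) as [N0 HN0]. simpl in HN0.
    assert (Hle : forall L M, (N0 <= L)%nat -> (L <= M)%nat -> Cmod (b M k - b L k)%C < eta).
    { intros L M HL HLM. specialize (Hdiff k L M HLM).
      specialize (HN0 M L ltac:(lia) HL). apply Rabs_lt_between in HN0.
      pose proof (Cmod_ge_0 (b M k - b L k)%C).
      apply Rsqr_incrst_0; [|auto|lra]. unfold Rsqr.
      apply Rle_lt_trans with (N * (S2 M - S2 L)); [simpl in Hdiff; lra|].
      apply Rlt_le_trans with (N * (eta ^ 2 / N)).
      - apply Rmult_lt_compat_l; [lra|]. simpl. simpl in HN0. lra.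
      - right. field. lra. }
    exists N0. intros m n Hm Hn. destruct (Nat.le_ge_cases m n).
    - rewrite Cmod_minus_sym. auto.
    - auto. }
  assert (HB : forall j n, sum_n (fun k => Cmod (b j k) ^ 2) n <= N * ell2_norm a ^ 2).
  { intros j n. apply Rle_trans with (1 := comp_partial_coeffs a j (b j) (Hb j) n).
    apply Rmult_le_compat_l; [lra|]. apply ell2_partial; auto. }
  destruct (dirichlet_weak_limit b beta _ HB Hbeta) as [Hsum Hlim].
  destruct (ell2_of_bound beta _ Hsum) as [Hell Hnorm].
  exists beta. split; [split; auto|].
  - intros s Hs. apply is_series_C_Clim.
    apply (Hlim s (fun j => comp_partial a phi j s)); auto.
    + intros j. apply coeffs_series; auto. intros e He. apply comp_partial_unif; auto.
    + apply is_series_C_Clim. apply Hf. apply phi_range. unfold halfplane in *; lra.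
  - rewrite sqrt_mult, sqrt_pow2 in Hnorm; auto using ell2_norm_ge_0, pow2_ge_0. lra.
Qed.

End Subordination.

(** * The extremal symbol *)

Lemma geometric_sum (z : C) (J : nat) :
  ((1 - z) * sum_n (fun j => z ^ j) J = 1 - z ^ S J)%C.
Proof.
  induction J as [|J IH].
  - rewrite sumC_0. simpl. ring.
  - rewrite sumC_S, Cmult_plus_distr_l, IH. simpl. ring.
Qed.

Lemma Cmod_1_minus (z : C) : 1 - Cmod z <= Cmod (1 - z)%C.
Proof.
  pose proof (Cmod_le_of_close 1%C z) as H. rewrite Cmod_1 in H. lra.
Qed.

Lemma geometric_error (z : C) (rho : R) (J : nat) : Cmod z <= rho -> rho < 1 ->
  Cmod (/ (1 - z) - sum_n (fun j => z ^ j) J)%C <= rho ^ S J / (1 - rho).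
Proof.
  intros Hz Hr. pose proof (Cmod_1_minus z) as H1.
  assert (Hp : 0 < Cmod (1 - z)%C) by lra.
  assert (Hnz : (1 - z)%C <> RtoC 0) by (apply Cmod_gt_0; auto).
  replace (/ (1 - z) - sum_n (fun j => z ^ j) J)%C with (z ^ S J / (1 - z))%C.
  - rewrite Cmod_div, Cmod_pow by auto. pose proof (Cmod_ge_0 z).
    apply Rmult_le_compat.
    + apply pow_le; auto.
    + left; apply Rinv_0_lt_compat; auto.
    + apply pow_incr; auto.
    + apply Rinv_le_contravar; lra.
  - replace (z ^ S J)%C with (1 - (1 - z) * sum_n (fun j => z ^ j) J)%C
      by (rewrite geometric_sum; ring).
    field. auto.
Qed.

Lemma unif_dpoly_geometric (e rho : R) (F : C -> C) :
  unif_dpoly e F -> 0 <= rho < 1 -> (forall s, halfplane e s -> Cmod (F s) <= rho) ->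
  unif_dpoly e (fun s => / (1 - F s))%C.
Proof.
  intros HF Hr Hs. apply unif_dpoly_lim. intros eta Heta.
  destruct (pow_lt_1_zero rho ltac:(rewrite Rabs_pos_eq; lra) (eta * (1 - rho)))
    as [J HJ]; [apply Rmult_lt_0_compat; lra|].
  exists (fun s => sum_n (fun j => F s ^ j)%C J). split.
  - clear HJ. induction J as [|J IH].
    + apply unif_dpoly_ext with (fun _ => RtoC 1); [|apply unif_dpoly_const].
      intros s _. rewrite sumC_0. reflexivity.
    + apply unif_dpoly_ext with (fun s => sum_n (fun j => F s ^ j) J + F s ^ S J)%C.
      * intros s _. rewrite sumC_S. reflexivity.
      * apply unif_dpoly_plus; auto. apply unif_dpoly_pow; auto.
  - intros s Hh. eapply Rle_trans; [apply geometric_error with (rho := rho); [auto | lra]|].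
    specialize (HJ (S J) ltac:(lia)). rewrite Rabs_pos_eq in HJ by (apply pow_le; lra).
    apply Rmult_le_reg_r with (1 - rho); [lra|].
    replace (rho ^ S J / (1 - rho) * (1 - rho)) with (rho ^ S J) by (field; lra). lra.
Qed.

Lemma unif_dpoly_of_cv (e : R) (c : nat -> C) (F : C -> C) :
  dirichlet_cv_unif c (halfplane e) F -> unif_dpoly e F.
Proof.
  intros H eta Heta. destruct (H eta Heta) as [N HN].
  exists (fun s => sum_n (dirichlet_term c s) N). split; [apply is_dpoly_partial|].
  intros s Hs. rewrite Cmod_minus_sym. left. apply HN; auto.
Qed.

Lemma lim_infty_of_cv (e : R) (c : nat -> C) (F : C -> C) :
  dirichlet_cv_unif c (halfplane e) F -> lim_infty F (c 0%nat).
Proof.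
  intros H eta Heta. destruct (H (eta / 2)) as [N HN]; [lra|].
  destruct (lim_infty_dpoly c N (eta / 2)) as [M HM]; [lra|].
  exists (Rmax M e). intros s Hs. pose proof (Rmax_l M e). pose proof (Rmax_r M e).
  specialize (HN N (Nat.le_refl N) s ltac:(unfold halfplane; lra)).
  specialize (HM s ltac:(lra)).
  pose proof (Cmod_triangle_minus (F s) (sum_n (dirichlet_term c s) N) (c 0%nat)) as Ht.
  rewrite (Cmod_minus_sym (F s) (sum_n _ _)) in Ht. lra.
Qed.

Lemma value_at_infty_iff (phi : C -> C) (w : C) : value_at_infty phi w <-> lim_infty phi w.
Proof.
  split.
  - intros H eta Heta. apply (H (fun z => Cmod (z - w)%C < eta)).
    apply locally_C_Cmod. exists eta; auto.
  - intros H P HP. apply locally_C_Cmod in HP. destruct HP as [eta [Heta HP]].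
    destruct (H eta Heta) as [M HM]. exists M. intros s Hs. apply HP, HM, Hs.
Qed.

Lemma Re_cayley (z : C) : Cmod z < 1 ->
  Re ((1 - z) / (1 + z))%C = (1 - Cmod z ^ 2) / Cmod (1 + z)%C ^ 2.
Proof.
  intros Hz. rewrite !Cmod_sqr.
  assert (Hp : 0 < Cmod (1 + z)%C).
  { pose proof (Cmod_1_minus (- z)%C) as H. rewrite Cmod_opp in H.
    replace (1 - - z)%C with (1 + z)%C in H by ring. lra. }
  assert (Hp2 : 0 < Cmod (1 + z)%C ^ 2) by nra. rewrite Cmod_sqr in Hp2.
  destruct z as [a b]. simpl in *. field. nra.
Qed.

Lemma lnS_1_bounds : 0 < lnS 1 <= 1.
Proof.
  split; [rewrite <- lnS_0; apply lnS_lt; lia|].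
  pose proof (exp_ineq1_le (lnS 1)) as H. rewrite exp_lnS in H. simpl in H. lra.
Qed.

Section Extremal.

Variables (w : C) (alpha : R).
Hypothesis alpha_pos : 0 < alpha.
Hypothesis alpha_eq : alpha = Re w - 1 / 2.

Definition two_pow (s : C) : C := npow_neg 1 s.

(* [w - alpha + alpha (1 - z) / (1 + z)] with [z = 2^{-s}]: a conformal map of
   the unit disc onto C_{1/2}, shifted by i Im w, sending 0 to w. *)
Definition extremal_symbol (s : C) : C :=
  (w + RtoC (2 * alpha) * (/ (1 - (- two_pow s)) - 1))%C.

(** From 1/(1+z) = sum of (-z)^j: the coefficient 2 alpha (-1)^j sits at the integer 2^j, index 2^j
    - 1. The case j = 0 is separate, its contribution being cancelled by the -1 in the symbol. *)
Definition extremal_coeff (n : nat) : C :=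
  match n with
  | O => w
  | _ => if Nat.eqb (S n) (2 ^ Nat.log2 (S n))
         then (RtoC (2 * alpha) * (- (1)) ^ Nat.log2 (S n))%C else RtoC 0
  end.

Lemma Cmod_two_pow_le (e : R) (s : C) : halfplane e s -> Cmod (two_pow s) <= exp (- e * lnS 1).
Proof. intros H. apply Cmod_npow_neg_le. unfold halfplane in H; lra. Qed.

Lemma Cmod_two_pow_lt_1 (s : C) : halfplane 0 s -> Cmod (two_pow s) < 1.
Proof.
  intros H. unfold two_pow. rewrite Cmod_npow_neg, <- exp_0. apply exp_increasing.
  pose proof lnS_1_bounds. unfold halfplane in H. nra.
Qed.

Lemma npow_neg_pow2 (n j : nat) (s : C) : S n = (2 ^ j)%nat -> npow_neg n s = (two_pow s ^ j)%C.
Proof.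
  intros H. unfold two_pow. rewrite !npow_neg_eq, Cexp_pow. f_equal.
  replace (lnS n) with (INR j * lnS 1).
  - rewrite RtoC_mult. ring.
  - unfold lnS. rewrite H, pow_INR. symmetry. apply ln_pow. apply INR_S_pos.
Qed.

(** A new term of the geometric series appears exactly when the integer n + 1 reaches a power of
    two; otherwise its logarithm is unchanged and the coefficient is 0. *)
Lemma extremal_partial (s : C) (n : nat) :
  sum_n (dirichlet_term extremal_coeff s) n
  = (w + RtoC (2 * alpha) * (sum_n (fun j => (- two_pow s) ^ j) (Nat.log2 (S n)) - 1))%C.
Proof.
  induction n as [|n IH].
  - rewrite sumC_0. simpl Nat.log2. rewrite sumC_0. unfold dirichlet_term.
    rewrite npow_neg_0. simpl. cring.
  - rewrite sumC_S, IH. unfold dirichlet_term.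
    change (extremal_coeff (S n)) with (if Nat.eqb (S (S n)) (2 ^ Nat.log2 (S (S n)))
      then (RtoC (2 * alpha) * (- (1)) ^ Nat.log2 (S (S n)))%C else RtoC 0).
    set (l := Nat.log2 (S n)).
    destruct (Nat.log2_succ_or (S n)) as [Hl|Hl]; rewrite Hl; fold l.
    + assert (Hpow : S (S n) = (2 ^ S l)%nat).
      { pose proof (Nat.log2_spec (S n) ltac:(lia)) as H1.
        pose proof (Nat.log2_spec (S (S n)) ltac:(lia)) as H2.
        rewrite Hl in H2. fold l in H1, H2. lia. }
      rewrite <- Hpow, Nat.eqb_refl, (npow_neg_pow2 (S n) (S l)) by auto.
      rewrite sumC_S.
      replace ((- two_pow s) ^ S l)%C with ((- (1)) ^ S l * two_pow s ^ S l)%C.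
      * cring.
      * rewrite <- Cpow_mult_l. f_equal. ring.
    + assert (Hne : S (S n) <> (2 ^ l)%nat).
      { pose proof (Nat.log2_spec (S n) ltac:(lia)) as H1. fold l in H1. lia. }
      apply Nat.eqb_neq in Hne. rewrite Hne. cring.
Qed.

Lemma extremal_cv_unif (e : R) : 0 < e ->
  dirichlet_cv_unif extremal_coeff (halfplane e) extremal_symbol.
Proof.
  intros He eta Heta. pose proof lnS_1_bounds as Hl.
  set (rho := exp (- e * lnS 1)).
  assert (Hr0 : 0 < rho) by apply exp_pos.
  assert (Hr : rho < 1) by (unfold rho; rewrite <- exp_0; apply exp_increasing; nra).
  destruct (pow_lt_1_zero rho ltac:(rewrite Rabs_pos_eq; lra) (eta * (1 - rho) / (2 * alpha)))
    as [J HJ].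
  { apply Rdiv_lt_0_compat; [apply Rmult_lt_0_compat|]; lra. }
  exists (2 ^ J)%nat. intros n Hn s Hs.
  rewrite extremal_partial. unfold extremal_symbol.
  set (l := Nat.log2 (S n)).
  assert (HJl : (J <= l)%nat).
  { unfold l. rewrite <- (Nat.log2_pow2 J) by lia. apply Nat.log2_le_mono. lia. }
  rewrite Cmod_minus_sym.
  match goal with |- Cmod ?x < _ => replace x with
    (RtoC (2 * alpha) * (/ (1 - - two_pow s) - sum_n (fun j => (- two_pow s) ^ j) l))%C by ring end.
  rewrite Cmod_mult, Cmod_R, Rabs_pos_eq by lra.
  eapply Rle_lt_trans.
  - apply Rmult_le_compat_l; [lra|]. apply geometric_error with (rho := rho); auto.
    rewrite Cmod_opp. apply Cmod_two_pow_le; auto.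
  - specialize (HJ (S l) ltac:(lia)). rewrite Rabs_pos_eq in HJ by (apply pow_le; lra).
    apply Rmult_lt_reg_r with ((1 - rho) / (2 * alpha)); [apply Rdiv_lt_0_compat; lra|].
    replace (2 * alpha * (rho ^ S l / (1 - rho)) * ((1 - rho) / (2 * alpha)))
      with (rho ^ S l) by (field; lra).
    replace (eta * ((1 - rho) / (2 * alpha))) with (eta * (1 - rho) / (2 * alpha)) by (field; lra).
    exact HJ.
Qed.

Lemma one_plus_two_pow (s : C) : halfplane 0 s -> 0 < Cmod (1 + two_pow s)%C.
Proof.
  intros H. pose proof (Cmod_two_pow_lt_1 s H).
  pose proof (Cmod_1_minus (- two_pow s)%C) as H1. rewrite Cmod_opp in H1.
  replace (1 - - two_pow s)%C with (1 + two_pow s)%C in H1 by ring. lra.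
Qed.

(** The quotient is the Poisson kernel of the disc with pole at z = -1: small near the unit circle
    away from that point. *)
Lemma Re_extremal (s : C) : halfplane 0 s ->
  Re (extremal_symbol s - RtoC (1 / 2))%C
  = alpha * ((1 - Cmod (two_pow s) ^ 2) / Cmod (1 + two_pow s)%C ^ 2).
Proof.
  intros H. pose proof (one_plus_two_pow s H) as Hp.
  rewrite <- Re_cayley by (apply Cmod_two_pow_lt_1; auto).
  assert (Hnz : (1 + two_pow s)%C <> RtoC 0) by (apply Cmod_gt_0; auto).
  replace (extremal_symbol s - RtoC (1 / 2))%C
    with ((w - RtoC (1 / 2) - RtoC alpha)
          + RtoC alpha * ((1 - two_pow s) / (1 + two_pow s)))%C.
  - rewrite re_plus, re_scal_l.
    replace (Re (w - RtoC (1 / 2) - RtoC alpha)%C) with (Re w - 1 / 2 - alpha)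
      by (destruct w; simpl; ring).
    rewrite alpha_eq at 1. ring.
  - unfold extremal_symbol. rewrite RtoC_mult.
    replace (1 - - two_pow s)%C with (1 + two_pow s)%C by ring. field. auto.
Qed.

Lemma extremal_range (s : C) : halfplane 0 s -> halfplane (1 / 2) (extremal_symbol s).
Proof.
  intros H. pose proof (Re_extremal s H) as Hre.
  change (Re (extremal_symbol s - RtoC (1 / 2))%C) with (Re (extremal_symbol s) - 1 / 2) in Hre.
  pose proof (one_plus_two_pow s H). pose proof (Cmod_two_pow_lt_1 s H).
  pose proof (Cmod_ge_0 (two_pow s)).
  assert (0 < alpha * ((1 - Cmod (two_pow s) ^ 2) / Cmod (1 + two_pow s)%C ^ 2)).
  { apply Rmult_lt_0_compat; auto. apply Rdiv_lt_0_compat; nra. }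
  unfold halfplane. lra.
Qed.

Lemma extremal_unif (e : R) : 0 < e -> unif_dpoly e extremal_symbol.
Proof. intros He. eapply unif_dpoly_of_cv, extremal_cv_unif; auto. Qed.

Lemma extremal_infty : lim_infty extremal_symbol w.
Proof. exact (lim_infty_of_cv 1 extremal_coeff _ (extremal_cv_unif 1 ltac:(lra))). Qed.

Lemma extremal_in_class : gordon_hedenmalm extremal_symbol.
Proof.
  exists 0%nat, extremal_coeff, extremal_symbol. repeat split.
  - intros s _. simpl. ring.
  - apply extremal_cv_unif.
  - intros _. apply extremal_range.
  - intros H; lia.
Qed.

(** This is kappa / (kappa + 1 + z) with z = 2^{-s}, in the form of a geometric series. Its pole -1
    - kappa lies just outside the disc: its real part is bounded below near z = -1, while its mean,
    the value at z = 0, is about kappa. The frequency of visits near -1 is thus estimated without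
    measuring arcs. *)
Definition peak (kappa : R) (s : C) : C :=
  (RtoC (kappa / (kappa + 1)) * / (1 - (RtoC (- / (kappa + 1)) * two_pow s)))%C.

Lemma peak_unif (kappa e : R) : 0 < kappa -> 0 < e -> unif_dpoly e (peak kappa).
Proof.
  intros Hk He. assert (Hi : 0 < / (kappa + 1) < 1).
  { split; [apply Rinv_0_lt_compat; lra|]. rewrite <- Rinv_1. apply Rinv_lt_contravar; lra. }
  apply unif_dpoly_mult; [apply unif_dpoly_const|].
  apply unif_dpoly_geometric with (rho := / (kappa + 1)); [|lra|].
  - apply unif_dpoly_of_dpoly. apply is_dpoly_term.
  - intros s Hs. rewrite Cmod_mult, Cmod_R, Rabs_Ropp, Rabs_pos_eq by lra.
    pose proof (Cmod_two_pow_lt_1 s ltac:(unfold halfplane in *; lra)).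
    pose proof (Cmod_ge_0 (two_pow s)). nra.
Qed.

Lemma peak_infty (kappa : R) : 0 < kappa ->
  lim_infty (peak kappa) (RtoC (kappa / (kappa + 1))).
Proof.
  intros Hk. assert (Hi : 0 < / (kappa + 1) < 1).
  { split; [apply Rinv_0_lt_compat; lra|]. rewrite <- Rinv_1. apply Rinv_lt_contravar; lra. }
  replace (RtoC (kappa / (kappa + 1))) with (RtoC (kappa / (kappa + 1)) * 1)%C by ring.
  apply lim_infty_mult; [apply lim_infty_const|].
  intros eta Heta.
  destruct (lim_infty_npow_neg (RtoC (- / (kappa + 1))) 0 (Rmin (1 / 2) (eta / 2))) as [M HM].
  { apply Rmin_glb_lt; lra. }
  exists M. intros s Hs. specialize (HM s Hs).
  change (npow_neg 1 s) with (two_pow s) in HM. rewrite Cminus_0_r in HM.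
  set (u := (RtoC (- / (kappa + 1)) * two_pow s)%C) in *.
  pose proof (Rmin_l (1 / 2) (eta / 2)). pose proof (Rmin_r (1 / 2) (eta / 2)).
  pose proof (Cmod_1_minus u) as H1.
  assert (Hnz : (1 - u)%C <> RtoC 0) by (apply Cmod_gt_0; lra).
  replace (/ (1 - u) - 1)%C with (u / (1 - u))%C by (field; auto).
  rewrite Cmod_div by auto.
  apply Rmult_lt_reg_r with (Cmod (1 - u)%C); [lra|].
  replace (Cmod u / Cmod (1 - u)%C * Cmod (1 - u)%C) with (Cmod u) by (field; lra).
  nra.
Qed.

Lemma Re_peak (kappa : R) (s : C) : 0 < kappa -> halfplane 0 s ->
  0 <= Re (peak kappa s) /\ (Cmod (1 + two_pow s)%C <= kappa -> 1 <= 4 * Re (peak kappa s)).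
Proof.
  intros Hk Hs. pose proof (Cmod_two_pow_lt_1 s Hs) as Hz.
  pose proof (Cmod_ge_0 (two_pow s)) as Hz0.
  assert (Hz2 : Cmod (two_pow s) ^ 2 < 1) by nra.
  rewrite Cmod_sqr in Hz2.
  assert (Hsq : Cmod (1 + two_pow s)%C <= kappa -> Cmod (1 + two_pow s)%C ^ 2 <= kappa ^ 2).
  { intros H. apply pow_incr. split; [apply Cmod_ge_0 | auto]. }
  rewrite Cmod_sqr in Hsq. unfold peak.
  destruct (two_pow s) as [a b]. simpl in Hz2, Hsq |- *.
  (* The squared modulus of kappa + 1 + z, equal to kappa^2 + 2 kappa (1 + a) + |1 + z|^2. *)
  set (D := (kappa + 1 + a) ^ 2 + b ^ 2).
  assert (Ha : -1 < a) by nra.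
  assert (HD : 0 < D) by (unfold D; nra).
  match goal with |- 0 <= ?x /\ _ => replace x with (kappa * (kappa + 1 + a) / D) end.
  2:{ unfold D. field. split; [lra|].
      replace (kappa + 1 + - (-1 * a)) with (kappa + 1 + a) by ring.
      apply Rgt_not_eq. pose proof (pow2_ge_0 b). nra. }
  split.
  - apply Rmult_le_pos; [nra | left; apply Rinv_0_lt_compat; auto].
  - intros H. specialize (Hsq H). apply Rmult_le_reg_r with D; auto.
    replace (4 * (kappa * (kappa + 1 + a) / D) * D) with (4 * (kappa * (kappa + 1 + a)))
      by (field; lra).
    unfold D. nra.
Qed.

(* e^{-d psi} is unimodular on the imaginary axis except at the points where
   2^{-s} = -1; [peak] majorizes the defect near those points and has mean
   kappa / (kappa + 1). *)
Lemma extremal_inner (d eta : R) : 0 <= d -> 0 < eta ->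
  exists sigma0, 0 < sigma0 /\ forall sigma, 0 < sigma < sigma0 ->
    exists N0, forall N, (N0 <= N)%nat ->
      avg (fun i => 1 - Cmod (Cexp (- RtoC d * (extremal_symbol (vpt sigma i) - RtoC (1 / 2)))%C) ^ 2) N
      <= eta.
Proof.
  intros Hd Heta.
  (* Eventually the average of 4 Re [peak] is at most 4 (kappa + eta/16) = eta/2, half of the
     allowance. *)
  set (kappa := eta / 16).
  assert (Hk : 0 < kappa) by (unfold kappa; lra).
  (* Chosen so that 4 d alpha sigma / kappa^2 <= eta/2; the summand 1 covers d = 0. *)
  set (sigma0 := eta * kappa ^ 2 / (8 * (d * alpha + 1))).
  assert (Hda : 0 <= d * alpha) by (apply Rmult_le_pos; lra).
  assert (Hk2 : 0 < kappa ^ 2) by nra.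
  assert (Hs0 : 0 < sigma0).
  { apply Rdiv_lt_0_compat; [apply Rmult_lt_0_compat|]; lra. }
  exists sigma0. split; auto. intros sigma Hs.
  destruct (mean_eventually _ _ (eta / 16)
    (mean_Re_unif (sigma / 2) sigma (peak kappa) _
       (peak_unif kappa (sigma / 2) Hk ltac:(lra)) (peak_infty kappa Hk) ltac:(lra))
    ltac:(lra)) as [N0 HN0].
  exists N0. intros N HN. specialize (HN0 N HN). apply Rabs_lt_between in HN0.
  simpl (Re (RtoC _)) in HN0.
  assert (Hmean : kappa / (kappa + 1) <= kappa).
  { apply Rmult_le_reg_r with (kappa + 1); [lra|].
    replace (kappa / (kappa + 1) * (kappa + 1)) with kappa by (field; lra). nra. }
  apply Rle_trans with
    (avg (fun i => 4 * Re (peak kappa (vpt sigma i)) + eta / 2) N).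
  2:{ rewrite avg_plus, avg_scal, avg_const. unfold kappa in *. lra. }
  apply avg_le. intros i. set (s := vpt sigma i).
  assert (Hh : halfplane 0 s) by (apply halfplane_vpt; lra).
  rewrite Cmod_Cexp_scal, exp_sqr, Re_extremal by auto.
  destruct (Re_peak kappa s Hk Hh) as [Hp0 Hp1].
  set (p := Cmod (1 + two_pow s)%C) in *.
  assert (Hp : 0 < p) by (apply one_plus_two_pow; auto).
  set (q := 1 - Cmod (two_pow s) ^ 2).
  (* Near z = -1 the defect is below 1 and [peak] absorbs it. Elsewhere 1 - e^{-x} <= x and 1 -
     |z|^2 <= 2 sigma make it small. *)
  destruct (Rle_or_lt p kappa) as [Hle|Hlt].
  - specialize (Hp1 Hle).
    pose proof (exp_pos (2 * (- d * (alpha * (q / p ^ 2))))). lra.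
  - pose proof (exp_ineq1_le (2 * (- d * (alpha * (q / p ^ 2))))) as He.
    assert (Hq : q <= 2 * sigma).
    { unfold q, two_pow. rewrite Cmod_npow_neg, exp_sqr.
      change (Re s) with sigma.
      pose proof (exp_ineq1_le (2 * (- sigma * lnS 1))). pose proof lnS_1_bounds. nra. }
    assert (Hqp : q / p ^ 2 <= 2 * sigma / kappa ^ 2).
    { apply Rle_trans with (2 * sigma / p ^ 2).
      - apply Rmult_le_compat_r; [left; apply Rinv_0_lt_compat; nra | auto].
      - apply Rmult_le_compat_l; [lra|]. apply Rinv_le_contravar; nra. }
    assert (Hfin : 2 * (d * alpha) * (2 * sigma / kappa ^ 2) <= eta / 2).
    { apply Rle_trans with (2 * (d * alpha) * (2 * sigma0 / kappa ^ 2)).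
      - apply Rmult_le_compat_l; [lra|]. apply Rmult_le_compat_r; [|lra].
        left; apply Rinv_0_lt_compat; auto.
      - unfold sigma0.
        replace (2 * (d * alpha) * (2 * (eta * kappa ^ 2 / (8 * (d * alpha + 1))) / kappa ^ 2))
          with (eta / 2 * (d * alpha / (d * alpha + 1))) by (field; split; lra).
        rewrite <- (Rmult_1_r (eta / 2)) at 2. apply Rmult_le_compat_l; [lra|].
        apply Rmult_le_reg_r with (d * alpha + 1); [lra|].
        replace (d * alpha / (d * alpha + 1) * (d * alpha + 1)) with (d * alpha) by (field; lra).
        lra. }
    assert (Hm : 2 * (d * alpha) * (q / p ^ 2) <= 2 * (d * alpha) * (2 * sigma / kappa ^ 2))
      by (apply Rmult_le_compat_l; lra).
    replace (2 * (- d * (alpha * (q / p ^ 2)))) with (- (2 * (d * alpha) * (q / p ^ 2))) in * by ring.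
    lra.
Qed.

Let psi (s : C) : C := (extremal_symbol s - RtoC (1 / 2))%C.

(** Each step loses at most B^2 times the mean defect of unimodularity. The order of the limits
    matters: sigma is fixed below a threshold first, and the number of sample points is then taken
    large depending on it. *)
Lemma mean_square_horner_ge (c : nat -> C) (j : nat) : forall k eta, 0 < eta ->
  exists sigma0, 0 < sigma0 /\ forall sigma, 0 < sigma < sigma0 ->
    exists N0, forall N, (N0 <= N)%nat ->
      qform c (w - RtoC (1 / 2))%C j k - eta
      <= avg (fun i => Cmod (horner c (psi (vpt sigma i)) j k) ^ 2) N.
Proof.
  induction j as [|j IH]; intros k eta Heta.
  - exists 1. split; [lra|]. intros sigma _. exists 0%nat. intros N _.
    simpl. rewrite avg_const. lra.
  - destruct (IH (S k) (eta / 4)) as [s1 [Hs1 H1]]; [lra|].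
    destruct (horner_bounded c j (S k)) as [B [HB0 HB]].
    destruct (extremal_inner (gap k) (eta / (4 * (B ^ 2 + 1)))) as [s2 [Hs2 H2]].
    { left; apply gap_pos. }
    { apply Rdiv_lt_0_compat; nra. }
    exists (Rmin s1 s2). split; [apply Rmin_glb_lt; auto|]. intros sigma Hs.
    pose proof (Rmin_l s1 s2). pose proof (Rmin_r s1 s2).
    destruct (H1 sigma ltac:(lra)) as [N1 HN1]. destruct (H2 sigma ltac:(lra)) as [N2 HN2].
    assert (Hu : unif_dpoly (sigma / 2) psi).
    { apply unif_dpoly_plus; [apply extremal_unif; lra | apply unif_dpoly_const]. }
    assert (Hl : lim_infty psi (w - RtoC (1 / 2))%C).
    { apply lim_infty_plus; [apply extremal_infty | apply lim_infty_const]. }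
    destruct (mean_eventually _ _ (eta / 8)
      (mean_cross_term (sigma / 2) sigma c psi _ j k Hu Hl ltac:(lra)) ltac:(lra)) as [N3 HN3].
    exists (Nat.max N1 (Nat.max N2 N3)). intros N HN.
    specialize (HN1 N ltac:(lia)). specialize (HN2 N ltac:(lia)). specialize (HN3 N ltac:(lia)).
    apply Rabs_lt_between in HN3.
    rewrite (avg_horner_step c (fun i => psi (vpt sigma i))). cbn [qform].
    assert (Hc : avg (fun i => Cmod (horner c (psi (vpt sigma i)) j (S k)) ^ 2) N - eta / 4
                 <= avg (fun i => Cmod (Cexp (- RtoC (gap k) * psi (vpt sigma i))
                                     * horner c (psi (vpt sigma i)) j (S k))%C ^ 2) N).
    { assert (Hle : avg (fun i => Cmod (horner c (psi (vpt sigma i)) j (S k)) ^ 2) N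
        <= avg (fun i => Cmod (Cexp (- RtoC (gap k) * psi (vpt sigma i))
                              * horner c (psi (vpt sigma i)) j (S k))%C ^ 2
             + B ^ 2 * (1 - Cmod (Cexp (- RtoC (gap k) * psi (vpt sigma i))%C) ^ 2)) N).
      { apply avg_le. intros i. rewrite Cmod_mult, Rpow_mult_distr.
        assert (Hre : 0 <= Re (psi (vpt sigma i))).
        { pose proof (extremal_range (vpt sigma i) ltac:(apply halfplane_vpt; lra)) as Hr.
          unfold halfplane in Hr. unfold psi.
          change (Re (extremal_symbol (vpt sigma i) - RtoC (1 / 2))%C)
            with (Re (extremal_symbol (vpt sigma i)) - 1 / 2). lra. }
        assert (Hg : Cmod (Cexp (- RtoC (gap k) * psi (vpt sigma i))%C) ^ 2 <= 1).
        { rewrite Cmod_Cexp_scal, exp_sqr, <- exp_0. apply exp_le.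
          pose proof (gap_pos k). nra. }
        assert (Hh : Cmod (horner c (psi (vpt sigma i)) j (S k)) ^ 2 <= B ^ 2).
        { apply pow_incr. split; [apply Cmod_ge_0 | apply HB; auto]. }
        set (g := Cmod (Cexp _) ^ 2) in *. set (h := Cmod (horner _ _ _ _) ^ 2) in *.
        (* Expanded, this reads h <= g h + B^2 (1 - g), up to a nonnegative rearrangement. *)
        assert (0 <= (1 - g) * (B ^ 2 - h)) by (apply Rmult_le_pos; lra). lra. }
      rewrite avg_plus, avg_scal in Hle.
      assert (Hsm : B ^ 2 * avg (fun i => 1 - Cmod (Cexp (- RtoC (gap k) * psi (vpt sigma i))%C) ^ 2) N
                    <= eta / 4).
      { apply Rle_trans with (B ^ 2 * (eta / (4 * (B ^ 2 + 1)))).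
        - apply Rmult_le_compat_l; [apply pow2_ge_0 | exact HN2].
        - pose proof (pow2_ge_0 B).
          apply Rmult_le_reg_r with (4 * (B ^ 2 + 1)); [lra|].
          replace (B ^ 2 * (eta / (4 * (B ^ 2 + 1))) * (4 * (B ^ 2 + 1))) with (B ^ 2 * eta)
            by (field; lra). nra. }
      lra. }
    lra.
Qed.

(** This is n^{i Im w}; it cancels the phases of e^{-gap omega}, so the complex nested sums become
    real ones and the passage to moduli loses nothing. *)
Definition twist (n : nat) : C := Cexp (0, Im w * lnS n).

Lemma twist_conj (n : nat) : (Cconj (twist n) * twist n)%C = RtoC 1.
Proof.
  rewrite Cmult_comm, <- Cmod2_conj. unfold twist. rewrite Cmod_Cexp. simpl.
  rewrite exp_0. f_equal. ring.
Qed.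

Lemma twist_step (k : nat) :
  (Cexp (- RtoC (gap k) * (w - RtoC (1 / 2))) * twist (S k))%C
  = (twist k * RtoC (exp (- gap k * alpha)))%C.
Proof.
  unfold twist. replace (RtoC (exp (- gap k * alpha))) with (Cexp (RtoC (- gap k * alpha))).
  - rewrite <- !Cexp_plus. f_equal. rewrite alpha_eq. destruct w as [x y].
    unfold gap, Cplus, Cmult, Copp, Cminus, RtoC; simpl. f_equal; ring.
  - unfold Cexp, RtoC; simpl. rewrite cos_0, sin_0. f_equal; ring.
Qed.

Lemma horner_twist (y : nat -> R) (j : nat) : forall k,
  horner (fun n => RtoC (y n) * twist n)%C (w - RtoC (1 / 2))%C j k
  = (twist k * RtoC (rhorner y alpha j k))%C.
Proof.
  induction j as [|j IH]; intros k; cbn [horner rhorner].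
  - ring.
  - rewrite IH, Cmult_assoc, twist_step, RtoC_plus, RtoC_mult. ring.
Qed.

Lemma qform_twist (y : nat -> R) (j : nat) : forall k,
  qform (fun n => RtoC (y n) * twist n)%C (w - RtoC (1 / 2))%C j k = rqform y alpha j k.
Proof.
  assert (Hsq : forall k, Cmod (RtoC (y k) * twist k)%C ^ 2 = y k ^ 2).
  { intros k. rewrite Cmod_mult, Cmod_R. unfold twist. rewrite Cmod_Cexp. cbn [Re fst].
    rewrite exp_0, Rmult_1_r. apply pow2_abs. }
  induction j as [|j IH]; intros k; cbn [qform rqform]; [apply Hsq|].
  rewrite Hsq, IH, horner_twist, (Cmult_assoc (Cexp _)), twist_step.
  f_equal. f_equal. f_equal.
  replace (Cconj (RtoC (y k) * twist k) *
             (twist k * RtoC (exp (- gap k * alpha)) * RtoC (rhorner y alpha j (S k))))%C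
    with (RtoC (y k * (exp (- gap k * alpha) * rhorner y alpha j (S k)))); [reflexivity|].
  rewrite !RtoC_mult, Cmult_conj.
  replace (Cconj (RtoC (y k))) with (RtoC (y k)) by (unfold Cconj, RtoC; simpl; f_equal; ring).
  transitivity (RtoC (y k) * (Cconj (twist k) * twist k)
    * RtoC (exp (- gap k * alpha)) * RtoC (rhorner y alpha j (S k)))%C; [|ring].
  rewrite twist_conj. ring.
Qed.

(** Tested on Dirichlet polynomials with coefficients x_n n^{i Im w}: the averages of the image
    approach the quadratic form from below and are bounded by its squared norm, which is at most K^2
    times the sum of x_n^2. *)
Lemma extremal_lower (K : R) : comp_bound extremal_symbol K -> quad_bound alpha (K ^ 2).
Proof.
  intros [HK HB] x M.
  set (a := fun n => (RtoC (x n) * twist n)%C).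
  (* Only the truncation lies in H^2; the nested sum keeps [a], whose entries beyond M it never
     reads. *)
  set (a' := fun n => if Nat.leb n M then a n else RtoC 0).
  assert (Ha0 : forall k, (M < k)%nat -> a' k = RtoC 0).
  { intros k Hk. unfold a'. destruct (Nat.leb_spec k M); [lia | auto]. }
  assert (Ha1 : forall k, (k <= M)%nat -> a' k = a k).
  { intros k Hk. unfold a'. destruct (Nat.leb_spec k M); [auto | lia]. }
  assert (Hsum : forall s, sum_n (dirichlet_term a' s) M = sum_n (dirichlet_term a s) M).
  { intros s. apply sum_n_ext_loc. intros k Hk. unfold dirichlet_term. rewrite Ha1; auto. }
  destruct (ell2_finite a' M Ha0) as [Hl Hn].
  destruct (HB (fun s => sum_n (dirichlet_term a s) M) a') as [b [[Hb Hbs] Hle]].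
  { split; auto. intros s _. apply is_series_C_Clim. rewrite <- Hsum. apply Clim_finite.
    intros k Hk. apply dirichlet_term_0; auto. }
  change (forall s, halfplane (1 / 2) s ->
    is_series (dirichlet_term b s) (comp_partial a extremal_symbol M s)) in Hbs.
  set (F := comp_partial a extremal_symbol M) in *.
  assert (Hxa : ell2_norm a' ^ 2 = sum_n (fun m => x m ^ 2) M).
  { rewrite Hn. apply sum_n_ext_loc. intros k Hk. rewrite Ha1 by auto. unfold a, twist.
    rewrite Cmod_mult, Cmod_R, Cmod_Cexp. cbn [Re fst]. rewrite exp_0, Rmult_1_r. apply pow2_abs. }
  assert (Hcoef : is_coeffs F b).
  { apply is_coeffs_of_series with (B := ell2_norm b ^ 2).
    - intros n. apply ell2_partial; auto.
    - intros s Hs. apply is_series_C_Clim. apply Hbs; auto. }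
  set (c := fun n => (a n * RtoC (exp (- lnS n / 2)))%C).
  assert (Hq : qform c (w - RtoC (1 / 2))%C M 0 = Bsum alpha x x M M).
  { transitivity (rqform (fun n => x n * exp (- lnS n / 2)) alpha M 0).
    - rewrite <- qform_twist. f_equal.
      apply functional_extensionality. intros n. unfold c, a. rewrite RtoC_mult. ring.
    - rewrite rqform_sum. reflexivity. }
  pose proof (ell2_norm_ge_0 b) as Hb0. pose proof (ell2_norm_ge_0 a') as Ha'0.
  assert (Hmain : Bsum alpha x x M M <= ell2_norm b ^ 2).
  { apply le_epsilon. intros eta Heta. rewrite <- Hq.
    destruct (mean_square_horner_ge c M 0 (eta / 2)) as [s0 [Hs0 H0]]; [lra|].
    set (sigma := s0 / 2). destruct (H0 sigma) as [N1 HN1]; [unfold sigma; lra|].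
    set (e := Rmin 1 (sigma / 2)).
    assert (Hsg : 0 < sigma) by (unfold sigma; lra).
    assert (He : 0 < e) by (apply Rmin_glb_lt; lra).
    assert (He1 : e <= 1) by apply Rmin_l.
    assert (He2 : e <= sigma / 2) by apply Rmin_r.
    destruct (coeffs_parseval_le e sigma (ell2_norm b ^ 2) F b) with (eta := eta / 2)
      as [N2 HN2]; auto; try lra.
    - apply pow2_ge_0.
    - apply comp_partial_unif; auto. apply extremal_unif.
    (* The weights are at most 1 for sigma > 0, so the norm of [b] bounds every weighted sum. *)
    - intros n. apply Rle_trans with (sum_n (fun k => Cmod (b k) ^ 2) n).
      + apply sumR_le. intros k _. rewrite <- (Rmult_1_r (Cmod (b k) ^ 2)) at 2.
        apply Rmult_le_compat_l; [apply pow2_ge_0|]. unfold wt. rewrite <- exp_0.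
        apply exp_le. pose proof (lnS_ge_0 k). nra.
      + apply ell2_partial; auto.
    - specialize (HN1 (Nat.max N1 N2) ltac:(lia)). specialize (HN2 (Nat.max N1 N2) ltac:(lia)).
      rewrite (avg_ext _ (fun i => Cmod (horner c (psi (vpt sigma i)) M 0) ^ 2)) in HN2.
      + lra.
      + intros i. unfold F. rewrite comp_partial_horner. reflexivity. }
  apply Rle_trans with (1 := Hmain). rewrite <- Hxa, <- Rpow_mult_distr.
  apply pow_incr. auto.
Qed.

End Extremal.

(** Along the positive real axis c0 s grows without bound if c0 >= 1, while phi0 stays bounded on
    C_1. *)
Lemma finite_limit_c0_zero (phi phi0 : C -> C) (c : nat -> C) (c0 : nat) (w : C) :
  (forall s, halfplane 0 s -> phi s = (RtoC (INR c0) * s + phi0 s)%C) ->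
  dirichlet_cv_unif c (halfplane 1) phi0 -> lim_infty phi w -> c0 = 0%nat.
Proof.
  intros Hphi Hcv Hlim. destruct (Nat.eq_dec c0 0) as [|Hc0]; auto. exfalso.
  destruct (unif_dpoly_bounded 1 phi0 (unif_dpoly_of_cv _ _ _ Hcv)) as [B [HB0 HB]].
  destruct (Hlim 1 ltac:(lra)) as [M HM].
  (* Beyond M, and larger than |w| + B + 1, which the limit allows as a bound for c0 x. *)
  set (x := Rmax M 1 + Cmod w + B + 1).
  pose proof (Rmax_l M 1). pose proof (Rmax_r M 1). pose proof (Cmod_ge_0 w).
  assert (Hx : Rmax M 1 + 1 <= x) by (unfold x; lra).
  specialize (HM (RtoC x) ltac:(simpl; lra)).
  specialize (HB (RtoC x) ltac:(unfold halfplane; simpl; lra)).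
  rewrite Hphi in HM by (unfold halfplane; simpl; lra).
  pose proof (Cmod_le_of_close (RtoC (INR c0) * RtoC x)%C (w - phi0 (RtoC x))%C) as H3.
  replace (RtoC (INR c0) * RtoC x - (w - phi0 (RtoC x)))%C
    with (RtoC (INR c0) * RtoC x + phi0 (RtoC x) - w)%C in H3 by ring.
  pose proof (Cmod_triangle w (- phi0 (RtoC x))%C) as H4. rewrite Cmod_opp in H4.
  rewrite <- RtoC_mult, Cmod_R in H3.
  assert (H5 : 1 <= INR c0) by (apply (le_INR 1); lia).
  assert (H6 : x <= Rabs (INR c0 * x)) by (apply Rle_trans with (2 := Rle_abs _); nra).
  rewrite RtoC_mult in H3. unfold Cminus in *. unfold x in H6 at 1. lra.
Qed.

Theorem theorem2 (w : C) (hw : halfplane (1 / 2) w) :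
  exists N : R,
    is_B_norm (Re w - 1 / 2) N /\
    Rbar_lub (fun x : Rbar =>
      exists phi : C -> C,
        gordon_hedenmalm phi /\ value_at_infty phi w /\ x = comp_norm phi)
    = Finite (sqrt N).
Proof.
  set (alpha := Re w - 1 / 2). unfold halfplane in hw.
  assert (Ha : 0 < alpha) by (unfold alpha; lra).
  destruct (quad_bound_least alpha Ha) as [N [HN Hmin]].
  exists N. split; [apply is_B_norm_least; auto|].
  apply Rbar_is_lub_unique. split.
  - intros x [phi [[c0 [c [phi0 [Hphi [Hcv [H0 _]]]]]] [Hinf ->]]].
    apply value_at_infty_iff in Hinf.
    (* Once c0 = 0, phi agrees with phi0 on C_0 and condition (a) places its range in C_{1/2}. *)
    pose proof (finite_limit_c0_zero phi phi0 c c0 w Hphi (Hcv 1 Rlt_0_1) Hinf) as Hc0. subst c0.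
    assert (Heq : forall s, halfplane 0 s -> phi s = phi0 s).
    { intros s Hs. rewrite Hphi by auto. simpl. ring. }
    apply (proj1 (Glb_Rbar_correct (comp_bound phi))).
    split; [apply sqrt_pos|]. intros f a Hf.
    apply (composition_bounded phi w N); auto.
    + intros e He. apply unif_dpoly_ext with phi0.
      * intros s Hs. symmetry. apply Heq. unfold halfplane in *; lra.
      * apply unif_dpoly_of_cv with c. auto.
    + intros s Hs. rewrite Heq by auto. apply H0; auto.
  - intros y Hy. apply Rbar_le_trans with (comp_norm (extremal_symbol w alpha)).
    + apply (proj2 (Glb_Rbar_correct (comp_bound (extremal_symbol w alpha)))).
      (* K^2 is admissible for the quadratic form, so N <= K^2 by minimality of N. *)
      intros K HK. simpl. pose proof (Hmin _ (extremal_lower w alpha Ha eq_refl K HK)) as H.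
      rewrite <- (sqrt_pow2 K) by apply HK. apply sqrt_le_1_alt; auto.
    + apply Hy. exists (extremal_symbol w alpha). split; [apply extremal_in_class; auto|].
      split; [apply value_at_infty_iff; apply extremal_infty; auto | auto].
Qed.
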